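(* Let $X$ be a toric variety over $k$ with torus $T$, that is, an irreducible separated algebraic variety equipped with a good action of an algebraic torus $T$ embedded in $X$ as a Zariski open set, such that the action of $T$ on $X$ extends the action of $T$ on itself by multiplication. Then there exist a triple $(N,\Sigma,\Gamma)$ (a lattice $N$ with dual lattice $M$, a fan with attached family of semigroups) and an isomorphism $\varphi:T\to T^M$ such that the pair $(T,X)$ is equivariantly isomorphic to $(T^M,T^\Gamma_\Sigma)$ with respect to $\varphi$.
   Context: $k$ is an algebraically closed field. An action of a group on an algebraic variety $X$ is good if $X$ is covered by a finite number of affine open subsets which are invariant under the action. For a lattice $N$ with dual $M=\mathrm{Hom}(N,\mathbb Z)$, $T^M=\mathrm{Spec}\,k[t^M]$ is the associated torus, and for a finitely generated semigroup $\Lambda\subset M$ (containing $0$), $T^\Lambda=\mathrm{Spec}\,k[t^\Lambda]$. For a cone $\sigma\subset N_{\mathbb R}$, $\check\sigma\subset M_{\mathbb R}$ is its dual cone and $\tau^\perp=\{m\in M_{\mathbb R}\mid\langle\nu,m\rangle=0\ \forall\nu\in\tau\}$; $\tau\leq\sigma$ means $\tau$ is a face of $\sigma$. For a semigroup $\Lambda\subset M$ with $\mathbb R_{\geq0}\Lambda=\check\sigma$ and $\tau\leq\sigma$, $M(\tau,\Lambda)$ is the sublattice of $M$ generated by $\Lambda\cap\tau^\perp$. A fan in $N_{\mathbb R}$ is a finite set of strictly convex rational polyhedral cones, closed under taking faces, such that the intersection of any two of its cones is a cone of the fan and a face of each. A triple $(N,\Sigma,\Gamma)$ consists of a lattice $N$,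 a fan $\Sigma$ in $N_{\mathbb R}$ and a family $\Gamma=\{\Gamma_\sigma\subset\check\sigma\cap M\}_{\sigma\in\Sigma}$ of finitely generated subsemigroups of $M$ such that: (i) $\mathbb Z\Gamma_\sigma=M$ and $\mathbb R_{\geq0}\Gamma_\sigma=\check\sigma$ for all $\sigma\in\Sigma$; (ii) $\Gamma_\tau=\Gamma_\sigma+M(\tau,\Gamma_\sigma)$ for all $\sigma\in\Sigma$ and all faces $\tau\leq\sigma$. The variety $T^\Gamma_\Sigma$ is the union of the affine varieties $T^{\Gamma_\sigma}$, $\sigma\in\Sigma$, where $T^{\Gamma_\sigma}$ and $T^{\Gamma_{\sigma'}}$ are glued along their common open affine variety $T^{\Gamma_{\sigma\cap\sigma'}}$. The torus $T^M$ acts on it, through $k[t^{\Gamma_\sigma}]\to k[t^M]\otimes_k k[t^{\Gamma_\sigma}]$, $t^\gamma\mapsto t^\gamma\otimes t^\gamma$. *)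

(* Defs.v *)
From HB Require Import structures.
From Stdlib Require Import Relation_Operators.
From mathcomp Require Import all_boot all_order all_algebra finmap.
From mathcomp Require Import generic_quotient.
From mathcomp Require Import boolp classical_sets functions cardinality.
From mathcomp Require Import reals topology.
From mathcomp.multinomials Require Import monalg.

Set Implicit Arguments.
Unset Strict Implicit.
Unset Printing Implicit Defensive.

Import Order.TTheory GRing.Theory Num.Theory.

Local Open Scope classical_set_scope.
Local Open Scope ring_scope.

(* A space with functions: a topological space with a sheaf of k-algebras of
   k-valued functions such that, for f regular on U, the locus f != 0 is open
   and 1/f is regular there.  Functions are total; [regular U f] only depends
   on the values of f on U, and is meaningful for U open. *)
Record fspace (k : fieldType) := FSpace {
  fspace_space :> topologicalType;
  regular : set fspace_space -> set (fspace_space -> k);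
  regular_ext : forall U f g, open U -> {in U, f =1 g} ->
    regular U f -> regular U g;
  regular_sub : forall U V f, open U -> open V -> V `<=` U ->
    regular U f -> regular V f;
  regular_glue : forall U f, open U ->
    (forall x, U x -> exists V, [/\ open V, V x, V `<=` U & regular V f]) ->
    regular U f;
  regular_cst : forall U c, open U -> regular U (fun=> c);
  regularD : forall U f g, open U -> regular U f -> regular U g ->
    regular U (fun x => f x + g x);
  regularM : forall U f g, open U -> regular U f -> regular U g ->
    regular U (fun x => f x * g x);
  regularV : forall U f, open U -> regular U f ->
    open (U `&` [set x | f x != 0]) /\
    regular (U `&` [set x | f x != 0]) (fun x => (f x)^-1) }.

(* The space with functions whose regular functions are, near each x, the
   fractions of functions in P x. *)
Section LocalFractions.
Context (k : fieldType) (X : topologicalType) (P : X -> set (X -> k)).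
Hypothesis P_cst : forall x c, P x (fun=> c).
Hypothesis P_add : forall x f g, P x f -> P x g -> P x (fun y => f y + g y).
Hypothesis P_mul : forall x f g, P x f -> P x g -> P x (fun y => f y * g y).
Hypothesis P_neq0 : forall x f, P x f -> f x != 0 -> \forall y \near x, f y != 0.

Definition local_fraction (U : set X) (f : X -> k) := forall x, U x ->
  exists a b, [/\ P x a, P x b & \forall y \near x, b y != 0 /\ f y = a y / b y].

Program Definition fraction_space : fspace k :=
  @FSpace k X local_fraction _ _ _ _ _ _ _.
Next Obligation.
move=> U f g oU fg rf x Ux; have [a [b [Pa Pb ab]]] := rf x Ux.
exists a, b; split=> //; near=> y.
have Uy : U y by near: y; exact: open_nbhs_nbhs.
by rewrite -fg ?inE//; near: y.
Unshelve. all: by end_near. Qed.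
Next Obligation. by move=> U V f _ _ VU rf x /VU; exact: rf. Qed.
Next Obligation. by move=> U f _ rf x /rf[V [_ Vx _]]; exact. Qed.
Next Obligation.
move=> U c _ x _; exists (fun=> c), (fun=> 1); split=> //.
by near=> y; rewrite oner_eq0 divr1.
Unshelve. all: by end_near. Qed.
Next Obligation.
move=> U f g _ rf rg x Ux.
have [a [b [Pa Pb ab]]] := rf x Ux; have [c [d [Pc Pd cd]]] := rg x Ux.
exists (fun y => a y * d y + c y * b y), (fun y => b y * d y); split.
- by apply: P_add; apply: P_mul.
- exact: P_mul.
near=> y.
have [by0 ->] : b y != 0 /\ f y = a y / b y by near: y.
have [dy0 ->] : d y != 0 /\ g y = c y / d y by near: y.
by rewrite mulf_neq0// addf_div.
Unshelve. all: by end_near. Qed.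
Next Obligation.
move=> U f g _ rf rg x Ux.
have [a [b [Pa Pb ab]]] := rf x Ux; have [c [d [Pc Pd cd]]] := rg x Ux.
exists (fun y => a y * c y), (fun y => b y * d y); split; try exact: P_mul.
near=> y.
have [by0 ->] : b y != 0 /\ f y = a y / b y by near: y.
have [dy0 ->] : d y != 0 /\ g y = c y / d y by near: y.
by rewrite mulf_neq0// mulf_div.
Unshelve. all: by end_near. Qed.
Next Obligation.
move=> U f oU rf; have near_nz x : U x -> f x != 0 ->
    exists a b, [/\ P x a, P x b &
      \forall y \near x, [/\ U y, f y != 0, a y != 0 & (f y)^-1 = b y / a y]].
  move=> Ux fx0; have [a [b [Pa Pb ab]]] := rf x Ux; exists a, b; split=> //.
  have [bx0 fx] := nbhs_singleton ab.
  have ax0 : a x != 0 by apply: contraNneq fx0 => ax; rewrite fx ax mul0r.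
  near=> y.
  have [by0 fy] : b y != 0 /\ f y = a y / b y by near: y.
  have ay0 : a y != 0 by near: y; exact: P_neq0.
  split=> //; last by rewrite fy invf_div.
    by near: y; exact: open_nbhs_nbhs.
  by rewrite fy mulf_neq0// invr_neq0.
split.
  rewrite openE => x [Ux fx0]; have [a [b [_ _ H]]] := near_nz x Ux fx0.
  by apply: filterS H => y [].
move=> x [Ux fx0]; have [a [b [Pa Pb H]]] := near_nz x Ux fx0.
by exists b, a; split=> //; apply: filterS H => y [].
Unshelve. all: by end_near. Qed.

End LocalFractions.

Section Morphisms.
Context (k : fieldType).
Implicit Types X Y : fspace k.

Definition morphism X Y (f : X -> Y) : Prop := continuous f /\
  forall (V : set Y) (g : Y -> k), open V -> regular V g ->
    regular (f @^-1` V) (g \o f).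

Definition isomorphism X Y (f : X -> Y) : Prop :=
  exists g : Y -> X, [/\ morphism f, morphism g, cancel f g & cancel g f].

(* f is an isomorphism onto an open subspace of Y. *)
Definition open_immersion X Y (f : X -> Y) : Prop :=
  [/\ morphism f, injective f,
      forall U : set X, open U -> open (f @` U) &
      forall (U : set X) (g : Y -> k), open U -> regular U (g \o f) ->
        regular (f @` U) g].

End Morphisms.

Section Affine.
Context (k : fieldType) (A : comAlgType k).

(* For k algebraically closed and A finitely generated, these are the closed
   points of Spec A (Nullstellensatz), which are all the points of Spec A as a
   classical variety. *)
Definition spec : Type := {lrmorphism A -> k^o}.

Definition ev (a : A) (x : spec) : k := (x : {lrmorphism A -> k^o}) a.

Lemma spec_ext (x y : spec) : ev^~ x =1 ev^~ y -> x = y.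
Proof.
case: x => x cx; case: y => y cy xy.
have {}xy : x = y by apply/funext.
case: _ / xy in cy *; congr GRing.LRMorphism.Pack.
case: cx => [[a] [b] [c]]; case: cy => [[a'] [b'] [c']].
by congr GRing.LRMorphism.Class; congr (_ _); exact: Prop_irrelevance.
Qed.

HB.instance Definition _ := gen_eqMixin spec.
HB.instance Definition _ := gen_choiceMixin spec.

Definition zariski_open : set_system spec := [set U | forall x, U x ->
  exists a, ev a x != 0 /\ [set y | ev a y != 0] `<=` U].

Let zariski_openT : zariski_open setT.
Proof. by move=> x _; exists 1; rewrite /ev rmorph1 oner_neq0. Qed.

Let zariski_openI : setI_closed zariski_open.
Proof.
move=> U V oU oV x [/oU[a [ax aU]] /oV[b [bx bV]]]; exists (a * b).
rewrite /ev rmorphM mulf_neq0//; split=> // y /=; rewrite rmorphM mulf_eq0.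
by move=> /norP[ay by_]; split; [exact: aU|exact: bV].
Qed.

Let zariski_open_bigU (I : Type) (U : I -> set spec) :
  (forall i, zariski_open (U i)) -> zariski_open (\bigcup_i U i).
Proof.
move=> oU x [i _ /oU[a [ax aU]]]; exists a; split=> // y /aU Uy.
by exists i.
Qed.

HB.instance Definition _ :=
  isOpenTopological.Build spec zariski_openT zariski_openI zariski_open_bigU.

Definition polyfun (x : spec) : set (spec -> k) := range ev.

Let polyfun_cst x c : polyfun x (fun=> c).
Proof.
exists c%:A => //; apply/funext => y; rewrite /ev linearZ/= rmorph1.
exact: mulr1.
Qed.

Let polyfun_add x f g :
  polyfun x f -> polyfun x g -> polyfun x (fun y => f y + g y).
Proof.
move=> [a _ <-] [b _ <-]; exists (a + b) => //.
by apply/funext => y; rewrite /ev rmorphD.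
Qed.

Let polyfun_mul x f g :
  polyfun x f -> polyfun x g -> polyfun x (fun y => f y * g y).
Proof.
move=> [a _ <-] [b _ <-]; exists (a * b) => //.
by apply/funext => y; rewrite /ev rmorphM.
Qed.

Let polyfun_neq0 x f :
  polyfun x f -> f x != 0 -> \forall y \near x, f y != 0.
Proof.
move=> [a _ <-] ax; have oa : open [set y | ev a y != 0].
  by move=> y /= ay; exists a; split.
exact: (open_nbhs_nbhs (conj oa ax)).
Qed.

(* Spec A with its Zariski topology and the functions that are locally
   fractions of elements of A. *)
Definition affine : fspace k :=
  fraction_space polyfun_cst polyfun_add polyfun_mul polyfun_neq0.

Definition finitely_generated_algebra : Prop := exists s : seq A,
  smallest (fun B : set A => subalg_closed (mem B)) [set` s] = setT.

End Affine.

Section Product.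
Context (k : fieldType) (X Y : fspace k).

(* The carrier of the product variety; its Zariski topology is finer than the
   product topology carried by X * Y. *)
Definition prod_pt : Type := (X * Y)%type.
HB.instance Definition _ := Choice.on prod_pt.

(* The image of O(U) (x) O(V) in the functions on X * Y. *)
Definition tensor (U : set X) (V : set Y) : set (prod_pt -> k) :=
  [set h | exists s : seq ((X -> k) * (Y -> k)),
     (forall fg, fg \in s -> regular U fg.1 /\ regular V fg.2) /\
     h = (fun p => \sum_(fg <- s) fg.1 p.1 * fg.2 p.2)].

Definition tensor_at (p : prod_pt) : set (prod_pt -> k) :=
  [set h | exists U V,
     [/\ open U, open V, U p.1 /\ V p.2 & tensor U V h]].

Definition prod_open : set_system prod_pt := [set W | forall p, W p ->
  exists (U : set X) (V : set Y) h,
    [/\ open U, open V, tensor U V h, [/\ U p.1, V p.2 & h p != 0] &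
        [set q | [/\ U q.1, V q.2 & h q != 0]] `<=` W]].

Let tensor_cst U V c : open U -> open V -> tensor U V (fun=> c).
Proof.
move=> oU oV; exists [:: (fun=> c, fun=> 1)]; split.
  by move=> fg; rewrite inE => /eqP->; split; exact: regular_cst.
by apply/funext => p; rewrite big_seq1 mulr1.
Qed.

Let tensor_add U V f g :
  tensor U V f -> tensor U V g -> tensor U V (fun y => f y + g y).
Proof.
move=> [s [rs ->]] [t [rt ->]]; exists (s ++ t); split.
  by move=> fg; rewrite mem_cat => /orP[/rs|/rt].
by apply/funext => p; rewrite big_cat.
Qed.

Let tensor_mul U V f g : open U -> open V ->
  tensor U V f -> tensor U V g -> tensor U V (fun y => f y * g y).
Proof.
move=> oU oV [s [rs ->]] [t [rt ->]].
exists [seq ((fun x => a.1 x * b.1 x), (fun y => a.2 y * b.2 y))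
       | a <- s, b <- t]; split.
  move=> _ /allpairsP[[a b] [/= /rs[? ?] /rt[? ?] ->]].
  by split; exact: regularM.
apply/funext => p; rewrite big_allpairs_dep big_distrlr /=.
by apply: eq_bigr => a _; apply: eq_bigr => b _; rewrite mulrACA.
Qed.

Let tensor_sub U V U' V' f : open U -> open V -> open U' -> open V' ->
  U' `<=` U -> V' `<=` V -> tensor U V f -> tensor U' V' f.
Proof.
move=> oU oV oU' oV' UU VV [s [rs ->]]; exists s; split=> // fg /rs[? ?].
by split; [exact: regular_sub UU _|exact: regular_sub VV _].
Qed.

Let prod_openT : prod_open setT.
Proof.
move=> p _; exists setT, setT, (fun=> 1); split=> //; try exact: openT.
  by apply: tensor_cst; exact: openT.
by split=> //; rewrite oner_neq0.
Qed.

Let prod_openI : setI_closed prod_open.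
Proof.
move=> W W' oW oW' p [].
move=> /oW[U [V [h [oU oV th [Up Vp hp] UVW]]]].
move=> /oW'[U' [V' [h' [oU' oV' th' [Up' Vp' hp'] UVW']]]].
have oUU := openI oU oU'; have oVV := openI oV oV'.
exists (U `&` U'), (V `&` V'), (fun q => h q * h' q); split=> //.
- by apply: tensor_mul => //; [move: th|move: th']; apply: tensor_sub => // ? [].
- by split=> //; rewrite mulf_neq0.
move=> q /= [[Uq Uq'] [Vq Vq']]; rewrite mulf_eq0 => /norP[hq hq'].
by split; [exact: UVW|exact: UVW'].
Qed.

Let prod_open_bigU (I : Type) (W : I -> set prod_pt) :
  (forall i, prod_open (W i)) -> prod_open (\bigcup_i W i).
Proof.
move=> oW p [i _ /oW[U [V [h [oU oV th hp UVW]]]]].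
by exists U, V, h; split=> // q /UVW Wq; exists i.
Qed.

HB.instance Definition _ :=
  isOpenTopological.Build prod_pt prod_openT prod_openI prod_open_bigU.

Let tensor_at_cst p c : tensor_at p (fun=> c).
Proof.
exists setT, setT; split=> //; try exact: openT.
by apply: tensor_cst; exact: openT.
Qed.

Let tensor_at_both p f g : tensor_at p f -> tensor_at p g ->
  exists U V, [/\ open U, open V, U p.1 /\ V p.2, tensor U V f & tensor U V g].
Proof.
move=> [U [V [oU oV [Up Vp] tf]]] [U' [V' [oU' oV' [Up' Vp'] tg]]].
have oUU := openI oU oU'; have oVV := openI oV oV'.
exists (U `&` U'), (V `&` V'); split=> //.
- by move: tf; apply: tensor_sub => // ? [].
- by move: tg; apply: tensor_sub => // ? [].
Qed.

Let tensor_at_add p f g :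
  tensor_at p f -> tensor_at p g -> tensor_at p (fun y => f y + g y).
Proof.
move=> /tensor_at_both/[apply] -[U [V [oU oV UVp tf tg]]].
by exists U, V; split=> //; exact: tensor_add.
Qed.

Let tensor_at_mul p f g :
  tensor_at p f -> tensor_at p g -> tensor_at p (fun y => f y * g y).
Proof.
move=> /tensor_at_both/[apply] -[U [V [oU oV UVp tf tg]]].
by exists U, V; split=> //; exact: tensor_mul.
Qed.

Let tensor_at_neq0 p f :
  tensor_at p f -> f p != 0 -> \forall q \near p, f q != 0.
Proof.
move=> [U [V [oU oV [Up Vp] tf]]] fp.
have oW : open [set q : prod_pt | [/\ U q.1, V q.2 & f q != 0]].
  by move=> q qW; exists U, V, f; split=> //; case: qW.
have Wp : [set q : prod_pt | [/\ U q.1, V q.2 & f q != 0]] p by [].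
by apply: filterS (open_nbhs_nbhs (conj oW Wp)) => q [].
Qed.

Definition product : fspace k :=
  fraction_space tensor_at_cst tensor_at_add tensor_at_mul tensor_at_neq0.

End Product.

Section Varieties.
Context (k : fieldType).
Implicit Types X : fspace k.

Definition affine_open X (U : set X) : Prop := open U /\
  exists (A : comAlgType k) (f : affine A -> X),
    [/\ finitely_generated_algebra A, open_immersion f & range f = U].

Definition algebraic_variety X : Prop :=
  exists (n : nat) (U : 'I_n -> set X),
    (forall i, affine_open (U i)) /\ \bigcup_i U i = setT.

Definition separated X : Prop :=
  closed [set p : product X X | p.1 = p.2].

Definition irreducible X : Prop := [set: X] !=set0 /\
  forall F G : set X, closed F -> closed G -> F `|` G = setT ->
    F = setT \/ G = setT.

Record alg_group := AlgGroup {
  group_variety :> fspace k;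
  group_mul : group_variety -> group_variety -> group_variety;
  group_one : group_variety;
  group_inv : group_variety -> group_variety;
  group_is_variety : algebraic_variety group_variety;
  group_mulA : associative group_mul;
  group_mul1 : left_id group_one group_mul;
  group_mulV : left_inverse group_one group_inv group_mul;
  group_mul_morphism : morphism
    (fun p : product group_variety group_variety => group_mul p.1 p.2);
  group_inv_morphism : morphism group_inv }.

Definition algebraic_action (G : alg_group) X (act : G -> X -> X) : Prop :=
  [/\ forall x, act (group_one G) x = x,
      forall s t x, act (group_mul s t) x = act s (act t x) &
      morphism (fun p : product G X => act p.1 p.2)].

Definition good_action (G : alg_group) X (act : G -> X -> X) : Prop :=
  exists (n : nat) (U : 'I_n -> set X),
    [/\ forall i, affine_open (U i), \bigcup_i U i = setT &
        forall i t x, U i x -> U i (act t x)].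

End Varieties.

Section SemigroupAlgebra.
Context (k : fieldType) (L : nmodType).

(* k[t^L]; the product of [{malg k[L]}] in the library is restricted to
   monoids without invertible elements. *)
Definition sgalg : Type := {malg k[L]}.
HB.instance Definition _ := GRing.Lmodule.on sgalg.

Definition tmon (a : L) : sgalg := << a >>.

Definition sgalg_mul (p q : sgalg) : sgalg :=
  \sum_(a <- msupp p) \sum_(b <- msupp q) << p@_a * q@_b *g a + b >>.

Let mulwE (d e : {fset L}) (p q : sgalg) :
  (msupp p `<=` d)%fset -> (msupp q `<=` e)%fset ->
  sgalg_mul p q = \sum_(a <- d) \sum_(b <- e) << p@_a * q@_b *g a + b >>.
Proof.
move=> pd qe; rewrite /sgalg_mul (big_fset_incl _ pd) /=.
  apply/eq_bigr => a _; apply/big_fset_incl => // b _ /mcoeff_outdom ->.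
  by rewrite mulr0 monalgU0.
move=> a _ /mcoeff_outdom pa; rewrite big1 // => b _.
by rewrite pa mul0r monalgU0.
Qed.

Let mulUU c d a b : sgalg_mul << c *g a >> << d *g b >> = << c * d *g a + b >>.
Proof. by rewrite (mulwE msuppU_le msuppU_le) !big_seq_fset1 !mcoeffUU. Qed.

Let mulC : commutative sgalg_mul.
Proof.
move=> p q; rewrite /sgalg_mul exchange_big /=.
by apply: eq_bigr => a _; apply: eq_bigr => b _; rewrite mulrC addrC.
Qed.

Let mulDl : left_distributive sgalg_mul +%R.
Proof.
move=> p q r.
rewrite [in RHS](mulwE (fsubsetUl _ (msupp q)) (fsubset_refl _)).
rewrite [in RHS](mulwE (fsubsetUr (msupp p) _) (fsubset_refl _)).
rewrite (mulwE (msuppD_le _ _) (fsubset_refl _)) -big_split /=.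
apply/eq_bigr=> a _; rewrite -big_split /=; apply/eq_bigr => b _.
by rewrite mcoeffD mulrDl monalgUD.
Qed.

Let mul0 : left_zero 0 sgalg_mul.
Proof. by move=> p; rewrite /sgalg_mul msupp0 big_seq_fset0. Qed.

Let mul_suml I (s : seq I) (F : I -> sgalg) q :
  sgalg_mul (\sum_(i <- s) F i) q = \sum_(i <- s) sgalg_mul (F i) q.
Proof. exact: (big_morph (sgalg_mul^~ q) (fun _ _ => mulDl _ _ _) (mul0 q)). Qed.

Let mul_sumr I (s : seq I) (F : I -> sgalg) q :
  sgalg_mul q (\sum_(i <- s) F i) = \sum_(i <- s) sgalg_mul q (F i).
Proof. by rewrite mulC mul_suml; apply: eq_bigr => i _; rewrite mulC. Qed.

Let mul1 : left_id (tmon 0) sgalg_mul.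
Proof.
move=> p; rewrite [in LHS](monalgE p) mul_sumr [RHS]monalgE.
by apply: eq_bigr => a _; rewrite mulUU mul1r add0r.
Qed.

Let mulA : associative sgalg_mul.
Proof.
move=> p q r; rewrite (monalgE p).
rewrite [LHS]mul_suml [X in _ = sgalg_mul X r]mul_suml [RHS]mul_suml.
apply: eq_bigr => a _; rewrite (monalgE q).
rewrite [X in sgalg_mul _ X = _]mul_suml [LHS]mul_sumr.
rewrite [X in _ = sgalg_mul X r]mul_sumr [RHS]mul_suml.
apply: eq_bigr => b _; rewrite (monalgE r).
rewrite [X in sgalg_mul _ X = _]mul_sumr [LHS]mul_sumr [RHS]mul_sumr.
apply: eq_bigr => c _.
by rewrite !mulUU mulrA addrA.
Qed.

Let one_neq0 : tmon 0 != 0 :> sgalg.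
Proof. by rewrite /tmon monalgU_eq0 oner_neq0. Qed.

HB.instance Definition _ := GRing.Zmodule_isComNzRing.Build sgalg
  mulA mulC mul1 mulDl one_neq0.

Let scaleAl c (p q : sgalg) : c *: (p * q) = (c *: p) * q.
Proof.
have scaleU d a : c *: (<< d *g a >> : sgalg) = << c * d *g a >>.
  by apply/malgP => b; rewrite mcoeffZ !mcoeffU mulrnAr.
have sumE (g : sgalg) : g = \sum_(a <- msupp g) (<< g@_a *g a >> : sgalg).
  exact: monalgE.
rewrite (sumE p) mulr_suml !scaler_sumr mulr_suml; apply: eq_bigr => a _.
rewrite (sumE q) !mulr_sumr scaler_sumr; apply: eq_bigr => b _.
by rewrite scaleU /GRing.mul/= !mulUU scaleU mulrA.
Qed.

HB.instance Definition _ := GRing.Lmodule_isLalgebra.Build k sgalg scaleAl.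
HB.instance Definition _ := GRing.Lalgebra_isComAlgebra.Build k sgalg.

Lemma tmon0 : tmon 0 = 1. Proof. by []. Qed.

Lemma tmonD a b : tmon (a + b) = tmon a * tmon b.
Proof. by rewrite /GRing.mul/= mulUU mulr1. Qed.

Lemma sgalgE (p : sgalg) : p = \sum_(a <- msupp p) p@_a *: tmon a.
Proof.
rewrite {1}(monalgE p); apply: eq_bigr => a _.
by apply/malgP => b; rewrite mcoeffZ !mcoeffU mulrnAr mulr1.
Qed.

(* The point of Spec k[t^L] given by a character of L. *)
Section Character.
Variable chi : L -> k.
Hypothesis chi0 : chi 0 = 1.
Hypothesis chiD : forall a b, chi (a + b) = chi a * chi b.

Definition char_eval (p : sgalg) : k^o := \sum_(a <- msupp p) p@_a * chi a.

Lemma char_evalE (d : {fset L}) (p : sgalg) :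
  (msupp p `<=` d)%fset -> char_eval p = \sum_(a <- d) p@_a * chi a.
Proof.
move=> pd; apply: big_fset_incl => // a _ /mcoeff_outdom ->.
by rewrite mul0r.
Qed.

Let char_eval_add p q : char_eval (p + q) = char_eval p + char_eval q.
Proof.
rewrite (char_evalE (msuppD_le p q)) (char_evalE (fsubsetUl (msupp p) (msupp q))).
rewrite (char_evalE (fsubsetUr (msupp p) (msupp q))) -big_split/=.
by apply: eq_bigr => a _; rewrite mcoeffD mulrDl.
Qed.

Let char_eval0 : char_eval 0 = 0.
Proof. by rewrite /char_eval msupp0 big_seq_fset0. Qed.

Let char_eval_nmod : nmod_morphism char_eval.
Proof. by split; [exact: char_eval0|exact: char_eval_add]. Qed.

HB.instance Definition _ :=
  GRing.isNmodMorphism.Build sgalg k^o char_eval char_eval_nmod.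

Let char_evalZ : scalable char_eval.
Proof.
move=> c p; rewrite (char_evalE (msuppZ_le c p)) /char_eval.
rewrite /GRing.scale/= mulr_sumr; apply: eq_bigr => a _.
by rewrite mcoeffZ mulrA.
Qed.

HB.instance Definition _ :=
  GRing.isScalable.Build k sgalg k^o *:%R char_eval char_evalZ.

Lemma char_eval_tmon a : char_eval (tmon a) = chi a.
Proof. by rewrite (char_evalE msuppU_le) big_seq_fset1 mcoeffUU mul1r. Qed.

Let tmon_mul_linear (phi : {linear sgalg -> k^o}) :
  (forall a, phi (tmon a) = chi a) ->
  forall p q, phi (p * q) = (phi p : k) * (phi q : k).
Proof.
move=> phiE p q.
have phiZ c x : phi (c *: x) = c * (phi x : k) by rewrite linearZ.
rewrite (sgalgE p) mulr_suml !linear_sum mulr_suml; apply: eq_bigr => a _.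
rewrite -scalerAl !phiZ (sgalgE q) mulr_sumr !linear_sum !mulr_sumr.
by apply: eq_bigr => b _; rewrite -scalerAr !phiZ -tmonD !phiE chiD mulrACA mulrA.
Qed.

Let char_eval_mul : monoid_morphism char_eval.
Proof.
split=> [|p q]; first by rewrite -tmon0 char_eval_tmon.
exact: (tmon_mul_linear char_eval_tmon).
Qed.

HB.instance Definition _ :=
  GRing.isMonoidMorphism.Build sgalg k^o char_eval char_eval_mul.

Definition char_point : spec sgalg := char_eval : {lrmorphism sgalg -> k^o}.

Lemma ev_char_point a : ev (tmon a) char_point = chi a.
Proof. exact: char_eval_tmon. Qed.

End Character.

Lemma spec_sgalg_ext (x y : spec sgalg) :
  (forall a, ev (tmon a) x = ev (tmon a) y) -> x = y.
Proof.
move=> xy; apply: spec_ext => p; rewrite (sgalgE p) /ev !linear_sum.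
by apply: eq_bigr => a _; rewrite !linearZ/= -/(ev _ _) xy.
Qed.

End SemigroupAlgebra.

Section Torus.
Context (k : fieldType).

(* T^L = Spec k[t^L] *)
Definition tspec (L : nmodType) : fspace k := affine (sgalg k L).

(* The character t^m at a point of T^L. *)
Definition tval (L : nmodType) (m : L) (x : tspec L) : k := ev (tmon k m) x.

Lemma tval0 (L : nmodType) (x : tspec L) : tval 0 x = 1.
Proof. exact: rmorph1. Qed.

Lemma tvalD (L : nmodType) (a b : L) (x : tspec L) :
  tval (a + b) x = tval a x * tval b x.
Proof. by rewrite /tval tmonD; exact: rmorphM. Qed.

(* The map T^M x T^L -> T^L induced by k[t^L] -> k[t^M] (x) k[t^L],
   t^a |-> t^(h a) (x) t^a, for h : L -> M additive. *)
Section Coaction.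
Context (L M : nmodType) (h : {additive L -> M}).

Let chi (t : tspec M) (x : tspec L) (a : L) : k := tval (h a) t * tval a x.

Let chi0 t x : chi t x 0 = 1.
Proof. by rewrite /chi raddf0 !tval0 mulr1. Qed.

Let chiD t x a b : chi t x (a + b) = chi t x a * chi t x b.
Proof. by rewrite /chi raddfD !tvalD mulrACA. Qed.

Definition tact (t : tspec M) (x : tspec L) : tspec L :=
  char_point (@chi0 t x) (@chiD t x).

Lemma tactE t x a : tval a (tact t x) = tval (h a) t * tval a x.
Proof. exact: ev_char_point. Qed.

End Coaction.

Definition tmul (M : nmodType) : tspec M -> tspec M -> tspec M :=
  tact (idfun : {additive M -> M}).

(* An isomorphism of algebraic groups G -> T^M. *)
Definition torus_isomorphism (G : alg_group k) (M : nmodType)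
  (phi : G -> tspec M) : Prop :=
  isomorphism phi /\ {morph phi : s t / group_mul s t >-> tmul s t}.

Definition algebraic_torus (G : alg_group k) : Prop :=
  exists (r : nat) (phi : G -> tspec 'rV[int]_r), torus_isomorphism phi.

(* j is the embedding of T in X and act the action of T on X. *)
Record toric_variety (T : alg_group k) (X : fspace k)
    (j : T -> X) (act : T -> X -> X) : Prop := ToricVariety {
  toric_torus : algebraic_torus T;
  toric_algebraic : algebraic_variety X;
  toric_irreducible : irreducible X;
  toric_separated : separated X;
  toric_action : algebraic_action act;
  toric_good : good_action act;
  toric_open : open_immersion j;
  toric_extends : forall s t, act s (j t) = j (group_mul s t) }.

End Torus.

(* Lattices are written in coordinates: N = 'cV[int]_n and M = 'rV[int]_n, with
   the pairing m *m v; N_R = 'cV[R]_n and M_R = 'rV[R]_n. *)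

Section Fans.
Context (R : realType).

Definition cone (V : lmodType R) (S : set V) : set V :=
  [set v | exists (m : nat) (c : 'I_m -> R) (w : 'I_m -> V),
     (forall i, 0 <= c i /\ S (w i)) /\ v = \sum_i c i *: w i].

Definition subgroup_gen (M : zmodType) (S : set M) : set M :=
  smallest (fun G : set M => zmod_closed (mem G)) S.

Definition submonoid_gen (M : nmodType) (S : set M) : set M :=
  smallest (fun G : set M => addr_closed (mem G)) S.

Context (n : nat).
Implicit Types (s t : set 'cV[R]_n) (m : 'rV[R]_n) (v : 'cV[R]_n).

Definition toR (p q : nat) (A : 'M[int]_(p, q)) : 'M[R]_(p, q) :=
  map_mx intr A.

Definition pairing m v : R := (m *m v) 0 0.

Definition rational_polyhedral s : Prop :=
  exists g : seq 'cV[int]_n, s = cone [set toR v | v in [set` g]].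

Definition strictly_convex s : Prop := forall v, s v -> s (- v) -> v = 0.

Definition dual_cone s : set 'rV[R]_n :=
  [set m | forall v, s v -> 0 <= pairing m v].

Definition orthogonal s : set 'rV[R]_n :=
  [set m | forall v, s v -> pairing m v = 0].

Definition face t s : Prop :=
  exists2 m, dual_cone s m & t = s `&` [set v | pairing m v = 0].

Definition is_fan (F : set (set 'cV[R]_n)) : Prop :=
  [/\ finite_set F,
      forall s, F s -> rational_polyhedral s /\ strictly_convex s,
      forall s t, F s -> face t s -> F t &
      forall s t, F s -> F t ->
        [/\ F (s `&` t), face (s `&` t) s & face (s `&` t) t]].

(* M(t, L): the lattice generated by the m in L that vanish on t. *)
Definition face_lattice t (L : set 'rV[int]_n) : set 'rV[int]_n :=
  subgroup_gen (L `&` [set m | orthogonal t (toR m)]).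

End Fans.

Section Submonoid.
Context (M : nmodType) (L : addrClosed M).

Definition submonoid : Type := {m : M | m \in L}.
HB.instance Definition _ := SubChoice.on submonoid.
HB.instance Definition _ :=
  GRing.SubChoice_isSubNmodule.Build M (fun m => m \in L) submonoid (rpred0D L).

End Submonoid.

Record toric_triple (R : realType) := ToricTriple {
  rank : nat;
  fan : set (set 'cV[R]_rank);
  fan_is_fan : is_fan fan;
  semigroup : fan -> addrClosed 'rV[int]_rank;
  semigroup_fg : forall s : fan, exists g : seq 'rV[int]_rank,
    [set` semigroup s] = submonoid_gen [set` g];
  semigroup_dual : forall (s : fan) m,
    m \in semigroup s -> dual_cone (val s) (toR R m);
  semigroup_group : forall s : fan, subgroup_gen [set` semigroup s] = setT;
  semigroup_cone : forall s : fan,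
    cone [set toR R m | m in [set` semigroup s]] = dual_cone (val s);
  semigroup_face : forall s t : fan, face (val t) (val s) ->
    [set` semigroup t] =
    [set a + b | a in [set` semigroup s] &
                 b in face_lattice (val t) [set` semigroup s]] }.

Arguments rank {R} D : rename.
Arguments fan {R} D : rename.
Arguments semigroup {R} D s : rename.

Section ToricSpace.
Context (k : fieldType) (R : realType) (D : toric_triple R).

Definition chart (s : fan D) : fspace k := tspec k (submonoid (semigroup D s)).

(* x is the image of y under the map dual to the inclusion of the semigroup
   of s in that of t, for t a face of s. *)
Definition restricts (t s : fan D) (y : chart t) (x : chart s) : Prop :=
  forall (a : submonoid (semigroup D s)) (b : submonoid (semigroup D t)),
    val a = val b -> tval a x = tval b y.

Definition charts : Type := {s : fan D & chart s}.

(* Two points are identified when they come from a common point of the chart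
   of the intersection of the two cones. *)
Definition glued (p q : charts) : Prop := exists t : fan D,
  val t = val (tag p) `&` val (tag q) /\
  exists y : chart t, restricts y (tagged p) /\ restricts y (tagged q).

(* Generating an equivalence makes the gluing well defined for free; for a
   triple the relation [glued] is already an equivalence. *)
Definition glue_rel (p q : charts) : bool :=
  `[< clos_refl_sym_trans charts glued p q >].

Let glue_refl : reflexive glue_rel.
Proof. by move=> p; apply/asboolP; exact: rst_refl. Qed.

Let glue_sym : symmetric glue_rel.
Proof.
by move=> p q; apply/asboolP/asboolP => pq; exact: rst_sym.
Qed.

Let glue_trans : transitive glue_rel.
Proof.
move=> q p r /asboolP pq /asboolP qr; apply/asboolP; exact: rst_trans pq qr.
Qed.

Canonical glue_equiv := EquivRel glue_rel glue_refl glue_sym glue_trans.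

Definition toric_pt : topologicalType :=
  quotient_topology {eq_quot glue_rel}%qT.

Definition chart_map (s : fan D) (x : chart s) : toric_pt :=
  (\pi_({eq_quot glue_rel}) (Tagged chart x))%qT.

Lemma chart_mapP (p : toric_pt) : exists s (x : chart s), p = chart_map x.
Proof.
have [q ->] : exists q : charts, p = (\pi_({eq_quot glue_rel}) q)%qT.
  by exists (repr p); rewrite reprK.
by case: q => s x; exists s, x.
Qed.

Lemma chart_map_eq (s t : fan D) (x : chart s) (y : chart t) :
  chart_map x = chart_map y <->
  clos_refl_sym_trans charts glued (Tagged chart x) (Tagged chart y).
Proof.
split=> [/eqmodP/asboolP//|xy]; exact/eqmodP/asboolP.
Qed.

Lemma open_toric (U : set toric_pt) :
  open U <-> forall s, open (chart_map (s := s) @^-1` U).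
Proof. exact: sigT_openP. Qed.

Definition toric_regular (U : set toric_pt) (f : toric_pt -> k) : Prop :=
  forall s, regular (chart_map (s := s) @^-1` U) (f \o chart_map (s := s)).

(* T_Sigma^Gamma: the charts Spec k[t^(Gamma_s)] glued, with the quotient
   topology and the functions that are regular in every chart. *)
Program Definition toric_space : fspace k :=
  @FSpace k toric_pt toric_regular _ _ _ _ _ _ _.
Next Obligation.
move=> U f g /open_toric oU fg rf s; apply: regular_ext (oU s) _ (rf s) => x.
by rewrite inE => Ux; apply: fg; rewrite inE.
Qed.
Next Obligation.
move=> U V f /open_toric oU /open_toric oV VU rf s.
by apply: regular_sub (oU s) (oV s) _ (rf s) => x; exact: VU.
Qed.
Next Obligation.
move=> U f /open_toric oU rf s; apply: regular_glue => // x /rf[V].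
by move=> [/open_toric oV Vx VU rV]; exists (chart_map (s := s) @^-1` V); split=> // y /VU.
Qed.
Next Obligation. by move=> U c /open_toric oU s; exact: regular_cst. Qed.
Next Obligation.
by move=> U f g /open_toric oU rf rg s; exact: (regularD (oU s) (rf s) (rg s)).
Qed.
Next Obligation.
by move=> U f g /open_toric oU rf rg s; exact: (regularM (oU s) (rf s) (rg s)).
Qed.
Next Obligation.
move=> U f /open_toric oU rf; split; first apply/open_toric.
  by move=> s; have [] := regularV (oU s) (rf s).
by move=> s; have [] := regularV (oU s) (rf s).
Qed.

Definition torus : fspace k := tspec k 'rV[int]_(rank D).

Definition chart_act (s : fan D) (t : torus) (x : chart s) : chart s :=
  tact (val : {additive submonoid (semigroup D s) -> 'rV[int]_(rank D)}) t x.

Definition charts_act (t : torus) (p : charts) : charts :=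
  Tagged chart (chart_act t (tagged p)).

(* The action of T^M; it does not depend on the representative, see
   [toric_act_chart]. *)
Definition toric_act (t : torus) (p : toric_space) : toric_space :=
  (\pi_({eq_quot glue_rel}) (charts_act t (repr (p : {eq_quot glue_rel}))))%qT.

Lemma toric_act_chart t s (x : chart s) :
  toric_act t (chart_map x) = chart_map (chart_act t x).
Proof.
have act_glued p q : glued p q -> glued (charts_act t p) (charts_act t q).
  move=> [u [uE [y [yp yq]]]]; exists u; split=> //; exists (chart_act t y).
  by split=> a b ab; rewrite !tactE/= ab; congr (_ * _); [exact: yp|exact: yq].
have act_equiv p q : clos_refl_sym_trans charts glued p q ->
    clos_refl_sym_trans charts glued (charts_act t p) (charts_act t q).
  elim=> {p q} [p q /act_glued|p|p q _|p q r _ pq _].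
  - exact: rst_step.
  - exact: rst_refl.
  - exact: rst_sym.
  - exact: rst_trans.
rewrite /toric_act; set q := repr _.
have /eqmodP/asboolP/act_equiv qx : (q = Tagged chart x %[mod_eq glue_rel])%qT.
  exact: reprK.
by apply/eqmodP/asboolP; exact: qx.
Qed.

End ToricSpace.

(* Main.v *)
(* Let M be the character lattice of T and e : T^M -> X the open orbit.  On an
   invariant affine open U, the functions restrict to a translation-invariant
   subalgebra of k[t^M] (Nullstellensatz), which is therefore spanned by the
   characters it contains: U = Spec k[t^L] for a finitely generated semigroup
   L.  Separatedness makes L intrinsic: if two charts L, L' meet at a point
   where the only non-vanishing characters of L are invertible in L, then
   comparing the two local expressions of t^m, m in L', gives L' <= L.  Applied
   to the limit at 0 of a one-parameter subgroup in the relative interior of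
   the intersection of two dual cones, this shows that the charts share the
   localization at the corresponding faces, so the dual cones form a fan.
   Applied at an arbitrary common point, it shows that the charts are glued
   exactly as in T_Sigma^Gamma. *)

From HB Require Import structures.
From Stdlib Require Import Relation_Operators.
From mathcomp Require Import all_boot all_order all_algebra finmap.
From mathcomp Require Import generic_quotient ring_quotient.
From mathcomp Require Import boolp classical_sets functions cardinality.
From mathcomp Require Import reals topology.
From mathcomp.multinomials Require Import monalg.
From mathcomp Require Import zify ring.
Require Import Defs.

Set Implicit Arguments.
Unset Strict Implicit.
Unset Printing Implicit Defensive.

Import Order.TTheory GRing.Theory Num.Theory.

Local Open Scope classical_set_scope.
Local Open Scope ring_scope.

(** * Extension of homomorphisms to an algebraically closed field *)

(** [X] is not assumed normal, so the monoid of a chart need not be saturated and convex geometry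
    does not recover it from its cone; that charts with equal dual cones have equal monoids is
    itself a consequence of separatedness. This is why comparisons are made between monoids, with
    integral points in relative interiors as the link to the cones. The fan is not read off from the
    given affine cover: it consists of the dual cones of all charts of [X], so that closure under
    faces is immediate (a localization of a chart is a chart) and finiteness becomes the point to
    prove. An invariant subalgebra is spanned by characters because points of the torus separate
    them: subtracting from a translate of an element a multiple of that element removes one monomial
    and keeps a chosen other one. The Nullstellensatz serves to show that a regular function on all
    of Spec A comes from an element of A; it is derived from the extension of homomorphisms into k,
    for every algebraically closed k. *)

Section HomExtension.
Context (K : idomainType) (k : closedFieldType).
Implicit Types (S : subringClosed K) (phi : K -> k) (p q : {poly K}).

(** A homomorphism is a total function on [K] constrained only on [S], so that passing to a larger
    subring does not change its type. *)
Definition hom_on (S : {pred K}) phi : Prop := [/\ phi 1 = 1,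
  {in S &, {morph phi : x y / x + y}} & {in S &, {morph phi : x y / x * y}}].

Definition adjoin (S : subringClosed K) (a : K) : {pred K} :=
  [pred x | `[< exists2 p, p \is a polyOver S & x = p.[a] >]].

Lemma adjoinP S a x :
  reflect (exists2 p, p \is a polyOver S & x = p.[a]) (x \in adjoin S a).
Proof. exact: asboolP. Qed.

Lemma adjoin_subring S a : subring_closed (adjoin S a).
Proof.
split.
- by apply/adjoinP; exists 1; rewrite ?rpred1 ?hornerC.
- move=> _ _ /adjoinP[p pS ->] /adjoinP[q qS ->]; apply/adjoinP.
  by exists (p - q); rewrite ?rpredB// hornerD hornerN.
- move=> _ _ /adjoinP[p pS ->] /adjoinP[q qS ->]; apply/adjoinP.
  by exists (p * q); rewrite ?rpredM// hornerM.
Qed.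

HB.instance Definition _ S a :=
  GRing.isSubringClosed.Build K (adjoin S a) (adjoin_subring S a).

Lemma sub_adjoin S a : {subset S <= adjoin S a}.
Proof.
by move=> x xS; apply/adjoinP; exists x%:P; rewrite ?polyOverC ?hornerC.
Qed.

Lemma mem_adjoin S a : a \in adjoin S a.
Proof. by apply/adjoinP; exists 'X; rewrite ?polyOverX ?hornerX. Qed.

(** [S] is not a field, so the leading coefficient of [q] cannot be inverted; each reduction step
    multiplies [p] by it instead. *)
Lemma pseudo_division S p q : p \is a polyOver S -> q \is a polyOver S ->
  q != 0 -> exists n s t, [/\ s \is a polyOver S, t \is a polyOver S,
    lead_coef q ^+ n *: p = s * q + t & (size t < size q)%N].
Proof.
move=> pS qS q0; have lqS : lead_coef q \in S by exact: (polyOverP qS).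
have [n] := ubnP (size p); elim: n => // n IH in p pS *; rewrite ltnS => pn.
have [pq|qp] := ltnP (size p) (size q).
  by exists 0, 0, p; rewrite rpred0 scale1r mul0r add0r.
have lpS : lead_coef p \in S by exact: (polyOverP pS).
pose r := lead_coef p *: 'X^(size p - size q).
pose p' := lead_coef q *: p - r * q.
have rS : r \is a polyOver S by rewrite polyOverZ// rpredX// polyOverX.
have p'S : p' \is a polyOver S by rewrite rpredB ?polyOverZ// rpredM.
have q_gt0 : (0 < size q)%N by rewrite size_poly_gt0.
have sp' : (size p' < size p)%N.
  have p_gt0 := leq_trans q_gt0 qp.
  rewrite -(prednK p_gt0) ltnS; apply/leq_sizeP => i pi.
  rewrite /p' /r -scalerAl coefB !coefZ coefXnM.
  have [->|ip] := eqVneq i (size p).-1.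
    have -> : ((size p).-1 < size p - size q)%N = false by lia.
    have -> : ((size p).-1 - (size p - size q) = (size q).-1)%N by lia.
    by rewrite -!lead_coefE mulrC subrr.
  have {}ip : (size p <= i)%N by rewrite -(prednK p_gt0) ltn_neqAle eq_sym ip.
  rewrite (nth_default 0 ip) mulr0 ifN -?leqNgt; last lia.
  rewrite nth_default ?mulr0 ?subr0//.
  by rewrite leq_subRL ?(leq_trans (leq_subr _ _) ip)// subnK.
have [m [s [t [sS tS cp' tq]]]] := IH p' p'S (leq_trans sp' pn).
pose c := lead_coef q ^+ m.
exists m.+1, (s + c *: r), t; split=> //.
  by rewrite rpredD// polyOverZ// rpredX.
rewrite exprSr -scalerA -[lead_coef q *: p](subrK (r * q)) -/p' scalerDr.
by rewrite cp' mulrDl -(scalerAl c r q) addrAC.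
Qed.

Section MapPoly.
Variables (S : subringClosed K) (phi : K -> k).
Hypothesis homphi : hom_on S phi.

Let phi0 : phi 0 = 0.
Proof.
have [_ phiD _] := homphi; apply: (addIr (phi 0)).
by rewrite add0r -phiD ?rpred0// addr0.
Qed.

Let phi_sum I (r : seq I) (P : pred I) (F : I -> K) : (forall i, F i \in S) ->
  phi (\sum_(i <- r | P i) F i) = \sum_(i <- r | P i) phi (F i).
Proof.
move=> FS; have [_ phiD _] := homphi.
elim: r => [|i r IH]; first by rewrite !big_nil.
rewrite !big_cons; case: ifP => // _; rewrite phiD ?IH//.
by rewrite rpred_sum.
Qed.

Lemma map_poly_homD p q : p \is a polyOver S -> q \is a polyOver S ->
  map_poly phi (p + q) = map_poly phi p + map_poly phi q.
Proof.
move=> /polyOverP pS /polyOverP qS; have [_ phiD _] := homphi.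
by apply/polyP => i; rewrite coefD !coef_map_id0// coefD phiD.
Qed.

Lemma map_poly_homM p q : p \is a polyOver S -> q \is a polyOver S ->
  map_poly phi (p * q) = map_poly phi p * map_poly phi q.
Proof.
move=> /polyOverP pS /polyOverP qS; have [_ _ phiM] := homphi.
apply/polyP => i; rewrite coef_map_id0// !coefM phi_sum; last first.
  by move=> l; rewrite rpredM.
by apply: eq_bigr => l _; rewrite !coef_map_id0// phiM.
Qed.

Lemma map_poly_homC c : map_poly phi c%:P = (phi c)%:P.
Proof.
by apply/polyP => i; rewrite coef_map_id0// !coefC; case: ifP.
Qed.

Lemma coef_map_hom p i : (map_poly phi p)`_i = phi p`_i.
Proof. by rewrite coef_map_id0. Qed.

Lemma hom_onN c : c \in S -> phi (- c) = - phi c.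
Proof.
move=> cS; have [_ phiD _] := homphi; apply: (addIr (phi c)).
by rewrite -phiD ?rpredN// !addNr.
Qed.

Lemma map_poly_homN p : p \is a polyOver S ->
  map_poly phi (- p) = - map_poly phi p.
Proof.
move=> /polyOverP pS; apply/polyP => i.
by rewrite coefN !coef_map_id0// coefN hom_onN.
Qed.

Lemma map_poly_homZ c p : c \in S -> p \is a polyOver S ->
  map_poly phi (c *: p) = phi c *: map_poly phi p.
Proof.
by move=> cS pS; rewrite -mul_polyC map_poly_homM ?polyOverC// map_poly_homC
  mul_polyC.
Qed.

(** [adjoin S a] is the quotient of S[X] by the polynomials that vanish at [a]; the hypothesis says
    that applying [phi] and evaluating at [xi] kills them. *)
Lemma hom_extend a xi :
  (forall p, p \is a polyOver S -> p.[a] = 0 -> (map_poly phi p).[xi] = 0) ->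
  exists psi, hom_on (adjoin S a) psi /\
    forall p, p \is a polyOver S -> psi p.[a] = (map_poly phi p).[xi].
Proof.
move=> ker; have [phi1 _ _] := homphi.
pose P x p := p \is a polyOver S /\ x = p.[a].
pose psi x : k := (map_poly phi (xget 0 (P x))).[xi].
have psiE p : p \is a polyOver S -> psi p.[a] = (map_poly phi p).[xi].
  move=> pS; rewrite /psi; case: xgetP => [q _ [qS pq]|/(_ p)[]//].
  apply/eqP; rewrite -subr_eq0 -hornerN -hornerD -map_poly_homN//.
  rewrite -map_poly_homD ?rpredN// ker//; first by rewrite rpredB.
  by rewrite hornerD hornerN pq subrr.
exists psi; split=> //; split.
- by rewrite -(hornerC 1 a) psiE ?polyOverC ?rpred1// map_poly_homC hornerC.
- move=> _ _ /adjoinP[p pS ->] /adjoinP[q qS ->].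
  by rewrite -hornerD !psiE ?rpredD// map_poly_homD// hornerD.
- move=> _ _ /adjoinP[p pS ->] /adjoinP[q qS ->].
  by rewrite -hornerM !psiE ?rpredM// map_poly_homM// hornerM.
Qed.

End MapPoly.


(* Atiyah-Macdonald, Proposition 5.23. *)
Lemma hom_extension S a v : v \in adjoin S a -> v != 0 ->
  exists u, [/\ u \in S, u != 0 & forall phi, hom_on S phi -> phi u != 0 ->
    exists psi, [/\ hom_on (adjoin S a) psi, {in S, psi =1 phi} &
                    psi v != 0]].
Proof.
have extC phi psi : hom_on S phi ->
    (forall p, p \is a polyOver S -> exists xi,
      psi p.[a] = (map_poly phi p).[xi]) ->
    {in S, psi =1 phi}.
  move=> hphi psiE c cS; have [xi] := psiE c%:P (etrans (polyOverC _ _) cS).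
  by rewrite (map_poly_homC hphi) !hornerC.
move=> /adjoinP[g gS ->] ga0.
have [[q [qS q0 qa]]|tr] := pselect (exists q, [/\ q \is a polyOver S,
  q != 0 & q.[a] = 0]).
  (* Algebraic case: a nonzero polynomial over [S] of least size that kills [a] serves as a minimal
     polynomial. *)
  pose P n := exists q, [/\ q \is a polyOver S, q != 0, q.[a] = 0 & size q = n].
  have exP : exists n, `[<P n>] by exists (size q); apply/asboolP; exists q.
  move: (ex_minnP exP) => [_ /asboolP[{q0 qa}q [{}qS q0 qa <-]]] qmin.
  have {}qmin p : p \is a polyOver S -> p.[a] = 0 -> (size p < size q)%N ->
    p = 0.
    move=> pS pa pq; apply/eqP; apply: contraTT pq => p0; rewrite -leqNgt.
    by apply: qmin; apply/asboolP; exists p.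
  have sq2 : (1 < size q)%N.
    rewrite ltnNge; apply/negP => /size1_polyC qE.
    by move: q0 qa; rewrite qE hornerC polyC_eq0 => /eqP.
  (* [r] has least size among the combinations of [g] and [q] that do not vanish at [a]. It turns
     out to be a constant [d], which acts as a resultant: it lies in [S] and is a multiple of g(a)
     in S[a]. *)
  pose Q n := exists r h1 h2 : {poly K}, [/\ h1 \is a polyOver S,
    h2 \is a polyOver S,
    r = h1 * g + h2 * q, r.[a] != 0 & size r = n].
  have exQ : exists n, `[<Q n>].
    exists (size g); apply/asboolP; exists g, 1, 0.
    by rewrite rpred1 rpred0 mul1r mul0r addr0.
  move: (ex_minnP exQ) => [_ /asboolP[r [h1 [h2 [h1S h2S rE ra <-]]]] rmin].
  have {}rmin h1' h2' : h1' \is a polyOver S -> h2' \is a polyOver S ->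
      (h1' * g + h2' * q).[a] != 0 -> (size r <= size (h1' * g + h2' * q)%R)%N.
    move=> h1S' h2S' h0; apply: rmin; apply/asboolP.
    by exists (h1' * g + h2' * q), h1', h2'.
  have lqS : lead_coef q \in S by exact: (polyOverP qS).
  have lq0 : lead_coef q != 0 by rewrite lead_coef_eq0.
  have rq : (size r < size q)%N.
    have [n [s [t [sS tS gE tq]]]] := pseudo_division gS qS q0.
    apply: leq_ltn_trans tq; have tE : t = (lead_coef q ^+ n)%:P * g + - s * q.
      by rewrite mul_polyC gE mulNr addrAC subrr add0r.
    rewrite tE; apply: rmin; rewrite ?polyOverC ?rpredX ?rpredN//.
    by rewrite !hornerE qa mulr0 addr0 mulf_neq0// expf_neq0.
  have rS : r \is a polyOver S by rewrite rE rpredD// rpredM.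
  have r0 : r != 0 by apply: contraNneq ra => ->; rewrite horner0.
  (* If [r] were not constant, the remainder of [q] by [r] would vanish at [a], hence be zero, and
     the quotient would be a shorter polynomial killing [a]. *)
  have sr : (size r <= 1)%N.
    rewrite leqNgt; apply/negP => r1.
    have [n [s [t [sS tS qE tr]]]] := pseudo_division qS rS r0.
    have ta : t.[a] = 0.
      apply: contraTeq tr; rewrite -leqNgt => ta0.
      have tE : t = (- s * h1) * g + ((lead_coef r ^+ n)%:P - s * h2) * q.
        have -> : t = (lead_coef r ^+ n)%:P * q - s * r.
          by rewrite mul_polyC qE addrAC subrr add0r.
        by rewrite rE; move: _%:P => c; ring.
      rewrite tE; apply: rmin; rewrite -?tE//.
        by rewrite rpredM// rpredN.
      rewrite rpredB ?polyOverC ?rpredX ?rpredM//; exact: (polyOverP rS).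
    have t0 := qmin t tS ta (ltn_trans tr rq); rewrite t0 addr0 in qE.
    have lr0 : lead_coef r ^+ n != 0 by rewrite expf_neq0// lead_coef_eq0.
    have sa : s.[a] = 0.
      apply/eqP; have /eqP : (s * r).[a] = 0 by rewrite -qE hornerZ qa mulr0.
      by rewrite hornerM mulf_eq0 (negPf ra) orbF.
    have s0 : s != 0.
      by apply: contraNneq q0 => s0; move/eqP: qE; 
      rewrite s0 mul0r -mul_polyC mulf_eq0 polyC_eq0 (negPf lr0).
    have := congr1 (fun p : {poly K} => size p) qE;
      rewrite size_scale// size_mul// => sqE.
    apply/negP: s0; rewrite negbK; apply/eqP; apply: qmin => //.
    by rewrite sqE -(ltn_predK r1) addnS/= -[X in (X < _)%N]addn0 ltn_add2l
      -ltnS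
      (ltn_predK r1).
  have rC := size1_polyC sr; set d := r`_0 in rC.
  have d0 : d != 0 by rewrite -polyC_eq0 -rC.
  have dS : d \in S by exact: (polyOverP rS).
  (* The first factor keeps the degree of the image of [q], which then has a root [xi]; the second
     forces [psi v] to be nonzero, [d] being a multiple of [v]. *)
  exists (lead_coef q * d); split; [exact: rpredM|exact: mulf_neq0|].
  move=> phi hphi; have [phi1 _ phiM] := hphi.
  rewrite phiM// mulf_eq0 => /norP[plq0 pd0].
  pose q' := map_poly phi q.
  have [xi q'xi] : exists xi, root q' xi.
    apply/closed_rootP; apply: contra_neqN plq0 => /eqP sq'.
    rewrite lead_coefE -(coef_map_hom hphi) nth_default// sq'.
    by rewrite -ltnS (ltn_predK sq2).
  have [p pS pa|psi [hpsi psiE]] := hom_extend hphi (a := a) (xi := xi).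
    have [n [s [t [sS tS pE tq]]]] := pseudo_division pS qS q0.
    have t0 : t = 0.
      apply: qmin => //; apply/eqP; rewrite -[t](addKr (s * q)) -pE.
      by rewrite !hornerE qa pa !mulr0 oppr0 addr0.
    have lqnS : lead_coef q ^+ n \in S by rewrite rpredX.
    have := congr1 (fun p => (map_poly phi p).[xi]) pE.
    rewrite t0 addr0 (map_poly_homZ hphi)// (map_poly_homM hphi)// !hornerE.
    rewrite (eqP q'xi) mulr0 => /eqP; rewrite mulf_eq0 => /orP[|/eqP//].
    have -> : phi (lead_coef q ^+ n) = phi (lead_coef q) ^+ n.
      by elim: {lqnS pE} n => [|n IH];
        rewrite ?expr0// !exprS phiM ?rpredX// IH.
    by rewrite expf_eq0 (negPf plq0) andbF.
  exists psi; split=> //.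
    by apply: (extC) => // p pS; exists xi; exact: psiE.
  have [_ psiD psiM] := hpsi.
  have : psi d != 0.
    rewrite -(hornerC d a) psiE ?polyOverC//.
    by rewrite (map_poly_homC hphi) hornerC.
  have -> : d = h1.[a] * g.[a].
    by rewrite -(hornerC d a) -rC rE !hornerE qa mulr0 addr0.
  rewrite psiM ?mulf_eq0; first by case/norP.
    by apply/adjoinP; exists h1.
  by apply/adjoinP; exists g.
(* Transcendental case: there is no relation to respect, so [xi] can be any non-root of the image of
   [g], which is nonzero as soon as its leading coefficient is. *)
exists (lead_coef g); split.
- exact: (polyOverP gS).
- by rewrite lead_coef_eq0; apply: contraNneq ga0 => ->; rewrite horner0.
move=> phi hphi phig.
have : map_poly phi g != 0.
  apply: contraNneq phig => g0.
  by rewrite lead_coefE -(coef_map_hom hphi) g0 coef0.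
move=> /closed_nonrootP[xi gxi].
have [p pS pa|psi [hpsi psiE]] := hom_extend hphi (a := a) (xi := xi).
  have -> : p = 0.
    by apply: contra_notP tr => /eqP p0; exists p.
  by rewrite map_poly0 horner0.
exists psi; split=> //; last by rewrite psiE.
by apply: (extC) => // p pS; exists xi; exact: psiE.
Qed.

End HomExtension.

(** * Maximal ideals *)

Definition ideal (A : comNzRingType) (I : set A) : Prop :=
  I 0 /\ forall a u v, I u -> I v -> I (a * u + v).

Lemma maximal_ideal (A : comNzRingType) (I : set A) : ideal I -> ~ I 1 ->
  exists m : set A, [/\ ideal m, ~ m 1, I `<=` m &
    forall x, ~ m x -> exists a, m (1 - a * x)].
Proof.
move=> idI I1.
pose P J := J = set0 \/ [/\ ideal J, ~ J 1 & I `<=` J].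
have [F FP totF|m [mP mmax]] := @Zorn_bigcup A P.
  have [[J FJ J0]|F0] := pselect (exists2 J, F J & J !=set0); last first.
    left; apply/seteqP; split=> // x [J FJ Jx]; apply: F0; exists J => //.
    by exists x.
  right.
  have FP' J' x : F J' -> J' x -> [/\ ideal J', ~ J' 1 & I `<=` J'].
    by move=> /FP[->|].
  have [x Jx] := J0; have [[J00 JD] J1 IJ] := FP' _ _ FJ Jx.
  split; last by move=> y /IJ Jy; exists J.
    split; first by exists J.
    move=> a u v [J1' FJ1 J1u] [J2 FJ2 J2v].
    have [J12|J21] := totF _ _ FJ1 FJ2.
      exists J2 => //; have [[_ +] _ _] := FP' _ _ FJ2 J2v.
      by apply=> //; exact: J12.
    exists J1' => //; have [[_ +] _ _] := FP' _ _ FJ1 J1u.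
    by apply=> //; exact: J21.
  by move=> [J' FJ' J'1]; have [_ /(_ J'1)] := FP' _ _ FJ' J'1.
have {mP}[idm m1 Im] : [/\ ideal m, ~ m 1 & I `<=` m].
  case: mP => // m0; have P_I : P I by right; split.
  case: (mmax I _ P_I).
  rewrite m0; split=> //.
  by move=> /(_ 0); case: idI => I0 _; apply.
exists m; split=> // x mx; apply: contrapT => max.
apply: (mmax [set y | exists a, m (y - a * x)]).
  split=> [y my|/(_ x)].
    by exists 0; rewrite mul0r subr0.
  by move=> mx'; apply: mx; apply: mx'; exists 1; rewrite mul1r subrr;
    case: idm.
right; split.
- case: idm => m0 mD; split; first by exists 0; rewrite mul0r subr0.
  move=> a u v [b mb] [c mc]; exists (a * b + c).
  have -> : a * u + v - (a * b + c) * x = a * (u - b * x) + (v - c * x) by ring.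
  exact: mD.
- by move=> [a ma]; apply: max; exists a.
- by move=> y /Im my; exists 0; rewrite mul0r subr0.
Qed.

Section MaximalQuotient.
Context (A : comNzRingType) (m : set A).
Hypothesis (idm : ideal m) (m1 : ~ m 1).
Hypothesis mmax : forall x, ~ m x -> exists a, m (1 - a * x).

Let mp : {pred A} := mem m.
Let mp_ideal : idealr_closed mp.
Proof.
have [m0 mD] := idm; split; rewrite ?in_setE//.
  by apply/negP; rewrite in_setE.
by move=> a u v; rewrite !in_setE => mu mv; exact: mD.
Qed.
HB.instance Definition _ := isIdealr.Build A mp mp_ideal.

Definition residue : Type := {ideal_quot mp}.
HB.instance Definition _ := GRing.ComNzRing.on residue.

Let residueP (x : A) : (\pi_residue%qT x == 0 :> residue) = (x \in m).
Proof.
rewrite -[0](rmorph0 (\pi_residue%qT : {rmorphism A -> residue})).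
by rewrite -Quotient.idealrBE subr0.
Qed.

Let inverse (y : residue) : exists z, (y = 0 -> z = 0) /\ (y != 0 -> z * y = 1).
Proof.
have [->|y0] := eqVneq y 0; first by exists 0.
have := y0; rewrite -[y]reprK residueP => /negP; rewrite in_setE => /mmax[a ma].
exists (\pi_residue%qT a); rewrite reprK; split=> [/eqP|_];
  first by rewrite (negPf y0).
rewrite -[y]reprK; apply/eqP; rewrite -rmorphM eq_sym -subr_eq0.
rewrite -(rmorph1 (\pi_residue%qT : {rmorphism A -> residue})) -rmorphB.
by rewrite residueP in_setE.
Qed.

Let inv (y : residue) : residue := sval (cid (inverse y)).
Let mulVr y : y != 0 -> inv y * y = 1.
Proof. by rewrite /inv; case: cid => z []. Qed.
Let inv0 : inv 0 = 0. Proof. by rewrite /inv; case: cid => z h; exact: h.1. Qed.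

HB.instance Definition _ := GRing.ComNzRing_isField.Build residue mulVr inv0.

Lemma residue_field : exists (K : fieldType) (pi : {rmorphism A -> K}),
  forall x, pi x = 0 <-> m x.
Proof.
exists residue, \pi_residue%qT.
by move=> x; split=> [/eqP|mx]; [|apply/eqP]; rewrite residueP in_setE.
Qed.

End MaximalQuotient.

(** * Morphisms of spaces with functions *)

Section MorphismTheory.
Context (k : fieldType).
Implicit Types X Y Z : fspace k.

Lemma open_preimage (X Y : topologicalType) (f : X -> Y) (V : set Y) :
  continuous f -> open V -> open (f @^-1` V).
Proof. by move=> /continuousP; apply. Qed.

Lemma morphism_comp X Y Z (f : X -> Y) (g : Y -> Z) :
  morphism f -> morphism g -> morphism (g \o f).
Proof.
move=> [cf rf] [cg rg]; split=> [x|V h oV rV].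
  by apply: continuous_comp; [exact: cf|exact: cg].
by apply: (rf _ (h \o g)) (rg _ _ oV rV); exact: open_preimage.
Qed.

Lemma regular_compT X Y (f : X -> Y) (g : Y -> k) : morphism f ->
  regular setT g -> regular setT (g \o f).
Proof. by move=> mf rg; have := mf.2 _ _ openT rg; rewrite preimage_setT. Qed.

(** Functions of an [fspace] are total, so a function on [X] needs values off the image of [f]
    before its regularity on that image can be stated. *)
Lemma extend_along X Y (f : X -> Y) (r : X -> k) :
  injective f -> exists r' : Y -> k, forall x, r' (f x) = r x.
Proof.
move=> injf.
have F y : exists c, forall x, f x = y -> c = r x.
  have [[x <-]|nx] := pselect (exists x, f x = y).
    by exists (r x) => x' /injf->.
  by exists 0 => x xy; case: nx; exists x.
exists (fun y => sval (cid (F y))) => x.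
by case: cid => c /= /(_ x erefl).
Qed.

Lemma morphism_lift X Y Z (f : X -> Y) (g : Z -> Y) (h : Z -> X) :
  open_immersion f -> morphism g -> (forall z, f (h z) = g z) -> morphism h.
Proof.
move=> [[cf rf] injf of_ rf'] [cg rg] fh.
have hE U : h @^-1` U = g @^-1` (f @` U).
  apply/seteqP; split=> z /=; first by move=> Uz; exists (h z).
  by move=> [x Ux]; rewrite -fh => /injf <-.
split.
  by apply/continuousP => U oU; rewrite hE; apply: open_preimage cg _;
    exact: of_.
move=> U r oU rU; have [r' r'E] := extend_along r injf.
have rU' : regular (f @` U) r'.
  apply: rf' => //; apply: regular_ext oU _ rU => x _; exact/esym/r'E.
rewrite hE; apply: regular_ext (rg _ _ (of_ _ oU) rU').
  by apply: open_preimage cg _; exact: of_.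
by move=> z _; rewrite /= -fh r'E.
Qed.

Lemma open_immersion_comp X Y Z (f : X -> Y) (g : Y -> Z) :
  open_immersion f -> open_immersion g -> open_immersion (g \o f).
Proof.
move=> [mf injf of_ rf] [mg injg og rg]; split.
- exact: morphism_comp.
- exact: inj_comp.
- by move=> U oU; rewrite -image_comp; apply: og; exact: of_.
- move=> U h oU rU; rewrite -image_comp; apply: rg; first exact: of_.
  exact: rf.
Qed.

Lemma isomorphism_open_immersion X Y (f : X -> Y) :
  isomorphism f -> open_immersion f.
Proof.
move=> [g [mf [cg rg] fK gK]]; have fE U : f @` U = g @^-1` U.
  apply/seteqP; split=> y /=; first by move=> [x Ux <-]; rewrite fK.
  by move=> Uy; exists (g y).
split=> //; first exact: can_inj fK.
  by move=> U oU; rewrite fE; exact: open_preimage.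
move=> U h oU rU; rewrite fE; apply: regular_ext (rg _ _ oU rU).
  exact: open_preimage.
by move=> y _; rewrite /= gK.
Qed.

Lemma open_range X Y (f : X -> Y) : open_immersion f -> open (range f).
Proof. by case=> _ _ + _; apply; exact: openT. Qed.

Section Pairing.
Context (X Y Z : fspace k) (f : Z -> X) (g : Z -> Y).
Hypothesis (mf : morphism f) (mg : morphism g).
Let fg (z : Z) : product X Y := (f z, g z).

Lemma tensor_pullback (U : set X) (V : set Y) h : open U -> open V ->
  tensor U V h -> regular (f @^-1` U `&` g @^-1` V) (h \o fg).
Proof.
move=> oU oV [s [rs ->]].
have oUf := open_preimage mf.1 oU; have oVg := open_preimage mg.1 oV.
have oUV := openI oUf oVg.
elim: s rs => [_|[a b] s IH rs].
  apply: regular_ext (regular_cst 0 oUV) => // z _.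
  by rewrite /= big_nil.
have [ra rb] := rs _ (mem_head _ _).
have rs' fg' : fg' \in s -> regular U fg'.1 /\ regular V fg'.2.
  by move=> ?; apply: rs; rewrite inE orbC; apply/orP; left.
have raf : regular (f @^-1` U `&` g @^-1` V) (a \o f).
  by apply: regular_sub (mf.2 _ _ oU ra) => // z [].
have rbg : regular (f @^-1` U `&` g @^-1` V) (b \o g).
  by apply: regular_sub (mg.2 _ _ oV rb) => // z [].
apply: regular_ext (regularD oUV (regularM oUV raf rbg) (IH rs')) => // z _.
by rewrite /= big_cons.
Qed.

Let nonvanishing_nbhs (z : Z) (U : set X) (V : set Y) h : open U -> open V ->
  tensor U V h -> U (f z) -> V (g z) -> h (fg z) != 0 ->
  \forall w \near z, [/\ U (f w), V (g w) & h (fg w) != 0].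
Proof.
move=> oU oV th Ufz Vgz hz.
have oUV := openI (open_preimage mf.1 oU) (open_preimage mg.1 oV).
have [oW _] := regularV oUV (tensor_pullback oU oV th).
apply: (@filterS _ _ _ ((f @^-1` U `&` g @^-1` V) `&` [set w | (h \o fg) w !=
  0])).
  by move=> w [[]].
by apply: open_nbhs_nbhs; split.
Qed.

Lemma pairing_continuous : continuous fg.
Proof.
apply/continuousP => W oW; rewrite openE => z Wz.
have [U [V [h [oU oV th [Up Vp hp] UVW]]]] := oW _ Wz.
by apply: filterS (nonvanishing_nbhs oU oV th Up Vp hp) => w wUV; exact: UVW.
Qed.

Lemma pairing_morphism : morphism (fg : Z -> product X Y).
Proof.
split=> [|W r oW rr]; first exact: pairing_continuous.
have oWfg := open_preimage pairing_continuous oW.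
apply: regular_glue => // z Wz.
have [a [b [[U [V [oU oV [Uz Vz] ta]]] [U' [V' [oU' oV' [Uz' Vz'] tb]]] ab]]]
  := rr _ Wz.
have [bz _] := nbhs_singleton ab.
have : \forall w \near z, b (fg w) != 0 /\ r (fg w) = a (fg w) / b (fg w).
  exact: pairing_continuous ab.
rewrite /prop_near1 nbhsE => -[N [oN Nz] NP].
pose P := (f @^-1` U `&` g @^-1` V).
pose P' := (f @^-1` U' `&` g @^-1` V').
have oP : open P := openI (open_preimage mf.1 oU) (open_preimage mg.1 oV).
have oP' : open P' := openI (open_preimage mf.1 oU') (open_preimage mg.1 oV').
have ra : regular P (a \o fg) by exact: tensor_pullback.
have rb : regular P' (b \o fg) by exact: tensor_pullback.
have [oQ rQ] := regularV oP' rb.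
pose E := N `&` (fg @^-1` W) `&` P `&` (P' `&` [set w | (b \o fg) w != 0]).
have oE : open E by apply: openI => //; apply: openI => //; exact: openI.
exists E; split=> //.
  by move=> w [[[]]].
have raE : regular E (a \o fg) by apply: regular_sub ra => // w [[]].
have rbE : regular E (fun w => ((b \o fg) w)^-1) by apply: regular_sub rQ =>
  // w [].
apply: regular_ext (regularM oE raE rbE) => // w; rewrite inE.
by move=> [[[/NP[_ rw] _] _] _]; rewrite /= rw.
Qed.

End Pairing.

(** The equalizer is the preimage of the diagonal under the pairing of [f] and [g] into
    [product Y Y]. *)
Lemma closed_equalizer X Y (f g : X -> Y) : separated Y -> morphism f ->
  morphism g -> closed [set x | f x = g x].
Proof.
move=> sepY mf mg.
have := pairing_continuous mf mg => /continuous_closedP/(_ _ sepY).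
exact.
Qed.

End MorphismTheory.

Section AffineTheory.
Context (k : fieldType) (A : comAlgType k).

Lemma open_nonzero (a : A) : open [set x : spec A | ev a x != 0].
Proof. by move=> x /= ax; exists a; split. Qed.

Lemma open_specP (U : set (affine A)) : open U <-> forall x, U x ->
  exists a, ev a x != 0 /\ forall y, ev a y != 0 -> U y.
Proof.
split=> [oU x Ux|oU]; last by apply: (_ : zariski_open U) => x /oU.
exact: (oU : zariski_open U) _ Ux.
Qed.

Lemma near_spec (x : spec A) (P : set (spec A)) : (\forall y \near x, P y) ->
  exists a, ev a x != 0 /\ forall y, ev a y != 0 -> P y.
Proof.
rewrite /prop_near1 nbhsE => -[V [oV Vx] VP]; have [a [ax aV]] := oV x Vx.
by exists a; split=> // y ay; apply/VP/aV.
Qed.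

Lemma regular_specP (U : set (affine A)) (g : affine A -> k) :
  regular U g <-> forall x, U x -> exists a b c, ev c x != 0 /\
    forall y, ev c y != 0 -> ev b y != 0 /\ g y = ev a y / ev b y.
Proof.
split=> [rg x Ux|rg].
  have [_ [_ [[a _ <-] [b _ <-] ab]]] :=
    (rg : local_fraction (@polyfun _ A) _ _) _ Ux.
  by have [c cab] := near_spec ab; exists a, b, c.
apply: (_ : local_fraction (@polyfun _ A) _ _) => x /rg[a [b [c [cx cab]]]].
exists (ev a), (ev b); split; [by exists a|by exists b|].
have := open_nbhs_nbhs (conj (@open_nonzero c) cx).
by apply: filterS => y /cab.
Qed.

Lemma regular_ev (a : A) (U : set (affine A)) : regular U (ev a).
Proof.
apply/regular_specP => x Ux; exists a, 1, 1; rewrite /ev rmorph1 oner_neq0.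
by split=> // y; rewrite rmorph1 divr1.
Qed.

End AffineTheory.

Lemma affine_morphism (k : fieldType) (A B : comAlgType k)
    (f : affine B -> affine A) :
  (forall a, exists b, forall x, ev b x = ev a (f x)) -> morphism f.
Proof.
move=> fP; split.
  apply/continuousP => V /open_specP oV.
  apply/open_specP => x /oV[a [ax aV]]; have [b bE] := fP a.
  by exists b; rewrite bE; split=> // y; rewrite bE; exact: aV.
move=> V g oV /regular_specP rg; apply/regular_specP => x /rg.
move=> [a [b [c [cx cab]]]].
have [a' a'E] := fP a; have [b' b'E] := fP b; have [c' c'E] := fP c.
exists a', b', c'; rewrite c'E; split=> // y.
by rewrite a'E b'E c'E; exact: cab.
Qed.

(** * The Nullstellensatz *)

Section RingImage.
Context (F K : nzRingType) (i : {rmorphism F -> K}).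

Definition ring_image : {pred K} := [pred x | `[< exists c, i c = x >]].

Lemma ring_image_closed : subring_closed ring_image.
Proof.
split.
- by apply/asboolP; exists 1; rewrite rmorph1.
- move=> _ _ /asboolP[x <-] /asboolP[y <-]; apply/asboolP.
  by exists (x - y); rewrite rmorphB.
- move=> _ _ /asboolP[x <-] /asboolP[y <-]; apply/asboolP.
  by exists (x * y); rewrite rmorphM.
Qed.
HB.instance Definition _ :=
  GRing.isSubringClosed.Build K ring_image ring_image_closed.

End RingImage.

Section SpecOfFun.
Context (k : fieldType) (A : comAlgType k) (f : A -> k^o).
Hypothesis fD : forall a b, f (a + b) = f a + f b.
Hypothesis fZ : forall c a, f (c *: a) = c * f a.
Hypothesis f1 : f 1 = 1.
Hypothesis fM : forall a b, f (a * b) = (f a : k) * f b.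

Let f_nmod : nmod_morphism f.
Proof. by split=> //; rewrite -(scale0r 0) fZ mul0r. Qed.
HB.instance Definition _ := GRing.isNmodMorphism.Build A k^o f f_nmod.
Let f_mon : monoid_morphism f. Proof. by []. Qed.
HB.instance Definition _ := GRing.isMonoidMorphism.Build A k^o f f_mon.
Let f_scal : scalable f. Proof. by []. Qed.
HB.instance Definition _ := GRing.isScalable.Build k A k^o *:%R f f_scal.

Lemma spec_of_fun : exists x : spec A, forall a, ev a x = f a.
Proof. by exists (f : {lrmorphism A -> k^o}). Qed.

End SpecOfFun.

Section Nullstellensatz.
Context (k : closedFieldType) (A : comAlgType k).
Hypothesis fgA : finitely_generated_algebra A.

Lemma nullstellensatz (I : set A) : ideal I -> ~ I 1 ->
  exists x : spec A, forall a, I a -> ev a x = 0.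
Proof.
move=> idI I1; have [m [idm m1 Im mmax]] := maximal_ideal idI I1.
have [K [pi pi_ker]] := residue_field idm m1 mmax.
have [s sA] := fgA.
(* The last clause ranges over all nonzero [v], although only [v = 1] is wanted in the end:
   adjoining a generator replaces [v] by some [u] of the smaller ring over which there is no
   control. *)
pose good (S : subringClosed K) := forall v, v \in S -> v != 0 ->
  exists psi : K -> k, [/\ hom_on S psi,
    forall c, pi c%:A \in S /\ psi (pi c%:A) = c & psi v != 0].
have [S [gS sS]] : exists S : subringClosed K, good S /\
    forall a, a \in s -> pi a \in S.
  clear sA; elim: s => [|a s [S [gS sS]]].
    pose i : {rmorphism k -> K} := pi \o in_alg A.
    exists (ring_image i : subringClosed K); split=> // v vS v0.
    have iK c : xget 0 [set d | i d = i c] = c.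
      by case: xgetP => [d _ /fmorph_inj|/(_ c)[]].
    exists (fun x => xget 0 [set d | i d = x]); split.
    - split; first by have := iK 1; rewrite rmorph1.
      + move=> _ _ /asboolP[x <-] /asboolP[y <-].
        by rewrite -rmorphD !iK.
      + move=> _ _ /asboolP[x <-] /asboolP[y <-].
        by rewrite -rmorphM !iK.
    - move=> c; split; last exact: iK.
      by apply/asboolP; exists c.
    - move: v0; have /asboolP[c <-] := vS; rewrite iK; apply: contraNneq => ->.
      by rewrite rmorph0.
  exists (adjoin S (pi a) : subringClosed K); split.
    move=> v vS v0; have [u [uS u0 uext]] := hom_extension k vS v0.
    have [phi [hphi phiC phiu]] := gS u uS u0.
    have [psi [hpsi psiE psiv]] := uext phi hphi phiu.
    exists psi; split=> // c; have [cS phic] := phiC c.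
    by rewrite psiE//; split=> //; exact: sub_adjoin.
  move=> b; rewrite inE => /orP[/eqP->|/sS bS]; first exact: mem_adjoin.
  exact: sub_adjoin.
have [psi [[psi1 psiD psiM] psiC _]] := gS 1 (rpred1 _) (oner_neq0 _).
have piS a : pi a \in S.
  have : [set: A] a by [].
  rewrite -sA; apply: (_ : smallest _ _ `<=` [set a | pi a \in S]).
  apply: smallest_sub => [|b /= /sS//]; split; rewrite ?inE/=.
  - by rewrite rmorph1 rpred1.
  - move=> c u v; rewrite !inE/= => uS vS.
    by rewrite -mulr_algl rmorphD rmorphM rpredD// rpredM//; case: (psiC c).
  - by move=> u v; rewrite !inE/= => uS vS; rewrite rmorphM rpredM.
pose f (a : A) : k^o := psi (pi a).
have [|c a|||x fx] := spec_of_fun (f := f).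
- by move=> a b; rewrite /f rmorphD psiD.
- by rewrite /f -mulr_algl rmorphM psiM//; have [_ ->] := psiC c.
- by rewrite /f rmorph1.
- by move=> a b; rewrite /f rmorphM psiM.
exists x => a Ia; rewrite fx /f.
have -> : pi a = pi (0%:A) by rewrite scale0r rmorph0; apply/pi_ker/Im.
by have [_ ->] := psiC 0.
Qed.

(* If g = a / b on D(c), then cb * g = ca everywhere, as both sides vanish off
   D(c); so the denominators of g form an ideal without zeros. *)
Lemma regular_affine (g : affine A -> k) : regular setT g ->
  exists a, g = ev a.
Proof.
move=> rg.
pose I : set A := [set d | exists a, forall x, ev d x * g x = ev a x].
have [I1|I1] := pselect (I 1).
  have [a ga] := I1; exists a; apply/funext => x.
  by rewrite -ga /ev rmorph1 mul1r.
have idI : ideal I.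
  split; first by exists 0 => x; rewrite /ev !rmorph0 mul0r.
  move=> a u v [u' uE] [v' vE]; exists (a * u' + v') => x.
  by rewrite /ev !rmorphD !rmorphM mulrDl -mulrA [X in _ * X]uE [X in _ + X]vE.
have [x xI] := nullstellensatz idI I1.
have [a [b [c [cx cab]]]] := (regular_specP _ _).1 rg x Logic.I.
have : ev (c * b) x = 0.
  apply: xI; exists (c * a) => y; rewrite /ev !rmorphM.
  have [c0|c0] := eqVneq (ev c y) 0.
    by rewrite [X in X * _ * _]c0 [X in _ = X * _]c0 !mul0r.
  have [by0 gy] := cab y c0.
  by rewrite gy -mulrA; congr (_ * _); rewrite mulrC divfK.
have [bx _] := cab x cx.
by rewrite /ev rmorphM => /eqP; rewrite mulf_eq0 (negPf cx) (negPf bx).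
Qed.

End Nullstellensatz.

(** * Semigroup algebras and characters *)

Section SgalgTheory.
Context (k : fieldType).
Implicit Types L : nmodType.

Lemma mcoeff_tmon L (a b : L) : (tmon k a : sgalg k L)@_b = (a == b)%:R.
Proof. exact: mcoeffU. Qed.

Lemma mcoeff_lincomb L (I : Type) (s : seq I) (c : I -> k) (F : I ->
  sgalg k L) b :
  (\sum_(i <- s) c i *: F i)@_b = \sum_(i <- s) c i * (F i)@_b.
Proof.
elim: s => [|i s IH]; first by rewrite !big_nil mcoeff0.
by rewrite !big_cons mcoeffD mcoeffZ IH.
Qed.

Lemma evD (A : comAlgType k) (a b : A) x : ev (a + b) x = ev a x + ev b x.
Proof. exact: rmorphD. Qed.

Lemma evM (A : comAlgType k) (a b : A) x : ev (a * b) x = ev a x * ev b x.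
Proof. exact: rmorphM. Qed.

Lemma evZ (A : comAlgType k) c (a : A) x : ev (c *: a) x = c * ev a x.
Proof. by rewrite /ev linearZ. Qed.

Lemma ev0 (A : comAlgType k) x : ev (0 : A) x = 0.
Proof. exact: rmorph0. Qed.

Lemma ev1 (A : comAlgType k) x : ev (1 : A) x = 1.
Proof. exact: rmorph1. Qed.

Lemma evB (A : comAlgType k) (a b : A) x : ev (a - b) x = ev a x - ev b x.
Proof. exact: rmorphB. Qed.

Lemma ev_lincomb (A : comAlgType k) (I : Type) (s : seq I) (c : I ->
  k) (F : I -> A) x :
  ev (\sum_(i <- s) c i *: F i) x = \sum_(i <- s) c i * ev (F i) x.
Proof.
elim: s => [|i s IH]; first by rewrite !big_nil ev0.
by rewrite !big_cons evD evZ IH.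
Qed.

Lemma ev_sgalg L (p : sgalg k L) (x : tspec k L) :
  ev p x = \sum_(a <- msupp p) p@_a * tval a x.
Proof. by rewrite {1}(sgalgE p) ev_lincomb. Qed.

Lemma sgalg_linear_eq L (p q : sgalg k L) : (forall a, p@_a = q@_a) -> p = q.
Proof. by move/malgP. Qed.

Lemma ev_tmon L (a : L) (x : tspec k L) : ev (tmon k a) x = tval a x.
Proof. by []. Qed.

Lemma tvalMn L (a : L) N (x : tspec k L) :
  tval (a *+ N) x = tval a x ^+ N.
Proof.
elim: N => [|N IH]; first by rewrite mulr0n tval0 expr0.
by rewrite mulrS tvalD IH exprS.
Qed.

Section Map.
Context (L L' : nmodType) (h : L -> L') (c : L -> k).

Definition sgmap (p : sgalg k L) : sgalg k L' :=
  \sum_(a <- msupp p) (p@_a * c a) *: tmon k (h a).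

Lemma ev_sgmap p (x : tspec k L') :
  ev (sgmap p) x = \sum_(a <- msupp p) p@_a * (c a * tval (h a) x).
Proof. by rewrite ev_lincomb; apply: eq_bigr => a _; rewrite mulrA. Qed.

Lemma mcoeff_sgmap p b :
  (sgmap p)@_b = \sum_(a <- msupp p | h a == b) p@_a * c a.
Proof.
rewrite mcoeff_lincomb [RHS]big_mkcond/=; apply: eq_bigr => a _.
by rewrite mcoeff_tmon; case: eqP; rewrite ?mulr1 ?mulr0.
Qed.

Hypothesis h_inj : injective h.

Lemma mcoeff_sgmap_inj p a : (sgmap p)@_(h a) = p@_a * c a.
Proof.
rewrite mcoeff_sgmap; under eq_bigl do rewrite (inj_eq h_inj).
have [ap|ap] := boolP (a \in msupp p).
  rewrite big_mkcond (bigD1_seq a) ?fset_uniq//= eqxx big1 ?addr0//.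
  by move=> b /negPf ->.
rewrite (mcoeff_outdom ap) mul0r big1_seq// => b /andP[/eqP-> bp].
by rewrite bp in ap.
Qed.

End Map.

Lemma mcoeff_sgmap_out L L' (h : L -> L') c p b : (forall a, h a <> b) ->
  (sgmap h c p)@_b = 0.
Proof. by move=> hb; rewrite mcoeff_sgmap big1// => a /eqP /hb. Qed.

Section Separating.
Context (L : nmodType) (G : set (tspec k L)).
Hypothesis Gsep : forall a b : L, a != b ->
  exists2 x, G x & tval a x != tval b x.

(* Subtracting from a translate of p a multiple of p kills a monomial. *)
Lemma isolate_monomial (V : set (sgalg k L)) (p : sgalg k L) a :
  (forall c u v, V u -> V v -> V (c *: u + v)) ->
  (forall x q, G x -> V q -> V (sgmap id (fun b => tval b x) q)) ->
  V p -> a \in msupp p -> V (tmon k a).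
Proof.
move=> Vlin Vtr; have [n] := ubnP #|` msupp p|; elim: n => // n IH in p *.
rewrite ltnS => pn Vp ap.
have [[b bp ba]|only] := pselect (exists2 b, b \in msupp p & b != a).
  have [x Gx xab] := Gsep ba.
  pose q := (- tval b x) *: p + sgmap id (fun b => tval b x) p.
  have qE d : q@_d = p@_d * (tval d x - tval b x).
    by rewrite mcoeffD mcoeffZ (mcoeff_sgmap_inj _ (@inj_id L)) mulrBr mulNr
      mulrC addrC.
  apply: (IH q).
  - apply: leq_trans pn; apply: fproper_ltn_card.
    rewrite fproperE; apply/andP; split;
      [apply/fsubsetP => d|apply/negP => /fsubsetP/(_ b bp)].
      by rewrite -!mcoeff_neq0 qE mulf_eq0 negb_or => /andP[].
    by rewrite -mcoeff_neq0 qE subrr mulr0 eqxx.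
  - by apply: Vlin => //; exact: Vtr.
  - by rewrite -mcoeff_neq0 qE mulf_neq0 ?mcoeff_neq0// subr_eq0 eq_sym.
have pE : p = p@_a *: tmon k a.
  apply/sgalg_linear_eq => b; rewrite mcoeffZ mcoeff_tmon.
  case: eqVneq => [<-|ab]; first by rewrite mulr1.
  rewrite mulr0; apply: mcoeff_outdom; apply/negP => bp.
  by apply: only; exists b; rewrite // eq_sym.
have V0 : V 0 by rewrite -(addNr p) -scaleN1r; exact: Vlin.
have -> : tmon k a = (p@_a)^-1 *: p + 0.
  by rewrite addr0 {2}pE scalerA mulVf ?mcoeff_neq0// scale1r.
exact: Vlin.
Qed.

Hypothesis Gmul : forall x y, G x -> G y -> exists2 z, G z &
  forall a, tval a z = tval a x * tval a y.
Hypothesis Gnz : forall a, exists2 x, G x & tval a x != 0.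

(** Independence of characters: the elements vanishing on [G] form a subspace stable under
    translation by [G], hence contain every monomial of each member, while a monomial is nonzero
    somewhere on [G]. *)
Lemma sgalg_eval_inj (p : sgalg k L) : (forall x, G x -> ev p x = 0) -> p = 0.
Proof.
move=> p0; apply: sgalg_linear_eq => a; rewrite mcoeff0.
apply: mcoeff_outdom; apply/negP => ap.
have [] := Gnz a; suff ta0 : forall x, G x -> ev (tmon k a) x = 0.
  by move=> x /ta0 tx; rewrite /tval tx eqxx.
move: p0 ap; apply: (@isolate_monomial [set q | forall x, G x -> ev q x = 0]).
  by move=> c u v u0 v0 x Gx; rewrite evD evZ u0// v0// mulr0 addr0.
move=> x q Gx q0 y Gy; have [z Gz zE] := Gmul Gx Gy.
rewrite -(q0 z Gz) ev_sgmap ev_sgalg; apply: eq_bigr => b _.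
by rewrite zE.
Qed.

Lemma separating_dense (U : set (tspec k L)) : open U -> U !=set0 ->
  exists2 x, G x & U x.
Proof.
move=> /open_specP oU [y /oU[a [ay aU]]]; apply: contrapT => noG.
suff a0 : a = 0 by move: ay; rewrite a0 ev0 eqxx.
apply: sgalg_eval_inj => x Gx; apply: contrapT => /eqP/aU Ux.
by apply: noG; exists x.
Qed.

Lemma separating_ext (Y : fspace k) (f g : tspec k L -> Y) : separated Y ->
  morphism f -> morphism g -> (forall x, G x -> f x = g x) -> f =1 g.
Proof.
move=> sepY mf mg fg x; apply: contrapT => fgx.
have [||y Gy] := @separating_dense [set y | f y <> g y].
- by have /closed_openC := closed_equalizer sepY mf mg.
- by exists x.
by apply; exact: fg.
Qed.

End Separating.

Section Restriction.
Context (L M : nmodType) (h : {additive L -> M}).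

Let chi0 (x : tspec k M) : tval (h 0) x = 1.
Proof. by rewrite raddf0 tval0. Qed.
Let chiD (x : tspec k M) a b : tval (h (a + b)) x = tval (h a) x * tval (h b) x.
Proof. by rewrite raddfD tvalD. Qed.

(** Taking for [h] the map [subval] embeds the torus in a chart, [incl] gives the map between two
    charts, and [weight] gives a curve from the affine line to a chart. *)
Definition tres (x : tspec k M) : tspec k L := char_point (chi0 x) (chiD x).

Lemma tresE a x : tval a (tres x) = tval (h a) x.
Proof. exact: ev_char_point. Qed.

Lemma ev_tres p x : ev p (tres x) = ev (sgmap h (fun=> 1) p) x.
Proof.
rewrite ev_sgmap ev_sgalg; apply: eq_bigr => a _.
by rewrite tresE mul1r.
Qed.

Lemma tres_morphism : @morphism k (tspec k M) (tspec k L) tres.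
Proof.
apply: affine_morphism => p; exists (sgmap h (fun=> 1) p) => x.
by rewrite ev_tres.
Qed.

Lemma tact_morphism (t : tspec k M) :
  @morphism k (tspec k L) (tspec k L) (tact h t).
Proof.
apply: affine_morphism => p; exists (sgmap id (fun a => tval (h a) t) p) => x.
rewrite ev_sgmap ev_sgalg; apply: eq_bigr => a _.
by rewrite tactE.
Qed.

End Restriction.

Lemma tspec_ext L (x y : tspec k L) : (forall a, tval a x = tval a y) -> x = y.
Proof. exact: spec_sgalg_ext. Qed.

Lemma tres_idfun L (x : tspec k L) : tres (idfun : {additive L -> L}) x = x.
Proof. by apply: tspec_ext => a; rewrite tresE. Qed.

End SgalgTheory.

Arguments tres : simpl never.
Arguments tval : simpl never.
Arguments ev : simpl never.

(** * Localization of semigroup algebras *)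

Section Localization.
Context (k : fieldType) (L L' : nmodType) (h : {additive L -> L'}) (m : L).
Hypothesis h_inj : injective h.
Hypothesis h_unit : exists n, n + h m = 0.
Hypothesis h_loc : forall b, exists N a, b + h m *+ N = h a.

Let m_unit (y : tspec k L') : tval (h m) y != 0.
Proof.
have [n nm] := h_unit; apply/negP => /eqP m0; have := tval0 y.
by rewrite -nm tvalD m0 mulr0 => /eqP; rewrite eq_sym oner_eq0.
Qed.

(** A character of [L] that is nonzero at [m] extends to [L'] by fractions. [F] quantifies over all
    ways to clear the denominator of [b], so existence and independence of the choice are proved
    together. *)
Lemma tres_surj (x : tspec k L) : tval m x != 0 -> exists y, tres h y = x.
Proof.
move=> mx.
have F b : exists c, forall N a, b + h m *+ N = h a ->
  c = tval a x / tval m x ^+ N.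
  have [N [a ba]] := h_loc b; exists (tval a x / tval m x ^+ N) => N' a' ba'.
  have : h (a + m *+ N') = h (a' + m *+ N).
    by rewrite !raddfD !raddfMn -ba -ba' -!addrA [h m *+ N + _]addrC.
  move=> /h_inj /(congr1 (fun a => tval a x)).
  rewrite !tvalD !tvalMn => aE.
  apply/eqP; rewrite eqr_div ?expf_neq0//; exact/eqP.
have [chi chiE] := choice F.
have chi0 : chi 0 = 1.
  by rewrite (chiE 0 0%N 0) ?tval0 ?expr0 ?divr1// mulr0n addr0 raddf0.
have chiD a b : chi (a + b) = chi a * chi b.
  have [N [a' aE]] := h_loc a; have [N' [b' bE]] := h_loc b.
  rewrite (chiE _ _ _ aE) (chiE _ _ _ bE) (chiE _ (N + N')%N (a' + b')).
    by rewrite tvalD exprD mulf_div.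
  by rewrite raddfD mulrnDr addrACA aE bE.
exists (char_point chi0 chiD); apply: tspec_ext => a.
by rewrite tresE [LHS]ev_char_point (chiE _ 0%N a) ?expr0 ?divr1// addr0.
Qed.

Lemma clear_denominators (p : sgalg k L') : exists N (q : sgalg k L),
  forall y, ev q (tres h y) = ev p y * tval (h m) y ^+ N.
Proof.
rewrite (sgalgE p); elim: (enum_fset _) => [|b s [N [q qE]]].
  by exists 0%N, 0 => y; rewrite big_nil !ev0 mul0r.
have [N' [a ba]] := h_loc b.
exists (N' + N)%N, (p@_b *: (tmon k a * tmon k (m *+ N)) + tmon k (m *+ N') *
  q) => y.
rewrite big_cons !evD !evZ !evM qE !ev_tmon !tresE.
rewrite -ba tvalD !raddfMn !tvalMn exprD.
by rewrite mulrDl -!mulrA; congr (_ + _); rewrite mulrCA.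
Qed.

Let tres_inj : injective (tres h : tspec k L' -> tspec k L).
Proof.
move=> y y' yy; apply: tspec_ext => b; have [N [a ba]] := h_loc b.
have hE c : tval (h c) y = tval (h c) y' by rewrite -!tresE yy.
have := hE a; rewrite -ba !tvalD !tvalMn -(hE m).
by apply: mulIf; rewrite expf_neq0.
Qed.

Lemma tres_open_immersion :
  @open_immersion k (tspec k L') (tspec k L) (tres h).
Proof.
have openD (c : sgalg k L') (y : tspec k L') : ev c y != 0 ->
    exists c' : sgalg k L, ev c' (tres h y) != 0 /\ forall x, ev c' x != 0 ->
      exists2 y', tres h y' = x & ev c y' != 0.
  move=> cy; have [N [q qE]] := clear_denominators c.
  (* The factor t^m confines the open set to the points that lift through [tres h]. *)
  exists (q * tmon k m); rewrite evM qE ev_tmon tresE; split.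
    by rewrite !mulf_neq0// expf_neq0.
  move=> x; rewrite evM mulf_eq0 => /norP[qx /tres_surj[y' yx]].
  exists y' => //; apply: contraNneq qx => cy'.
  by rewrite -yx qE cy' mul0r.
split.
- exact: tres_morphism.
- exact: tres_inj.
- move=> U /open_specP oU; apply/open_specP => _ [y /oU[c [cy cU]] <-].
  have [c' [cy' c'P]] := openD c y cy; exists c'; split=> // x /c'P[y' yx cy''].
  by exists y' => //; exact: cU.
move=> U g oU /regular_specP rg; apply/regular_specP => _ [y Uy <-].
have [a [b [c [cy cab]]]] := rg _ Uy.
have [c' [cy' c'P]] := openD c y cy.
have [Na [a' aE]] := clear_denominators a.
have [Nb [b' bE]] := clear_denominators b.
(* The elements [a] and [b] are [a'] and [b'] divided by the powers [Na] and [Nb] of t^m; the powers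
   are exchanged to form their quotient. *)
exists (a' * tmon k (m *+ Nb)), (b' * tmon k (m *+ Na)), c'; split=> //.
move=> _ /c'P[y' <- /cab/=[by' ->]].
rewrite !evM aE bE !ev_tmon !tresE !raddfMn !tvalMn.
have mN N : tval (h m) y' ^+ N != 0 by rewrite expf_neq0.
split; first by rewrite !mulf_neq0.
by move: (mN Na) (mN Nb) by' => p0 q0 by'; field; rewrite by' p0 q0.
Qed.

End Localization.

(** * Points of tori *)

Section TorusPoints.
Context (k : closedFieldType) (M : zmodType).

Lemma one_parameter_point (v : {additive M -> int}) (z : k) : z != 0 ->
  exists t : tspec k M, forall m, tval m t = z ^ v m.
Proof.
move=> z0; have chi0 : z ^ v 0 = 1 by rewrite raddf0 expr0z.
have chiD (a b : M) : z ^ v (a + b) = z ^ v a * z ^ v b.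
  by rewrite raddfD expfzDr.
exists (@char_point k M (fun m => z ^ v m) chi0 chiD) => m.
exact: ev_char_point.
Qed.

Lemma trivial_point : exists t : tspec k M, forall m, tval m t = 1.
Proof.
have chiD (a b : M) : 1 = 1 * 1 :> k by rewrite mulr1.
exists (@char_point k M (fun=> 1) erefl chiD) => m.
exact: ev_char_point.
Qed.

Lemma exists_nontorsion (n : int) : n != 0 ->
  exists2 z : k, z != 0 & z ^ n != 1.
Proof.
(* The polynomial is nonzero in every characteristic, since the second factor is monic, and an
   algebraically closed field provides a non-root; the factor X keeps that non-root away from 0. *)
move=> n0; have : 'X * ('X^(absz n) - 1) != 0 :> {poly k}.
  by rewrite mulf_neq0 ?polyX_eq0// monic_neq0// monicXnsubC// lt0n absz_eq0.
move=> /closed_nonrootP[z]; rewrite /root !hornerE mulf_eq0 negb_or subr_eq0.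
move=> /andP[z0 zn]; exists z => //.
apply: contraNneq zn; case: (intP n) => [|{n0}n|{n0}n]; first by rewrite expr0z.
  by move=> zn; apply/eqP.
by rewrite -invr_expz => /eqP; rewrite invr_eq1 => /eqP zn; apply/eqP.
Qed.

Lemma tval_torus_neq0 (m : M) (t : tspec k M) : tval m t != 0.
Proof.
apply/negP => /eqP m0; have := tval0 t.
by rewrite -(subrr m) tvalD m0 mul0r => /eqP; rewrite eq_sym oner_eq0.
Qed.

Section Embedded.
Hypothesis Msep : forall a b : M, a != b ->
  exists t : tspec k M, tval a t != tval b t.
Section Submonoid.
Context (L : nmodType) (i : {additive L -> M}).
Hypothesis i_inj : injective i.
Let G : set (tspec k L) := range (tres i).

Let G_sep (a b : L) : a != b -> exists2 x, G x & tval a x != tval b x.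
Proof.
rewrite -(inj_eq i_inj) => /Msep[t tab].
by exists (tres i t); [exists t|rewrite !tresE].
Qed.

Let G_mul x y : G x -> G y ->
  exists2 z, G z & forall a, tval a z = tval a x * tval a y.
Proof.
move=> [s _ <-] [t _ <-]; exists (tres i (tmul s t));
  first by exists (tmul s t).
by move=> a; rewrite !tresE tactE.
Qed.

Let G_nz (a : L) : exists2 x, G x & tval a x != 0.
Proof.
have [t _] := trivial_point.
by exists (tres i t); [exists t|rewrite tresE tval_torus_neq0].
Qed.

Lemma torus_isolate (V : set (sgalg k L)) (p : sgalg k L) a :
  (forall c u v, V u -> V v -> V (c *: u + v)) ->
  (forall t q, V q -> V (sgmap id (fun b => tval (i b) t) q)) ->
  V p -> a \in msupp p -> V (tmon k a).
Proof.
move=> Vlin Vtr; apply: (isolate_monomial G_sep Vlin) => _ q [t _ <-] /Vtr.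
have -> // : sgmap id (fun b => tval b (tres i t)) q = sgmap id (fun b =>
  tval (i b) t) q.
by apply: eq_bigr => b _; rewrite tresE.
Qed.

Lemma torus_eval_inj (p q : sgalg k L) :
  (forall t, ev p (tres i t) = ev q (tres i t)) -> p = q.
Proof.
move=> pq; apply/subr0_eq/(sgalg_eval_inj G_sep G_mul G_nz) => _ [t _ <-].
by rewrite evB pq subrr.
Qed.

Lemma torus_ext (Y : fspace k) (f g : tspec k L -> Y) : separated Y ->
  morphism f -> morphism g -> (forall t, f (tres i t) = g (tres i t)) -> f =1 g.
Proof.
move=> sepY mf mg fg; apply: (separating_ext G_sep G_mul G_nz) => // _ [t _ <-].
exact: fg.
Qed.

End Submonoid.

Lemma torus_eval_inj_id (p q : sgalg k M) :
  (forall t : tspec k M, ev p t = ev q t) -> p = q.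
Proof.
move=> pq; apply: (@torus_eval_inj _ idfun (@inj_id M)) => t.
by rewrite tres_idfun.
Qed.

End Embedded.

(* The affine line is [tspec k nat], with coordinate [tval 1]. *)
Lemma line_ext (Y : fspace k) (f g : tspec k nat -> Y) : separated Y ->
  morphism f -> morphism g -> (forall x, tval 1%N x != 0 -> f x = g x) ->
    f =1 g.
Proof.
have tvalX n (x : tspec k nat) : tval n x = tval 1%N x ^+ n.
  elim: n => [|n IH]; first exact: (tval0 x).
  by rewrite exprS -IH; exact: (tvalD 1%N n x).
have point (z : k) : exists x : tspec k nat, tval 1%N x = z.
  have chi0 : z ^+ (0 : nat) = 1 by rewrite expr0.
  have chiD (a b : nat) : z ^+ (a + b)%R = z ^+ a * z ^+ b by exact: exprD.
  exists (@char_point k nat (fun n => z ^+ n) chi0 chiD).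
  by rewrite /tval ev_char_point expr1.
pose G : set (tspec k nat) := [set x | tval 1%N x != 0].
have Gsep (a b : nat) : a != b -> exists2 x, G x & tval a x != tval b x.
  move=> ab; have [z z0 zab] : exists2 z : k, z != 0 & z ^ (a%:Z - b%:Z) != 1.
    by apply: exists_nontorsion; rewrite subr_eq0 eqz_nat.
  have [x xz] := point z; exists x; first by rewrite /G /mkset xz.
  rewrite (tvalX a) (tvalX b) xz; apply: contraNneq zab => abE.
  by rewrite expfzDr// -invr_expz -!exprnP abE mulfV// expf_neq0.
have Gmul x y : G x -> G y ->
    exists2 z, G z & forall a : nat, tval a z = tval a x * tval a y.
  move=> x0 y0; have [z zE] := point (tval 1%N x * tval 1%N y).
  exists z; first by rewrite /G /mkset zE mulf_neq0.
  by move=> a; rewrite (tvalX a x) (tvalX a y) (tvalX a z) zE exprMn.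
have Gnz (a : nat) : exists2 x, G x & tval a x != 0.
  have [x xE] := point 1; exists x; first by rewrite /G /mkset xE oner_neq0.
  by rewrite (tvalX a) xE expr1n oner_neq0.
move=> sepY mf mg fg; exact: (separating_ext Gsep Gmul Gnz sepY mf mg).
Qed.

End TorusPoints.

Section LatticeTorus.
Context (k : closedFieldType) (r : nat).
Notation M := 'rV[int]_r.

Definition pair_with (v : 'cV[int]_r) (m : M) : int := (m *m v) 0 0.

Let pair_with_nmod v : nmod_morphism (pair_with v).
Proof. by split=> [|a b]; rewrite /pair_with ?mul0mx ?mulmxDl mxE. Qed.
HB.instance Definition _ v :=
  GRing.isNmodMorphism.Build M int (pair_with v) (pair_with_nmod v).

Lemma torus_separates (a b : M) : a != b ->
  exists t : tspec k M, tval a t != tval b t.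
Proof.
move=> ab; have [i abi] : exists i, a 0 i - b 0 i != 0.
  apply: contrapT => nab; move/negP: ab; apply; apply/eqP/rowP => i.
  by apply/eqP; rewrite -subr_eq0; apply: contrapT => /negP abi; apply: nab;
    exists i.
have [z z0 zab] := exists_nontorsion k abi.
have [t tE] := one_parameter_point (pair_with (delta_mx i 0)) z0.
have mE (m : M) : pair_with (delta_mx i 0) m = m 0 i.
  rewrite /pair_with mxE (bigD1 i)//= mxE !eqxx mulr1 big1 ?addr0// => l li.
  by rewrite mxE (negPf li) mulr0.
exists t; rewrite !tE /= !mE; apply: contraNneq zab => abE.
by rewrite expfzDr// abE -invr_expz mulfV// expfz_neq0.
Qed.

End LatticeTorus.

(** * Toric charts *)

Section Submonoids.
Context (M : zmodType).
Implicit Types L : addrClosed M.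

Definition subval L : {additive submonoid L -> M} := val.

Lemma subval_inj L : injective (subval L).
Proof. exact: val_inj. Qed.

Section Inclusion.
Variables (L L' : addrClosed M).
Hypothesis sLL' : {subset L <= L'}.

Definition incl_fun (x : submonoid L) : submonoid L' :=
  exist _ (val x) (sLL' (valP x)).

Let incl_nmod : nmod_morphism incl_fun.
Proof. by split=> [|x y]; apply: val_inj => /=; rewrite ?raddf0 ?raddfD. Qed.
HB.instance Definition _ :=
  GRing.isNmodMorphism.Build (submonoid L) (submonoid L') incl_fun incl_nmod.

Definition incl : {additive submonoid L -> submonoid L'} := incl_fun.

Lemma incl_inj : injective incl.
Proof. by move=> x y /(congr1 val)/= xy; exact: val_inj. Qed.

End Inclusion.

Section Localize.
Variables (L : addrClosed M) (m : M).

Definition localize : {pred M} := [pred l | `[< exists N, l + m *+ N \in L >]].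

Lemma localize_closed : addr_closed localize.
Proof.
split; first by apply/asboolP; exists 0%N; rewrite addr0 rpred0.
move=> a b /asboolP[N aN] /asboolP[N' bN]; apply/asboolP; exists (N + N')%N.
by rewrite mulrnDr addrACA rpredD.
Qed.

HB.instance Definition _ := GRing.isAddClosed.Build M localize localize_closed.

Lemma localizeP l : reflect (exists N, l + m *+ N \in L) (l \in localize).
Proof. exact: asboolP. Qed.

Lemma sub_localize : {subset L <= localize}.
Proof. by move=> l lL; apply/localizeP; exists 0%N; rewrite addr0. Qed.

Lemma localizeN : - m \in localize.
Proof. by apply/localizeP; exists 1%N; rewrite addNr rpred0. Qed.

End Localize.

Lemma tres_incl (k : fieldType) (L L' : addrClosed M) (sLL' : {subset L <= L'})
  (t : tspec k M) : tres (incl sLL') (tres (subval L') t) = tres (subval L) t.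
Proof. by apply: tspec_ext => a; rewrite !tresE. Qed.

End Submonoids.

Section Charts.
Context (k : closedFieldType) (X : fspace k) (M : zmodType) (e : tspec k M ->
  X).
Hypothesis Msep : forall a b : M, a != b ->
  exists t : tspec k M, tval a t != tval b t.
Hypothesis (sepX : separated X) (oe : open_immersion e).
Implicit Types L : addrClosed M.

(* Near x the function t^m is a fraction a / b with b(x) <> 0, that is,
   b t^m = a in k[t^M]. *)
Lemma transition (L L' : nmodType) (i : {additive L ->
  M}) (i' : {additive L' -> M})
    (f : tspec k L -> X) (f' : tspec k L' -> X) x x' m :
  injective i -> morphism f -> open_immersion f' ->
  (forall t, f (tres i t) = e t) -> (forall t, f' (tres i' t) = e t) ->
  f x = f' x' -> exists l l', tval l x != 0 /\ i l + i' m = i l'.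
Proof.
move=> i_inj mf [mf' f'_inj of' rf'] fe f'e fx.
have [g gE] := extend_along (tval m) f'_inj.
have rg : regular (range f') g.
  apply: rf'; first exact: openT.
  have -> : g \o f' = tval m by apply/funext => y; exact: gE.
  exact: regular_ev.
have orf' : open (range f') by apply: of'; exact: openT.
have /regular_specP rgf := mf.2 _ _ orf' rg.
have [a [b [c [cx cab]]]] : exists a b c, ev c x != 0 /\
    forall y, ev c y != 0 -> ev b y != 0 /\ (g \o f) y = ev a y / ev b y.
  by apply: rgf; exists x'.
pose h (l : L) : M := i l + i' m.
have h_inj : injective h by move=> l l' /addIr/i_inj.
(* The equation t^m = a / b is known only where [c] does not vanish; the factor [c] makes both sides
   zero elsewhere, so they agree at every point of the torus. *)
have pq : sgmap h (fun=> 1) (c * b) = sgmap i (fun=> 1) (c * a).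
  apply: (torus_eval_inj_id Msep) => t.
  have -> : ev (sgmap h (fun=> 1) (c * b)) t =
      ev (c * b) (tres i t) * tval (i' m) t.
    rewrite ev_sgmap ev_sgalg mulr_suml; apply: eq_bigr => l _.
    by rewrite mul1r tvalD tresE mulrA.
  rewrite -ev_tres !evM.
  have [->|ct] := eqVneq (ev c (tres i t)) 0; first by rewrite !mul0r.
  have [bt] := cab _ ct; rewrite /= fe -f'e gE tresE => ->.
  by rewrite -mulrA; congr (_ * _); rewrite mulrC divfK.
have [bx _] := cab _ cx.
(* Since [c * b] is nonzero at [x], so is one of its monomials t^l. By [pq], the exponent of t^l
   times t^m then occurs on the right, where all exponents come from [L]. *)
have [l lcb lx] : exists2 l, l \in msupp (c * b) & tval l x != 0.
  apply: contrapT => nol; have := mulf_neq0 cx bx.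
  rewrite -evM ev_sgalg big1_seq ?eqxx// => l /andP[_ lcb].
  apply/eqP; rewrite mulf_eq0; apply/orP; right; apply: contrapT => /negP lx.
  by apply: nol; exists l.
exists l; apply: contrapT => nol'.
have := congr1 (fun p : sgalg k M => p@_(h l)) pq.
rewrite mcoeff_sgmap_inj// mcoeff_sgmap_out ?mulr1 => [l0|l' ll'].
  by move: lcb; rewrite -mcoeff_neq0 l0 eqxx.
by apply: nol'; exists l'.
Qed.

Definition toric_chart L (f : tspec k (submonoid L) -> X) : Prop :=
  open_immersion f /\ forall t, f (tres (subval L) t) = e t.

(** The open orbit is itself a chart, with monoid all of [M]; comparing [f] with it at a torus point
    writes each [m] as a difference of elements of [L]. *)
Lemma chart_group L f m : @toric_chart L f ->
  exists l l', [/\ l \in L, l' \in L & l + m = l'].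
Proof.
move=> [[mf f_inj _ _] fe]; have [t _] := trivial_point k M.
have ee s : e (tres idfun s) = e s by rewrite tres_idfun.
have [l [l' [_ ll']]] := transition m (@subval_inj _ L) mf oe fe ee (fe t).
by exists (val l), (val l'); split;
  [exact: (valP l)|exact: (valP l')|exact: ll'].
Qed.

Lemma chart_sub L L' f f' x x' : @toric_chart L f -> @toric_chart L' f' ->
  f x = f' x' -> (forall l, tval l x != 0 -> - val l \in L) -> {subset L' <= L}.
Proof.
move=> [[mf f_inj of_ rf] fe] [of' f'e] fx xL m mL'.
have [l [l' [lx ll']]] := transition (exist _ m mL' : submonoid L')
  (@subval_inj _ L) mf of' fe f'e fx.
have -> : m = val l' + - val l.
  by rewrite -[val l']/(subval L l') -ll' addrAC subrr add0r.
by rewrite rpredD ?xL//; exact: valP.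
Qed.

(** Both sides agree on the torus, which is dense in the chart of [L'], and [X] is separated. *)
Lemma chart_restrict L L' f f' (sLL' : {subset L <= L'}) y :
  @toric_chart L f -> @toric_chart L' f' -> f' y = f (tres (incl sLL') y).
Proof.
move=> [[mf _ _ _] fe] [[mf' _ _ _] f'e].
have mfr := morphism_comp (tres_morphism k (incl sLL')) mf.
apply: (torus_ext Msep (@subval_inj _ L') sepX mf' mfr _ y) => t.
by rewrite /= tres_incl fe f'e.
Qed.

Lemma chart_localize L f m (mL : m \in L) : @toric_chart L f ->
  @toric_chart (localize L m) (f \o tres (incl (@sub_localize _ L m))) /\
  forall x : tspec k (submonoid L), tval (exist _ m mL : submonoid L) x != 0 ->
    exists y, tres (incl (@sub_localize _ L m)) y = x.
Proof.
move=> [of_ fe]; pose h := incl (@sub_localize _ L m).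
have h_inj : injective h by exact: incl_inj.
pose m' : submonoid L := exist _ m mL.
have h_unit : exists n, n + h m' = 0.
  exists (exist _ (- m) (localizeN L m)); apply: val_inj.
  by rewrite raddfD/= addNr.
have h_loc b : exists N a, b + h m' *+ N = h a.
  have /localizeP[N bN] := valP b; exists N, (exist (fun m => m \in L) _ bN).
  by apply: subval_inj; rewrite raddfD raddfMn.
split; last exact: tres_surj h_inj h_loc.
split; first exact: open_immersion_comp (tres_open_immersion k h_inj h_unit
  h_loc) of_.
by move=> t; rewrite /= tres_incl fe.
Qed.

End Charts.

(** * Faces of finitely generated monoids *)

Section FaceGenerator.
Context (M : zmodType) (L : addrClosed M) (g : seq M).
Hypothesis Lg : [set` L] = submonoid_gen [set` g].

Lemma gen_mem a : a \in g -> a \in L.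
Proof.
move=> ag; have : [set` L] a by rewrite Lg => A [_]; apply.
by [].
Qed.

Lemma gen_ind (P : M -> Prop) : P 0 ->
  (forall a b, a \in L -> b \in L -> P a -> P b -> P (a + b)) ->
  (forall a, a \in g -> P a) -> forall a, a \in L -> P a.
Proof.
move=> P0 PD Pg a aL; have : submonoid_gen [set` g] a by rewrite -Lg.
move=> /(_ [set b | b \in L /\ P b]) /=; case=> //; split.
  split; first by rewrite inE/= rpred0.
  by move=> b c; rewrite !inE/= => -[bL Pb] [cL Pc]; rewrite rpredD//;
    split=> //; exact: PD.
by move=> b bg; split; [exact: gen_mem|exact: Pg].
Qed.

Variable F : {pred M}.
Hypothesis F0 : 0 \in F.
Hypothesis FD : forall a b, a \in L -> b \in L ->
  (a + b \in F) = (a \in F) && (b \in F).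

(** [FD] says that [F] cuts out a face of the monoid [L]. The sum of the generators lying in it is
    in the relative interior of the face, so inverting this single element inverts the whole
    face. *)
Let mF : M := \sum_(a <- g | a \in F) a.

Lemma face_gen_mem : mF \in L /\ mF \in F.
Proof.
rewrite /mF big_seq_cond; elim/big_rec: _ => [|a b /andP[ag aF] [bL bF]].
  by rewrite rpred0 F0.
have aL := gen_mem ag; split; first exact: rpredD.
by rewrite FD// aF.
Qed.

Lemma face_gen_sub a : a \in L -> a \in F -> exists N, mF *+ N - a \in L.
Proof.
move: a; apply: gen_ind => [_|a b aL bL IHa IHb|a ag aF].
- by exists 0%N; rewrite subr0 rpred0.
- rewrite FD// => /andP[/IHa[N NL] /IHb[N' NL']]; exists (N + N')%N.
  by rewrite mulrnDr opprD addrACA rpredD.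
exists 1%N; rewrite /mF (big_rem a ag)/= aF addrAC subrr add0r.
rewrite big_seq_cond; apply: rpred_sum => b /andP[/mem_rem bg _].
exact: gen_mem.
Qed.

(** [a] is a numerator of [l]: whether [l] is a unit of the localization is thereby reduced to
    whether an element of [L] lies in the face. *)
Lemma localize_face l : l \in localize L mF ->
  exists2 a, a \in L & exists N, a = l + mF *+ N /\ (a \in F ->
    - l \in localize L mF).
Proof.
move=> /localizeP[N aL]; exists (l + mF *+ N) => //; exists N; split=> // aF.
have [N' NL] := face_gen_sub aL aF; apply/localizeP; exists N'.
have -> : - l + mF *+ N' = mF *+ N' - (l + mF *+ N) + mF *+ N.
  by rewrite opprD addrA -[RHS]addrA addNr addr0 addrC.
by rewrite rpredD// rpredMn//; case: face_gen_mem.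
Qed.

End FaceGenerator.

Section NonnegativeWeight.
Context (M : zmodType) (L : addrClosed M) (v : {additive M -> int}).
Hypothesis v_ge0 : forall l, l \in L -> 0 <= v l.

(** A one-parameter subgroup [v] that is nonnegative on [L] extends over the origin of the affine
    line. With values in [nat] instead of [int], [tres] turns it into a morphism from the line to
    the chart. *)
Definition weight_fun (l : submonoid L) : nat := absz (v (val l)).

Let weightE l : (weight_fun l)%:Z = v (val l).
Proof. by rewrite /weight_fun gez0_abs// v_ge0//; exact: valP. Qed.

Let weight_nmod : nmod_morphism weight_fun.
Proof.
split=> [|a b]; first by rewrite /weight_fun (raddf0 (subval L)) (raddf0 v).
by apply/eqP; rewrite -eqz_nat weightE PoszD !weightE !raddfD.
Qed.
HB.instance Definition _ :=
  GRing.isNmodMorphism.Build (submonoid L) nat weight_fun weight_nmod.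

Definition weight : {additive submonoid L -> nat} := weight_fun.

Lemma posz_weight l : (weight l)%:Z = v (val l).
Proof. exact: weightE. Qed.

End NonnegativeWeight.

(** * Comparison of charts through limits and common points *)

Section ChartComparison.
Context (k : closedFieldType) (X : fspace k) (M : zmodType) (e : tspec k M ->
  X).
Hypothesis Msep : forall a b : M, a != b ->
  exists t : tspec k M, tval a t != tval b t.
Hypothesis sepX : separated X.
Implicit Types L : addrClosed M.

Lemma chart_equivariant L f (alpha : X -> X) s x : toric_chart e (L:=L) f ->
  morphism alpha -> (forall t, alpha (e t) = e (tmul s t)) ->
  alpha (f x) = f (tact (subval L) s x).
Proof.
move=> [[mf _ _ _] fe] malpha alphae.
have mfs := morphism_comp (tact_morphism (subval L) s) mf.
apply: (torus_ext Msep (@subval_inj _ L) sepX (morphism_comp mf malpha) mfs _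
  x) => t.
rewrite /= fe alphae -fe; congr f; apply: tspec_ext => a.
by rewrite tactE !tresE tactE.
Qed.

Lemma tval_natX n (x : tspec k nat) : tval n x = tval 1%N x ^+ n.
Proof.
elim: n => [|n IH]; first exact: (tval0 x).
by rewrite exprS -IH; exact: (tvalD 1%N n x).
Qed.

(* If v is in the relative interior of both cones, the limits at 0 of the
   one-parameter subgroup v in the two charts are the same point of X. *)
Lemma chart_limit_sub L L' f f' (v : {additive M -> int}) :
  toric_chart e (L:=L) f -> toric_chart e (L:=L') f' ->
  (forall l, l \in L -> 0 <= v l) -> (forall l, l \in L' -> 0 <= v l) ->
  (forall l, l \in L -> v l = 0 -> - l \in L) -> {subset L' <= L}.
Proof.
move=> cf cf' vL vL' vL0; have [[mf _ _ _] fe] := cf;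
  have [[mf' _ _ _] f'e] := cf'.
have chi0 : ((0%N == 0%N)%:R : k) = 1 by [].
have chiD (a b : nat) : ((a + b)%R == 0%N)%:R = (a == 0%N)%:R * (b == 0%N)%:R
  :> k.
  by rewrite -natrM mulnb; congr (_%:R); congr (nat_of_bool _); exact: addn_eq0.
(* The origin of the affine line: its coordinate function is 0, so n goes to 0^n. *)
pose x0 : tspec k nat := @char_point k nat (fun n => (n == 0%N)%:R) chi0 chiD.
have limit (N : addrClosed M) (vN : forall l, l \in N ->
  0 <= v l) x (t : tspec k M) :
    tval 1%N x != 0 -> (forall m, tval m t = tval 1%N x ^ v m) ->
    tres (weight vN) x = tres (subval N) t.
  move=> x1 tE; apply: tspec_ext => a.
  by rewrite !tresE tE tval_natX -[subval N a]/(val a) -posz_weight.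
(* Off the origin both curves run inside the open orbit, where the two charts agree with [e];
   separatedness carries the equality to the origin. *)
have ff' : f (tres (weight vL) x0) = f' (tres (weight vL') x0).
  apply: (line_ext sepX (morphism_comp (tres_morphism _ _) mf)
    (morphism_comp (tres_morphism _ _) mf') _ x0) => x x1.
  have [t tE] := one_parameter_point v x1.
  by rewrite /= !(limit _ _ x t)// fe f'e.
apply: (chart_sub Msep cf cf' ff') => l; rewrite tresE /tval ev_char_point.
have [wl _|_] := eqVneq (weight vL l) 0%N; last by rewrite eqxx.
by apply: vL0; [exact: valP|rewrite -posz_weight wl].
Qed.

(** The characters of [L] that do not vanish at [x] form a face; inverting it makes [x] the most
    special point of a smaller chart. The inverted element is displayed as a sum of members of [g]
    because only finitely many such sums exist, on which the finiteness of the fan rests. *)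
Lemma chart_at_point L f (g : seq M) x : toric_chart e (L:=L) f ->
  [set` L] = submonoid_gen [set` g] ->
  exists (b : pred M) (f' : _ -> X) y, let L' :=
    localize L (\sum_(a <- g | b a) a) in
    [/\ toric_chart e (L:=L') f', \sum_(a <- g | b a) a \in L, f' y = f x &
      forall l, tval l y != 0 -> - val l \in L'].
Proof.
move=> cf Lg.
pose F : {pred M} := [pred a | `[< exists l : submonoid L,
  val l = a /\ tval l x != 0 >]].
have FE (l : submonoid L) : (val l \in F) = (tval l x != 0).
  by apply/asboolP/idP => [[l' [/val_inj ->]]//|lx]; exists l.
have F0 : 0 \in F.
  by apply/asboolP; exists 0; rewrite raddf0 tval0 oner_eq0.
have FD a b : a \in L -> b \in L -> (a + b \in F) = (a \in F) && (b \in F).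
  move=> aL bL; pose a' : submonoid L := exist _ a aL.
  pose b' : submonoid L := exist _ b bL.
  have -> : a + b = val (a' + b') by rewrite raddfD.
  rewrite -[a]/(val a') -[b]/(val b') !FE tvalD mulf_eq0 negb_or.
  by [].
have [mL mF] := face_gen_mem Lg F0 FD.
have [cf' surj] := chart_localize mL cf.
have mx : tval (exist (fun m => m \in L) _ mL : submonoid L) x != 0
  by rewrite -FE.
have [y yx] := surj x mx.
exists (mem F), (f \o tres (incl (@sub_localize _ L _))), y.
split=> //; first by rewrite /= yx.
move=> l ly; have [a aL [N [aE aF]]] := localize_face Lg F0 FD (valP l).
apply: aF; pose a' : submonoid L := exist _ a aL.
rewrite -[a]/(val a') FE -yx tresE.
have -> : incl (@sub_localize _ L _) a' = l + incl (@sub_localize _ L _) (exist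
  (fun m => m \in L) _ mL) *+ N.
  by apply: subval_inj; rewrite raddfD raddfMn; exact: aE.
have {}mx : tval (incl (@sub_localize _ L _) (exist (fun m =>
  m \in L) _ mL)) y != 0.
  by rewrite -tresE yx.
by rewrite tvalD tvalMn; exact: (mulf_neq0 ly (expf_neq0 N mx)).
Qed.

End ChartComparison.

(** * Invariant affine open sets *)

Lemma addrClosed_of (M : nmodType) (P : {pred M}) : addr_closed P ->
  exists L : addrClosed M, L =i P.
Proof.
move=> hP; pose L : addrClosed M := HB.pack P (GRing.isAddClosed.Build M P hP).
by exists L.
Qed.

Lemma msupp_mulP (k : fieldType) (L : nmodType) (p q : sgalg k L) m :
  m \in msupp (p * q) -> exists a b, [/\ a \in msupp p,
    b \in msupp q & m = a + b].
Proof.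
rewrite -mcoeff_neq0 => pq0; apply: contrapT => nab; move/eqP: pq0; apply.
have -> : p * q = \sum_(a <- msupp p) p@_a *: \sum_(b <- msupp q) q@_b *: tmon
  k (a + b).
  rewrite {1}(sgalgE p) mulr_suml; apply: eq_bigr => a _.
  rewrite -scalerAl {1}(sgalgE q) mulr_sumr; congr (_ *: _).
  by apply: eq_bigr => b _; rewrite -scalerAr tmonD.
rewrite mcoeff_lincomb big1_seq// => a /andP[_ ap].
rewrite mcoeff_lincomb big1_seq ?mulr0// => b /andP[_ bq].
rewrite mcoeff_tmon; case: eqVneq => [abm|]; last by rewrite mulr0.
by case: nab; exists a, b.
Qed.

Section InvariantAffine.
Context (k : closedFieldType) (X : fspace k) (M : zmodType) (e : tspec k M ->
  X).
Hypothesis Msep : forall a b : M, a != b ->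
  exists t : tspec k M, tval a t != tval b t.
Hypothesis oe : open_immersion e.
Hypothesis fgM : finitely_generated_algebra (sgalg k M).
Hypothesis e_dense : forall V : set X, open V -> V !=set0 -> exists t, V (e t).
Context (A : comAlgType k) (f : affine A -> X).
Hypothesis (fgA : finitely_generated_algebra A) (of_ : open_immersion f).
Hypothesis eU : forall t, range f (e t).
Hypothesis translate : forall s : tspec k M, exists alpha : X -> X,
  [/\ morphism alpha, forall t, alpha (e t) = e (tmul s t) &
      forall y, range f (alpha (f y))].

Let f_inj : injective f. Proof. by case: of_. Qed.
Let mf : morphism f. Proof. by case: of_. Qed.

Let torus_lift : exists w : tspec k M -> affine A, forall t, f (w t) = e t.
Proof.
have F t : exists y, f y = e t by have [y _ <-] := eU t; exists y.
by have [u uE] := choice F; exists u.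
Qed.

Let w : tspec k M -> affine A := sval (cid torus_lift).
Let fw t : f (w t) = e t. Proof. exact: (svalP (cid torus_lift)). Qed.
Let mw : morphism w.
Proof. by apply: morphism_lift of_ _ fw; case: oe. Qed.

Let ev_ext a b : (forall t, ev a (w t) = ev b (w t)) -> ev a =1 ev b.
Proof.
move=> ab y; apply/eqP; rewrite -subr_eq0 -evB; apply: contrapT => /negP aby.
have [||t [y' + y'E]] := e_dense (V := f @` [set y | ev (a - b) y != 0]).
- by case: of_ => _ _ + _; apply; exact: open_nonzero.
- by exists (f y), y.
by rewrite -fw in y'E; rewrite (f_inj y'E) /= evB ab subrr eqxx.
Qed.

Let restrict a : exists p : sgalg k M, forall t, ev p t = ev a (w t).
Proof.
have rw := regular_compT mw (@regular_ev _ _ a setT).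
have [p pE] := regular_affine fgM rw.
by exists p => t; rewrite -pE.
Qed.

(** The translation preserves the affine open set, so it lifts to a morphism of Spec A to itself;
    the Nullstellensatz for [A] shows that the pulled-back function again comes from [A]. *)
Let shift s a : exists b, forall t, ev b (w t) = ev a (w (tmul s t)).
Proof.
have [alpha [malpha alphae alphaf]] := translate s.
have [beta betaE] : exists beta : affine A -> affine A,
    forall y, f (beta y) = alpha (f y).
  have F y : exists y', f y' = alpha (f y).
    by have [y' _ <-] := alphaf y; exists y'.
  by have [u uE] := choice F; exists u.
have mbeta : morphism beta.
  exact: morphism_lift of_ (morphism_comp mf malpha) betaE.
have rb := regular_compT mbeta (@regular_ev _ _ a setT).
have [b bE] := regular_affine fgA rb.
exists b => t; rewrite -bE /=; congr (ev a _); apply: f_inj.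
by rewrite betaE !fw alphae.
Qed.

Let restrictable : set (sgalg k M) :=
  [set p | exists a, forall t, ev p t = ev a (w t)].

Let exponents : {pred M} := [pred m | `[< restrictable (tmon k m) >]].

Let exponents_closed : addr_closed exponents.
Proof.
split; first by apply/asboolP; exists 1 => t; rewrite ev_tmon tval0 ev1.
move=> m n /asboolP[a aE] /asboolP[b bE]; apply/asboolP; exists (a * b) => t.
by rewrite tmonD !evM aE bE.
Qed.

Let restrict_supp p m : restrictable p -> m \in msupp p -> m \in exponents.
Proof.
move=> rp mp; apply/asboolP; move: rp mp.
have lin c u v : restrictable u -> restrictable v -> restrictable (c *: u + v).
  move=> [a aE] [b bE]; exists (c *: a + b) => t.
  by rewrite !evD !evZ aE bE.
apply: (torus_isolate Msep (i := idfun) (@inj_id M) lin) => s q [a aE].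
have [b bE] := shift s a; exists b => t; rewrite bE -aE ev_sgmap ev_sgalg.
by apply: eq_bigr => m' _; rewrite tactE.
Qed.

(** [th] expresses restriction to the torus as a homomorphism from [A] to k[t^L], with section
    [lift]. It need not be injective, as [A] may have nilpotents; but elements with the same image
    take the same values ([th_ev]), which is enough to identify the two spectra. *)
Lemma affine_toric_chart : exists (L : addrClosed M) (g : seq M)
    (fL : tspec k (submonoid L) -> X),
  [/\ [set` L] = submonoid_gen [set` g], toric_chart e fL & range fL = range f].
Proof.
have [L LE] := addrClosed_of exponents_closed.
pose i := subval L; have i_inj : injective i := @subval_inj _ L.
have thF a : exists p : sgalg k (submonoid L),
    forall t, ev p (tres i t) = ev a (w t).
  have [p pE] := restrict a.
  have pL m : m \in msupp p -> m \in L.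
    by rewrite LE; apply: restrict_supp; exists a.
  (* The default 0 is never reached: every exponent of [p] lies in [L] by [pL]. *)
  exists (\sum_(m <- msupp p) p@_m *: oapp (@tmon k (submonoid L)) 0 (insub m))
    => t.
  rewrite ev_lincomb -pE ev_sgalg; apply: eq_big_seq => m mp; congr (_ * _).
  by rewrite insubT ?pL//= => mL; rewrite ev_tmon tresE.
have [th thE] := choice thF.
have th_eq a p : (forall t, ev p (tres i t) = ev a (w t)) -> th a = p.
  by move=> pE; apply: (torus_eval_inj Msep i_inj) => t; rewrite thE pE.
have th_ev a b : th a = th b -> ev a =1 ev b.
  by move=> ab; apply: ev_ext => t; rewrite -!thE ab.
have cF (m : submonoid L) : exists a, th a = tmon k m.
  have := valP m; rewrite LE => /asboolP[a aE].
  by exists a; apply: th_eq => t; rewrite -aE !ev_tmon tresE.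
have [c cE] := choice cF.
have thD a b : th (a + b) = th a + th b.
  by apply: th_eq => t; rewrite !evD !thE.
have thZ x a : th (x *: a) = x *: th a.
  by apply: th_eq => t; rewrite !evZ !thE.
have thM a b : th (a * b) = th a * th b.
  by apply: th_eq => t; rewrite !evM !thE.
have th1 : th 1 = 1 by apply: th_eq => t; rewrite !ev1.
have th0 : th 0 = 0 by apply: th_eq => t; rewrite !ev0.
pose lift (p : sgalg k (submonoid L)) : A := \sum_(m <- msupp p) p@_m *: c m.
have th_lift p : th (lift p) = p.
  rewrite [RHS]sgalgE /lift; elim: (enum_fset _) => [|m s IH];
    first by rewrite !big_nil th0.
  by rewrite !big_cons thD thZ IH cE.
have gF (x : tspec k (submonoid L)) : exists y : affine A,
    forall a, ev a y = ev (th a) x.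
  apply: spec_of_fun => [a b|z a||a b].
  - by rewrite thD evD.
  - by rewrite thZ evZ.
  - by rewrite th1 ev1.
  - by rewrite thM evM.
have [g gE] := choice gF.
have chi0 y : ev (c 0) y = 1.
  by rewrite -(ev1 y); apply: th_ev; rewrite cE th1 tmon0.
have chiD y m n : ev (c (m + n)) y = ev (c m) y * ev (c n) y.
  by rewrite -evM; apply: th_ev; rewrite thM !cE tmonD.
pose g' (y : affine A) : tspec k (submonoid L) := char_point (chi0 y) (chiD y).
have g'E y m : tval m (g' y) = ev (c m) y by exact: ev_char_point.
have ev_g' y p : ev (lift p) y = ev p (g' y).
  by rewrite ev_lincomb ev_sgalg; apply: eq_bigr => m _; rewrite g'E.
have mg : morphism g by apply: affine_morphism => a; exists (th a) => x;
  rewrite gE.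
have mg' : morphism g'.
  by apply: affine_morphism => p; exists (lift p) => y; rewrite ev_g'.
have gK : cancel g g'.
  by move=> x; apply: tspec_ext => m; rewrite g'E gE cE.
have g'K : cancel g' g.
  move=> y; apply: spec_ext => a; rewrite gE -ev_g'.
  by apply: th_ev; rewrite th_lift.
have og : open_immersion g by apply: isomorphism_open_immersion; exists g'.
have [s sA] := fgA.
(* Each t^m with m in [L] is the image of some element of [A], hence a polynomial in the images of
   the generators [s]; its exponent is therefore a sum of exponents occurring in those images. *)
pose gens : seq M := flatten [seq [seq val m | m <- enum_fset (msupp (th a))] |
  a <- s].
exists L, gens, (f \o g); split.
- apply/seteqP; split=> [m mL|]; last first.
    apply: smallest_sub => [|m /= /flatten_mapP[a _ /mapP[n _ ->]]];
      last exact: valP.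
    by split=> [|a b]; rewrite ?inE/= ?rpred0//; exact: rpredD.
  have [N0 ND] : addr_closed (mem (submonoid_gen [set` gens])).
    split; first by rewrite inE => B [[B0 _] _]; move: B0; rewrite inE.
    move=> a b; rewrite !inE => aN bN B BP.
    have := BP => -[[_ BD] _]; have := BD a b; rewrite !inE; apply;
      [exact: aN|exact: bN].
  (* The elements whose image has all its exponents in the monoid generated by [gens] form a
     subalgebra containing [s], thus all of [A]. *)
  have suppN a : forall n, n \in msupp (th a) ->
    val n \in submonoid_gen [set` gens].
    have : [set: A] a by [].
    rewrite -sA; apply: (_ : smallest _ _ `<=` [set a | forall n,
      n \in msupp (th a) -> val n \in submonoid_gen [set` gens]]).
    apply: smallest_sub => [|b bs n nb]; last first.
      rewrite inE => B [_]; apply; apply/flatten_mapP; exists b => //.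
      exact: map_f.
    split.
    - rewrite inE /= => n; rewrite th1 -mcoeff_neq0 -tmon0 mcoeff_tmon.
      case: (eqVneq (0 : submonoid L) n) => [<- _|_]; last by rewrite eqxx.
      exact: N0.
    - move=> x u v; rewrite !inE /= => uN vN n.
      rewrite thD thZ -mcoeff_neq0 mcoeffD mcoeffZ.
      have [/uN//|nu] := boolP (n \in msupp (th u)).
      by rewrite (mcoeff_outdom nu) mulr0 add0r mcoeff_neq0; exact: vN.
    - move=> u v; rewrite !inE /= => uN vN n; rewrite thM.
      by move=> /msupp_mulP[a' [b' [/uN a'N /vN b'N ->]]]; exact: ND.
  pose m' : submonoid L := exist _ m mL.
  have := suppN (c m') m'; rewrite cE -mcoeff_neq0 mcoeff_tmon eqxx oner_neq0.
  by rewrite inE; apply.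
- split; first exact: open_immersion_comp.
  move=> t; rewrite /= -fw; congr f; apply: spec_ext => a.
  by rewrite gE thE.
apply/seteqP; split=> [_ [x _ <-]|_ [y _ <-]]; first by exists (g x).
by exists (g' y) => //=; rewrite g'K.
Qed.

End InvariantAffine.

Lemma sgalg_finitely_generated (k : fieldType) (L : nmodType) (g : seq L) :
  (forall m, submonoid_gen [set` g] m) ->
    finitely_generated_algebra (sgalg k L).
Proof.
move=> gL; exists (map (@tmon k L) g); apply/seteqP; split=> // p _ B [Bc gB].
have [B1 Blin BM] := Bc.
have Bt m : B (tmon k m).
  apply: (gL m [set m | B (tmon k m)]); split=> [|m' mg]; last first.
    by apply: gB; exact: map_f.
  split; first by rewrite inE /= tmon0; move: B1; rewrite inE.
  move=> a b; rewrite !inE /= => Ba Bb; rewrite tmonD.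
  by have := BM (tmon k a) (tmon k b); rewrite !inE; apply.
rewrite (sgalgE p); elim: (enum_fset _) => [|m s IH].
  rewrite big_nil; have := Blin (-1) (tmon k 0) (tmon k 0).
  by rewrite scaleN1r addNr !inE; apply; exact: Bt.
rewrite big_cons; have := Blin p@_m (tmon k m); rewrite inE => /(_ _ (Bt m)).
by move=> /(_ (\sum_(j <- s) p@_j *: tmon k j)); rewrite !inE; exact.
Qed.

Lemma lattice_generators (n : nat) : exists g : seq 'rV[int]_n,
  forall m, submonoid_gen [set` g] m.
Proof.
pose d i : 'rV[int]_n := delta_mx 0 i.
exists ([seq d i | i <- enum 'I_n] ++ [seq - d i | i <- enum 'I_n]).
move=> m B [[B0 BD] gB]; rewrite inE in B0.
have BMn x N : B x -> B (x *+ N).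
  move=> Bx; elim: N => [|N IH]; first by rewrite mulr0n.
  by rewrite mulrS; have := BD x (x *+ N); rewrite !inE; apply.
have Bd i : B (d i).
  by apply: gB; rewrite /= mem_cat; apply/orP; left; rewrite map_f ?mem_enum.
have BNd i : B (- d i).
  apply: gB; rewrite /= mem_cat; apply/orP; right.
  by apply/mapP; exists i; rewrite ?mem_enum.
rewrite (row_sum_delta m); elim/big_rec: _ => // i x _ Bx.
have := BD (m 0 i *: d i) x; rewrite !inE; apply=> //.
have ZE N : Posz N *: d i = d i *+ N by rewrite -scaler_nat natz.
case: (m 0 i) => N; first by rewrite ZE; exact: BMn.
by rewrite NegzE scaleNr ZE -mulNrn; exact: BMn.
Qed.

Lemma lattice_sgalg_fg (k : fieldType) (n : nat) :
  finitely_generated_algebra (sgalg k 'rV[int]_n).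
Proof. by have [g gP] := lattice_generators n;
  exact: sgalg_finitely_generated gP. Qed.

(** * Intersection of charts *)

Section LocalizeGenerators.
Context (M : zmodType).
Implicit Types L : addrClosed M.

Lemma generated_monoid (g : seq M) : exists L : addrClosed M,
  [set` L] = submonoid_gen [set` g].
Proof.
have cl : addr_closed (mem (submonoid_gen [set` g])).
  split; first by rewrite inE => B [[B0 _] _]; move: B0; rewrite inE.
  move=> a b; rewrite !inE => aN bN B BP.
  by have := BP => -[[_ BD] _]; have := BD a b; rewrite !inE; apply;
    [exact: aN|exact: bN].
have [L LE] := addrClosed_of cl; exists L; apply/seteqP; split=> m /=.
  by rewrite LE inE.
by move=> mg; rewrite LE inE.
Qed.

Lemma localize_generators L (g : seq M) m : m \in L ->
  [set` L] = submonoid_gen [set` g] ->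
  [set` localize L m] = submonoid_gen [set` (- m :: g)].
Proof.
move=> mL Lg; have [N NE] := generated_monoid (- m :: g); rewrite -NE.
have gN a : a \in - m :: g -> a \in N by move=> /(gen_mem NE).
apply/seteqP; split=> a /=.
  move=> /localizeP[n aL]; rewrite -[a](addrK (m *+ n)) -mulNrn rpredD
    ?rpredMn//.
    move: (a + m *+ n) aL; apply: (gen_ind Lg); first exact: rpred0.
      by move=> b c _ _; exact: rpredD.
    by move=> b bg; apply: gN; rewrite inE bg orbT.
  by apply: gN; rewrite inE eqxx.
move: a; apply: (gen_ind NE); first exact: rpred0.
  by move=> b c _ _; exact: rpredD.
move=> b; rewrite inE => /orP[/eqP->|bg]; first exact: localizeN.
exact/sub_localize/(gen_mem Lg).
Qed.

(** The indicator function of the units of [L]. It is multiplicative because a sum in a commutative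
    monoid is a unit only when both terms are. *)
Lemma special_point (k : fieldType) L : exists x : tspec k (submonoid L),
  forall l, tval l x != 0 -> - val l \in L.
Proof.
pose U (l : submonoid L) := - val l \in L.
have chi0 : (U 0)%:R = 1 :> k by rewrite /U (raddf0 (subval L)) oppr0 rpred0.
have chiD a b : (U (a + b))%:R = (U a)%:R * (U b)%:R :> k.
  rewrite -natrM mulnb; congr (_%:R); congr (nat_of_bool _);
    rewrite /U (raddfD (subval L)).
  apply/idP/andP => [abL|[aL bL]]; last by rewrite opprD rpredD.
  have NE c d : - c = - (c + d) + d :> M by rewrite opprD addrNK.
  split; first by rewrite (NE _ (val b)) rpredD//; exact: valP.
  by rewrite (NE _ (val a)) addrC rpredD//; [exact: valP|rewrite addrC].
exists (@char_point k (submonoid L) (fun l => (U l)%:R) chi0 chiD) => l.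
by rewrite /tval ev_char_point /U; case: (- val l \in L); rewrite ?eqxx.
Qed.

End LocalizeGenerators.

Section ChartIntersection.
Context (k : closedFieldType) (X : fspace k) (M : zmodType) (e : tspec k M ->
  X).
Hypothesis Msep : forall a b : M, a != b ->
  exists t : tspec k M, tval a t != tval b t.
Hypothesis sepX : separated X.
Implicit Types L : addrClosed M.

Definition chart_monoid L : Prop := (exists f, toric_chart e (L:=L) f) /\
  exists g : seq M, [set` L] = submonoid_gen [set` g].

Lemma chart_monoid_localize L m : m \in L -> chart_monoid L ->
  chart_monoid (localize L m).
Proof.
move=> mL [[f cf] [g Lg]]; split; last first.
  by exists (- m :: g); exact: localize_generators.
by have [cf' _] := chart_localize mL cf; eexists; exact: cf'.
Qed.

Lemma chart_monoid_weight L L' (v : {additive M -> int}) :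
  chart_monoid L -> chart_monoid L' ->
  (forall l, l \in L -> 0 <= v l) -> (forall l, l \in L' -> 0 <= v l) ->
  (forall l, l \in L -> v l = 0 -> - l \in L) ->
  (forall l, l \in L' -> v l = 0 -> - l \in L') -> L =i L'.
Proof.
move=> [[f cf] _] [[f' cf'] _] vL vL' vL0 vL0' l; apply/idP/idP.
  exact: (chart_limit_sub Msep sepX cf' cf vL' vL vL0').
exact: (chart_limit_sub Msep sepX cf cf' vL vL' vL0).
Qed.

(** The zeros of [v] in [L] form a face; once it is inverted, [v] vanishes only at units, which is
    the form of relative interiority needed to compare limits. *)
Lemma face_localize_weight L (v : {additive M -> int}) : chart_monoid L ->
  (forall l, l \in L -> 0 <= v l) -> exists m, [/\ m \in L, v m = 0,
    forall l, l \in localize L m -> 0 <= v l &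
    forall l, l \in localize L m -> v l = 0 -> - l \in localize L m].
Proof.
move=> [_ [g Lg]] vL; pose F : {pred M} := [pred a | v a == 0].
have F0 : 0 \in F by rewrite inE raddf0.
have FD a b : a \in L -> b \in L -> (a + b \in F) = (a \in F) && (b \in F).
  by move=> aL bL; rewrite !inE raddfD paddr_eq0 ?vL.
have [mL mF] := face_gen_mem Lg F0 FD.
have vm : v (\sum_(a <- g | a \in F) a) = 0 by apply/eqP; rewrite inE in mF.
have vE l a N : a = l + (\sum_(a <- g | a \in F) a) *+ N -> v a = v l.
  by move=> ->; rewrite raddfD raddfMn/= vm mul0rn addr0.
exists (\sum_(a <- g | a \in F) a); split=> // l /(localize_face Lg F0 FD)
    [a aL [N [/vE vaE aF]]].
  by rewrite -vaE vL.
by move=> vl0; apply: aF; rewrite inE vaE vl0.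
Qed.

(** Localizing [L] at the characters that do not vanish at [x] yields a second chart for which the
    common point is special. Two such charts contain each other's monoids. *)
Lemma chart_monoid_at_point L f x : toric_chart e (L:=L) f -> forall g : seq M,
  [set` L] = submonoid_gen [set` g] ->
  forall L' f' x', toric_chart e (L:=L') f' -> f x = f' x' ->
  (forall l, tval l x' != 0 -> - val l \in L') ->
  exists b : pred M, \sum_(a <- g | b a) a \in L /\
    L' =i localize L (\sum_(a <- g | b a) a).
Proof.
move=> cf g Lg L' f' x' cf' fx xL'.
have [b [f1 [y [c1 mL f1y yL]]]] := chart_at_point x cf Lg.
exists b; split=> // l; apply/idP/idP.
  by apply: (chart_sub Msep c1 cf' (x := y) (x' := x')) => //; rewrite f1y.
by apply: (chart_sub Msep cf' c1 (x := x') (x' := y)) => //; rewrite f1y.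
Qed.

(** The chart obtained from [L] by localizing at the common point has that point as its special
    point, so it is a localization of [L'] too. *)
Lemma chart_common_point L L' f f' x x' : toric_chart e (L:=L) f ->
  toric_chart e (L:=L') f' -> chart_monoid L -> chart_monoid L' ->
  f x = f' x' -> exists L'' f'' y, [/\ toric_chart e (L:=L'') f'',
    chart_monoid L'',
    {subset L <= L''}, {subset L' <= L''} & f'' y = f x].
Proof.
move=> cf cf' cL [_ [g' Lg']] fx; have [_ [g Lg]] := cL.
have [b [f1 [y [c1 mL f1y yL]]]] := chart_at_point x cf Lg.
have [b' [_ LE]] := chart_monoid_at_point cf' Lg' c1 (esym (etrans f1y fx)) yL.
exists (localize L (\sum_(a <- g | b a) a) : addrClosed M), f1, y; split=> //.
- exact: chart_monoid_localize.
- exact: sub_localize.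
by move=> l lL'; rewrite LE; exact: sub_localize.
Qed.

End ChartIntersection.

(** * Weyl's theorem with integral data *)

Section Weyl.
Context (n : nat).
Implicit Types (G H : seq 'rV[int]_n) (g h m : 'rV[int]_n).

Definition int_row (F : pzRingType) (m : 'rV[int]_n) : 'rV[F]_n :=
  map_mx intr m.

Definition row_dot (F : pzRingType) (h : 'rV[int]_n) (x : 'rV[F]_n) : F :=
  \sum_i (h 0 i)%:~R * x 0 i.

(** The recursion peels off one generator at a time, as Fourier-Motzkin elimination does. The field
    is a parameter so that the same integral inequalities serve over [rat], where denominators can
    be cleared, and over the reals. *)
Fixpoint in_cone (F : realFieldType) (G : seq 'rV[int]_n) (x : 'rV[F]_n) : Prop
  :=
  if G is g :: G' then exists2 t : F, 0 <= t & in_cone G' (x - t *: int_row F g)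
  else x = 0.

Lemma row_dotD (F : pzRingType) h (x y : 'rV[F]_n) :
  row_dot h (x + y) = row_dot h x + row_dot h y.
Proof. by rewrite -big_split/=; apply: eq_bigr => i _; rewrite mxE mulrDr. Qed.

Lemma row_dotZ (F : comPzRingType) h c (x : 'rV[F]_n) :
  row_dot h (c *: x) = c * row_dot h x.
Proof. by rewrite mulr_sumr; apply: eq_bigr => i _; rewrite mxE mulrCA. Qed.

Lemma row_dotB (F : comPzRingType) h (x y : 'rV[F]_n) :
  row_dot h (x - y) = row_dot h x - row_dot h y.
Proof. by rewrite row_dotD -scaleN1r row_dotZ mulN1r. Qed.

Lemma row_dot_int (F : pzRingType) h g :
  row_dot h (int_row F g) = (row_dot h g)%:~R.
Proof.
rewrite /row_dot rmorph_sum; apply: eq_bigr => i _ /=.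
by rewrite mxE intrM intz.
Qed.

Lemma row_dot_comb (F : comPzRingType) (a b : int) p q (x : 'rV[F]_n) :
  row_dot (a *: p - b *: q) x = a%:~R * row_dot p x - b%:~R * row_dot q x.
Proof.
rewrite /row_dot !mulr_sumr -sumrB; apply: eq_bigr => i _.
by rewrite !mxE intrB !intrM mulrBl !mulrA.
Qed.

(* Fourier-Motzkin: cone (g :: G) is the set of x such that x - t g is in
   cone G for some t >= 0; t is eliminated from the inequalities. *)
Lemma weyl G : exists H, forall (F : realFieldType) (x : 'rV[F]_n),
  in_cone G x <-> forall h, h \in H -> 0 <= row_dot h x.
Proof.
elim: G => [|g G [H HP]].
  pose d i : 'rV[int]_n := delta_mx 0 i.
  exists ([seq d i | i <- enum 'I_n] ++ [seq - d i | i <- enum 'I_n]) => F x.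
  have dE i : row_dot (d i) x = x 0 i.
    rewrite /row_dot (bigD1 i)//= mxE !eqxx mul1r big1 ?addr0// => l li.
    by rewrite mxE (negPf li) andbF mul0r.
  have dNE i : row_dot (- d i) x = - x 0 i.
    by rewrite -dE /row_dot -sumrN; apply: eq_bigr => l _;
      rewrite mxE mulrNz mulNr.
  split=> [-> h _|xP]; first by rewrite /row_dot big1// => i _;
    rewrite mxE mulr0.
  apply/rowP => i; rewrite mxE; apply/eqP; rewrite eq_le -oppr_ge0 -dNE -dE.
  by apply/andP; split; apply: xP; rewrite mem_cat; apply/orP; [right|left];
     apply/mapP; exists i; rewrite ?mem_enum.
pose a h : int := row_dot h g.
(* Inequalities nonnegative on [g] survive. A positive [p] and a negative [q] are combined with the
   positive weights [- a q] and [a p], so that the combination vanishes on [g]. *)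
exists ([seq h <- H | 0 <= a h] ++
  [seq a p *: q - a q *: p | p <- [seq h <- H | 0 < a h],
    q <- [seq h <- H | a h < 0]]).
move=> F x.
have stepE t : in_cone G (x - t *: int_row F g) <->
    forall h, h \in H -> t * (a h)%:~R <= row_dot h x.
  split=> [/HP|] xP.
    by move=> h /xP; rewrite row_dotB row_dotZ row_dot_int subr_ge0.
  by apply/HP => h /xP; rewrite row_dotB row_dotZ row_dot_int subr_ge0.
split.
  move=> [t t0 /stepE tP] h; rewrite mem_cat => /orP[|].
    rewrite mem_filter => /andP[ah /tP]; apply: le_trans.
    by rewrite mulr_ge0// ler0z.
  move=> /allpairsP[[p q] [/=]]; rewrite !mem_filter =>
    /andP[ap /tP pP] /andP[aq /tP qP] ->.
  rewrite row_dot_comb subr_ge0.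
  apply: (@le_trans _ _ ((a q)%:~R * (t * (a p)%:~R))).
    by rewrite ler_wnM2l// lerz0 ltW.
  rewrite [leLHS]mulrA [leLHS]mulrC; apply: ler_wpM2l;
    first by rewrite ler0z ltW.
  by rewrite mulrC.
move=> xP.
pose lo h := row_dot h x / (a h)%:~R.
(* The inequalities negative on [g] bound the coefficient of [g] from below; [t] is the least
   nonnegative value meeting these bounds, and the combined inequalities ensure that it meets the
   upper bounds. *)
pose t := \big[Num.max/0]_(h <- H | a h < 0) lo h.
have t0 : 0 <= t by exact: bigmax_ge_id.
exists t => //; apply/stepE => h hH.
have [ah|ah|ah] := ltgtP (a h) 0.
- rewrite -ler_ndivrMr ?ltrz0//.
  exact: (le_bigmax_seq 0 h (fun h => a h < 0) lo hH ah).
- rewrite -ler_pdivlMr ?ltr0z//; rewrite /t big_seq_cond; apply: bigmax_le.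
    apply: divr_ge0; last by rewrite ler0z ltW.
    by apply: xP; rewrite mem_cat mem_filter (ltW ah) hH.
  move=> q /andP[qH aq]; rewrite /lo ler_ndivrMr ?ltrz0// mulrAC ler_pdivrMr
    ?ltr0z//.
  rewrite -subr_ge0 mulrC [_ * (a q)%:~R]mulrC -row_dot_comb; apply: xP.
  rewrite mem_cat; apply/orP; right; apply/allpairsP; exists (h, q).
  by rewrite !mem_filter ah aq.
rewrite ah mulr0; apply: xP; rewrite mem_cat mem_filter ah lexx.
by rewrite hH.
Qed.

Lemma in_cone0 (F : realFieldType) G : in_cone G (0 : 'rV[F]_n).
Proof. by elim: G => //= g G IH; exists 0; rewrite ?scale0r ?subr0. Qed.

Lemma in_cone_gen (F : realFieldType) G g : g \in G -> in_cone G (int_row F g).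
Proof.
elim: G => //= g' G IH; rewrite inE => /orP[/eqP->|/IH gG].
  by exists 1; rewrite ?scale1r ?subrr//; exact: in_cone0.
by exists 0; rewrite ?scale0r ?subr0.
Qed.

Lemma in_cone_rat G (x : 'rV[rat]_n) : in_cone G x ->
  exists N m, [/\ (0 < N)%N, submonoid_gen [set` G] m & x *+ N = int_row _ m].
Proof.
move=> xG.
(* Membership in the generated monoid is restated with the submonoid [B] quantified, so that the
   induction can enlarge the list of generators. *)
suff : exists N m, [/\ (0 < N)%N, (forall B : set 'rV[int]_n,
  addr_closed (mem B) ->
    [set` G] `<=` B -> B m) & x *+ N = int_row _ m].
  move=> [N [m [N0 mG xN]]]; exists N, m; split=> // B [Bc GB]; exact: mG.
elim: G x xG => [x ->|g G IH x /= [t t0 /IH[N [m [N0 mG xN]]]]].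
  exists 1%N, 0; split=> //; last by rewrite mul0rn /int_row raddf0.
  by move=> B [+ _] _; rewrite inE.
have [a [b [b0 tE]]] : exists a b : nat, (0 < b)%N /\ t = a%:R / b%:R.
  exists (absz (numq t)), (absz (denq t)); rewrite absz_gt0 denq_neq0;
    split=> //.
  by rewrite !natr_absz !ger0_norm ?numq_ge0 ?denq_ge0// divq_num_den.
exists (N * b)%N, (m *+ b + g *+ (N * a)); split.
- by rewrite muln_gt0 N0.
- move=> B Bc GB; have [B0 BD] := Bc.
  have BM c l : B c -> B (c *+ l).
    move=> Bcc; elim: l => [|l IHl]; first by move: B0; rewrite mulr0n inE.
    by rewrite mulrS; have := BD c (c *+ l); rewrite !inE; apply.
  have := BD (m *+ b) (g *+ (N * a)); rewrite !inE; apply; apply: BM.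
    by apply: mG => // h hG; apply: GB; rewrite /= inE; apply/orP; right.
  by apply: GB; rewrite /= inE eqxx.
have -> : x = (x - t *: int_row _ g) + t *: int_row _ g by rewrite subrK.
rewrite mulrnDl mulrnA xN /int_row raddfD !raddfMn; congr (_ + _).
rewrite -!scaler_nat scalerA; congr (_ *: _); rewrite tE !natrM.
by field; rewrite pnatr_eq0 -lt0n.
Qed.

End Weyl.

(** * Dual cones of semigroups *)

Section DualCone.
Context (R : realType) (n : nat).
Notation M := 'rV[int]_n.
Implicit Types (L : addrClosed M) (G : seq M) (v : 'cV[R]_n).

Definition dual_of (L : {pred M}) : set 'cV[R]_n :=
  [set v | forall m, m \in L -> 0 <= pairing (toR R m) v].

Lemma pairing_trmx (x : 'rV[R]_n) (h : M) : pairing x (toR R h^T) = row_dot h x.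
Proof. by rewrite /pairing mxE; apply: eq_bigr => i _; rewrite !mxE mulrC. Qed.

Lemma pairing_row_dot (m : M) v : pairing (toR R m) v = row_dot m v^T.
Proof. by rewrite /pairing mxE; apply: eq_bigr => i _; rewrite !mxE. Qed.

Lemma pairingDl (x y : 'rV[R]_n) v : pairing (x + y) v = pairing x v + pairing
  y v.
Proof. by rewrite /pairing mulmxDl mxE. Qed.

Lemma pairing0l v : pairing (0 : 'rV[R]_n) v = 0.
Proof. by rewrite /pairing mul0mx mxE. Qed.

Lemma pairing_toRD (a b : M) v :
  pairing (toR R (a + b)) v = pairing (toR R a) v + pairing (toR R b) v.
Proof. by rewrite -pairingDl /toR raddfD. Qed.

Lemma pairing_toRMn (a : M) N v :
  pairing (toR R (a *+ N)) v = pairing (toR R a) v *+ N.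
Proof.
elim: N => [|N IH]; first by rewrite !mulr0n /toR raddf0 pairing0l.
by rewrite !mulrS pairing_toRD IH.
Qed.

Lemma pairing_comb (I : finType) (c : I -> R) (w : I -> 'rV[R]_n) v :
  pairing (\sum_i c i *: w i) v = \sum_i c i * pairing (w i) v.
Proof.
rewrite /pairing mulmx_suml summxE; apply: eq_bigr => i _.
by rewrite -scalemxAl mxE.
Qed.

Lemma pairing_combr (I : finType) (c : I -> R) (w : I -> 'cV[R]_n) x :
  pairing x (\sum_i c i *: w i) = \sum_i c i * pairing x (w i).
Proof.
rewrite /pairing mulmx_sumr summxE; apply: eq_bigr => i _.
by rewrite -scalemxAr mxE.
Qed.

Lemma cone0 (V : lmodType R) (S : set V) : cone S 0.
Proof.
exists 0%N, (fun=> 0), (fun=> 0); split; first by case.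
by rewrite big_ord0.
Qed.

Lemma cone_addr (V : lmodType R) (S : set V) (x w : V) t : cone S x ->
  0 <= t -> S w ->
  cone S (x + t *: w).
Proof.
move=> [m [c [u [cu ->]]]] t0 Sw.
exists m.+1, (fun i => oapp c t (unlift ord_max i)), (fun i =>
  oapp u w (unlift ord_max i)).
split.
  by move=> i; case: unliftP => [j _|_] /=; [exact: cu|].
rewrite big_ord_recr/= unlift_none/=; congr (_ + _); apply: eq_bigr => i _.
have -> : widen_ord (leqnSn m) i = lift ord_max i.
  by apply: val_inj; rewrite /= /bump leqNgt ltn_ord.
by rewrite liftK.
Qed.

Lemma in_cone_cone (V : lmodType R) (phi : {linear 'rV[R]_n ->
  V}) G (x : 'rV[R]_n)
  (S : set V) : (forall g, g \in G -> S (phi (int_row R g))) -> in_cone G x ->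
  cone S (phi x).
Proof.
elim: G x => [x _ ->|g G IH x GS /= [t t0 /IH xG]]; first by rewrite raddf0;
  exact: cone0.
have -> : phi x = phi (x - t *: int_row R g) + t *: phi (int_row R g).
  by rewrite -linearZ -linearD subrK.
apply: cone_addr => //.
  by apply: xG => h hG; apply: GS; rewrite inE hG orbT.
by apply: GS; rewrite inE eqxx.
Qed.

Section Generated.
Context (L : addrClosed M) (G : seq M).
Hypothesis LG : [set` L] = submonoid_gen [set` G].

Lemma dual_of_gen v : (forall g, g \in G -> 0 <= pairing (toR R g) v) ->
  dual_of L v.
Proof.
move=> Gv m; move: m; apply: (gen_ind LG) => [|a b _ _ a0 b0|//].
  by rewrite /toR raddf0 pairing0l.
by rewrite pairing_toRD addr_ge0.
Qed.

(** [H] holds both the inequalities of the cone of [L] and, transposed, generators of the dual cone.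
    As [L] need not be saturated, an integral solution of the inequalities has only a positive
    multiple in [L]. The last clause is Farkas' lemma, obtained from a second use of [weyl], on
    [H]. *)
Lemma dual_of_inequalities : exists H : seq M,
  [/\ forall h, h \in H -> dual_of L (toR R h^T),
      forall x, (forall h, h \in H -> 0 <= row_dot h x) ->
        cone [set toR R m | m in [set` L]] x,
      forall m, (forall h, h \in H -> 0 <= row_dot h m) ->
        exists2 N, (0 < N)%N & m *+ N \in L &
      forall v, dual_of L v -> cone [set toR R w | w in [set` map trmx H]] v].
Proof.
have [H HP] := weyl G.
have coneP x : (forall h, h \in H -> 0 <= row_dot h x) ->
    cone [set toR R m | m in [set` L]] x.
  move=> /HP; apply: (in_cone_cone (phi := idfun)) => g gG /=.
  by exists g => //=; exact: gen_mem gG.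
have dualP h : h \in H -> dual_of L (toR R h^T).
  move=> hH; apply: dual_of_gen => g gG; rewrite pairing_trmx.
  by have /HP := in_cone_gen R gG; apply.
exists H; split=> //.
  move=> m mH; have [|N [m' [N0 m'G mN]]] := @in_cone_rat n G (int_row rat m).
    by apply/HP => h /mH; rewrite row_dot_int ler0z.
  exists N => //; have -> : m *+ N = m'.
    apply/rowP => i; apply: (@intr_inj rat).
    by have /rowP/(_ i) := mN; rewrite -raddfMn !mxE.
  by have : [set` L] m' by rewrite LG.
move=> v vL; have [K KP] := weyl H.
rewrite -[v]trmxK.
apply: (in_cone_cone (phi := trmx) (G := H)).
  move=> h hH; exists h^T; first by rewrite /= map_f.
  by apply/matrixP => i j; rewrite !mxE.
(* An inequality [k'] of the cone of [H] is nonnegative on [H], so it lies in the cone of [L], on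
   which [v] is nonnegative. *)
apply/KP => k' kK; rewrite -pairing_row_dot.
have : cone [set toR R m | m in [set` L]] (toR R k').
  apply: coneP => h hH; rewrite row_dot_int ler0z.
  have /KP/(_ _ kK) := in_cone_gen R hH; rewrite row_dot_int ler0z.
  by congr (0 <= _); apply: eq_bigr => i _; rewrite !intz mulrC.
move=> [m [c [w [cw ->]]]]; rewrite pairing_comb; apply: sumr_ge0 => i _.
by have [ci [l lL <-]] := cw i; rewrite mulr_ge0// vL.
Qed.

Lemma dual_of_rational_polyhedral : rational_polyhedral (dual_of L).
Proof.
have [H [dualP _ _ coneP]] := dual_of_inequalities.
exists (map trmx H); apply/seteqP; split=> [v /coneP//|v].
move=> [m [c [w [cw ->]]]] l lL; rewrite pairing_combr; apply: sumr_ge0 => i _.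
have [ci [u uH <-]] := cw i; rewrite mulr_ge0//.
by move: uH => /mapP[h hH ->]; exact: dualP.
Qed.

Lemma cone_bidual :
  cone [set toR R m | m in [set` L]] = dual_cone (dual_of L).
Proof.
have [H [dualP coneP _ _]] := dual_of_inequalities.
apply/seteqP; split=> [_ [m [c [w [cw ->]]]] v vL|x xL].
  rewrite pairing_comb; apply: sumr_ge0 => i _.
  by have [ci [l lL <-]] := cw i; rewrite mulr_ge0// vL.
by apply: coneP => h /dualP/xL; rewrite pairing_trmx.
Qed.

(** Orthogonality makes [- m] satisfy the inequalities of the cone, so some N(-m) with N > 0 is in
    [L]; then - m = N(-m) + (N-1)m. *)
Lemma dual_of_orthogonalN m : m \in L ->
  (forall v, dual_of L v -> pairing (toR R m) v = 0) -> - m \in L.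
Proof.
move=> mL m0; have [H [dualP _ satP _]] := dual_of_inequalities.
have [h hH|N N0 NmL] := satP (- m).
  have := m0 _ (dualP h hH); rewrite pairing_trmx row_dot_int => /eqP.
  rewrite intr_eq0 => /eqP hm.
  by rewrite -[- m]add0r row_dotB hm subr0 /row_dot big1// => i _;
    rewrite mxE mulr0.
rewrite -(prednK N0) mulrS in NmL.
have -> : - m = - m + - m *+ N.-1 + m *+ N.-1
  by rewrite -addrA mulNrn addNr addr0.
by rewrite rpredD// rpredMn.
Qed.

(** The sum of generators of the dual cone is in its relative interior: if a sum of nonnegative
    pairings vanishes, each of them does. *)
Lemma dual_of_interior : exists v : 'cV[int]_n,
  forall m, (forall u, dual_of L u -> 0 <= pairing (toR R m) u) ->
    0 <= pair_with v m /\
    (pair_with v m = 0 -> forall u, dual_of L u -> pairing (toR R m) u = 0).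
Proof.
have [H [dualP _ _ coneP]] := dual_of_inequalities.
exists (\sum_(h <- H) h^T) => m m_ge0.
have -> : pair_with (\sum_(h <- H) h^T) m = \sum_(h <- H) row_dot h m.
  rewrite /pair_with mulmx_sumr summxE; apply: eq_bigr => h _.
  rewrite mxE; apply: eq_bigr => i _; by rewrite !mxE mulrC intz.
have dot_ge0 h : h \in H -> 0 <= row_dot h m.
  by move=> /dualP/m_ge0; rewrite pairing_trmx row_dot_int ler0z.
rewrite big_seq; split; first exact: sumr_ge0.
move=> /eqP; rewrite psumr_eq0// => /allP m0 u /coneP[p [c [w [cw ->]]]].
rewrite pairing_combr big1// => i _; have [ci [_ /mapP[h hH ->] <-]] := cw i.
rewrite pairing_trmx row_dot_int; have := m0 h hH; rewrite hH => /eqP ->.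
by rewrite mulr0.
Qed.

Lemma dual_of_strictly_convex :
  (forall m : M, exists l l', [/\ l \in L, l' \in L & l + m = l']) ->
  strictly_convex (dual_of L).
Proof.
move=> gL v vL vNL.
have L0 l : l \in L -> pairing (toR R l) v = 0.
  move=> lL; apply/eqP; rewrite eq_le vL// andbT -oppr_ge0.
  by have := vNL l lL; rewrite /pairing mulmxN mxE.
apply/colP => i; rewrite mxE.
have [l [l' [lL l'L ll']]] := gL (delta_mx 0 i).
have := pairing_toRD l (delta_mx 0 i) v;
  rewrite ll' (L0 l' l'L) (L0 l lL) add0r => /esym.
rewrite pairing_row_dot /row_dot (bigD1 i)//= big1 ?addr0.
  by rewrite !mxE !eqxx mul1r.
by move=> l0 li; rewrite mxE (negPf li) andbF mul0r.
Qed.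

(** The supporting functional is a nonnegative real combination of elements of [L]. All terms being
    nonnegative on the dual cone, its zeros there depend only on which coefficients are nonzero;
    replacing these by 1 gives an element of [L]. *)
Lemma face_dual_of t : face t (dual_of L) -> exists2 m, m \in L &
  t = dual_of L `&` [set v | pairing (toR R m) v = 0].
Proof.
move=> [x]; rewrite -cone_bidual => -[p [c [w [cw ->]]]] ->.
have uF i : exists l, l \in L /\ w i = toR R l.
  by have [_ [l lL <-]] := cw i; exists l.
have [u uP] := choice uF.
exists (\sum_(i | c i != 0) u i).
  by apply: rpred_sum => i _; case: (uP i).
have sumE v : pairing (toR R (\sum_(i | c i != 0) u i)) v =
    \sum_(i | c i != 0) pairing (toR R (u i)) v.
  elim/big_rec2: _ => [|i a b _ IH]; first by rewrite /toR raddf0 pairing0l.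
  by rewrite pairing_toRD IH.
have wE i v : pairing (w i) v = pairing (toR R (u i)) v by rewrite (uP i).2.
apply/seteqP; split=> v [vL] /=; rewrite pairing_comb sumE => v0; split=> //=.
  apply: big1 => i ci; apply/eqP.
  have /eqP := v0; rewrite psumr_eq0.
    move=> /allP/(_ i (mem_index_enum _)); rewrite /= mulf_eq0 (negPf ci) wE.
    by [].
  by move=> l _; rewrite wE mulr_ge0 ?vL//; [case: (cw l)|case: (uP l)].
apply: big1 => i _; have [->|ci] := eqVneq (c i) 0; first by rewrite mul0r.
have /eqP := v0; rewrite psumr_eq0.
  by move=> /allP/(_ i (mem_index_enum _)); rewrite ci/= wE => /eqP ->;
    rewrite mulr0.
by move=> l _; apply: vL; case: (uP l).
Qed.

End Generated.

Lemma dual_of_localize L m : m \in L ->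
  dual_of (localize L m) = dual_of L `&` [set v | pairing (toR R m) v = 0].
Proof.
move=> mL; apply/seteqP; split=> [v vL|v [vL /= vm] l /localizeP[N lN]].
  split=> [l lL|/=]; first by apply: vL; exact: sub_localize.
  apply/eqP; rewrite eq_le; apply/andP; split; last by apply: vL;
    exact: sub_localize.
  rewrite -oppr_ge0 -(addr0 (- _)) -[X in 0 <= _ + X](pairing0l v).
  have := vL _ (localizeN L m); congr (_ <= _).
  apply/eqP; rewrite eq_sym addrC subr_eq -pairing_toRD addNr /toR raddf0.
  by [].
by have := vL _ lN; rewrite pairing_toRD pairing_toRMn vm mul0rn addr0.
Qed.

Lemma face_localize L m : m \in L -> face (dual_of (localize L m)) (dual_of L).
Proof.
move=> mL; rewrite dual_of_localize//; exists (toR R m) => // v vL.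
exact: vL.
Qed.

End DualCone.

Arguments dual_of R {n} L.

(** * The fan of the charts *)

Section FanOfCharts.
Context (k : closedFieldType) (R : realType) (X : fspace k) (n : nat).
Notation M := 'rV[int]_n.
Context (e : tspec k M -> X).
Hypothesis (sepX : separated X) (oe : open_immersion e).
Implicit Types L : addrClosed M.

Let Msep := @torus_separates k n.

Lemma dual_of_ext L L' : L =i L' -> dual_of R L = dual_of R L'.
Proof. by move=> LL'; apply/seteqP; split=> v vL m; [rewrite -LL'|rewrite LL'];
  exact: vL. Qed.

Lemma chart_monoid_group L m : chart_monoid e L ->
  exists l l', [/\ l \in L, l' \in L & l + m = l'].
Proof. by move=> [[f cf] _]; exact: (chart_group Msep oe m cf). Qed.

(** An integral point in the relative interior of the common cone has limits in both charts; the
    comparison there, and not saturation, identifies the monoids. *)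
Lemma dual_of_inj L L' : chart_monoid e L -> chart_monoid e L' ->
  dual_of R L = dual_of R L' -> L =i L'.
Proof.
move=> cL cL' LL'; have [_ [g Lg]] := cL; have [_ [g' Lg']] := cL'.
have [v vP] := dual_of_interior R Lg.
have LP l : l \in L -> forall u, dual_of R L u -> 0 <= pairing (toR R l) u.
  by move=> lL u; apply.
have LP' l : l \in L' -> forall u, dual_of R L u -> 0 <= pairing (toR R l) u.
  by move=> lL u; rewrite LL'; apply.
apply: (chart_monoid_weight Msep sepX (v := pair_with v) cL cL').
- by move=> l /LP/vP[].
- by move=> l /LP'/vP[].
- by move=> l lL vl; apply: (dual_of_orthogonalN (R := R) Lg lL);
     have [_] := vP l (LP l lL); apply.
move=> l lL vl; apply: (dual_of_orthogonalN (R := R) Lg' lL); rewrite -LL'.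
by have [_] := vP l (LP' l lL); apply.
Qed.

Lemma chart_monoid_inter L L' : chart_monoid e L -> chart_monoid e L' ->
  exists m m', [/\ m \in L, m' \in L', localize L m =i localize L' m' &
    dual_of R (localize L m) = dual_of R L `&` dual_of R L'].
Proof.
move=> cL cL'; have [_ [g Lg]] := cL; have [_ [g' Lg']] := cL'.
(* [P] is the sum of the two monoids, whose dual cone is the intersection of theirs; it provides an
   integral point in the relative interior of that intersection. *)
have [P PE] := generated_monoid (g ++ g').
have LP l : l \in L -> l \in P.
  move: l; apply: (gen_ind Lg) => [|a b _ _|a ag]; rewrite ?rpred0//.
    exact: rpredD.
  by apply: (gen_mem PE); rewrite mem_cat ag.
have LP' l : l \in L' -> l \in P.
  move: l; apply: (gen_ind Lg') => [|a b _ _|a ag]; rewrite ?rpred0//.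
    exact: rpredD.
  by apply: (gen_mem PE); rewrite mem_cat ag orbT.
have dualP : dual_of R P = dual_of R L `&` dual_of R L'.
  apply/seteqP; split=> [v vP|v [vL vL']].
    by split=> l lL; apply: vP; [exact: LP|exact: LP'].
  apply: (dual_of_gen PE) => a; rewrite mem_cat =>
    /orP[/(gen_mem Lg)|/(gen_mem Lg')].
    exact: vL.
  exact: vL'.
have [v vP] := dual_of_interior R PE.
have PP l : l \in P -> forall u, dual_of R P u -> 0 <= pairing (toR R l) u.
  by move=> lL u; apply.
have vL l : l \in L -> 0 <= pair_with v l by move=> /LP/PP/vP[].
have vL' l : l \in L' -> 0 <= pair_with v l by move=> /LP'/PP/vP[].
have [m [mL vm m0 mN]] := face_localize_weight (v := pair_with v) cL vL.
have [m' [mL' vm' m0' mN']] := face_localize_weight (v := pair_with v) cL' vL'.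
have mm' : localize L m =i localize L' m'.
  exact: (chart_monoid_weight Msep sepX (v := pair_with v)
    (chart_monoid_localize mL cL) (chart_monoid_localize mL' cL')).
exists m, m'; split=> //; rewrite -dualP; apply/seteqP; split=> u.
  move=> uL; rewrite dualP; split.
    by move: uL; rewrite dual_of_localize// => -[].
  by move: uL; rewrite (dual_of_ext mm') dual_of_localize// => -[].
(* [m] vanishes at the relative interior point [v], hence on the whole intersection. *)
move=> uP; rewrite dual_of_localize//; split.
  by move: uP; rewrite dualP => -[].
by have [_] := vP m (PP m (LP m mL)); apply.
Qed.

(** All finitely generated charts contribute, including every localization of a chart, so that no
    cone has to be added to obtain the faces. *)
Definition chart_cones : set (set 'cV[R]_n) :=
  [set s | exists2 L, chart_monoid e L & s = dual_of R L].

Lemma chart_cones_face s t : chart_cones s -> face t s -> chart_cones t.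
Proof.
move=> [L cL ->]; have [_ [g Lg]] := cL; move=> /(face_dual_of Lg)[m mL ->].
exists (localize L m : addrClosed M); first exact: chart_monoid_localize.
by rewrite dual_of_localize.
Qed.

Lemma chart_cones_inter s t : chart_cones s -> chart_cones t ->
  [/\ chart_cones (s `&` t), face (s `&` t) s & face (s `&` t) t].
Proof.
move=> [L cL ->] [L' cL' ->].
have [m [m' [mL mL' mm' <-]]] := chart_monoid_inter cL cL'; split.
- by exists (localize L m : addrClosed M); first exact: chart_monoid_localize.
- exact: face_localize.
- by rewrite (dual_of_ext mm'); exact: face_localize.
Qed.

Context (p : nat) (U : 'I_p -> set X).
Hypothesis U_cover : forall x, exists i, U i x.
Hypothesis U_chart : forall i x, U i x ->
  exists L (g : seq M) (f : tspec k (submonoid L) -> X),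
  [/\ [set` L] = submonoid_gen [set` g], toric_chart e f & range f = U i].

(* The most special point of a chart lies in some U i, of which the chart is
   then a localization at a sum of generators. *)
Lemma chart_cones_finite : finite_set chart_cones.
Proof.
pose C i := [set s | exists L f x, [/\ chart_monoid e L, toric_chart e (L:=L) f,
  forall l, tval l x != 0 -> - val l \in L, s = dual_of R L & U i (f x)]].
have : chart_cones `<=` \bigcup_(i in setT) C i.
  move=> _ [L cL ->]; have [[f cf] _] := cL; have [x xL] := special_point k L.
  by have [i Ui] := U_cover (f x); exists i => //; exists L, f, x.
move/sub_finite_set; apply; apply: bigcup_finite => [|i _];
  first exact: finite_finset.
have [[x Ux]|U0] := pselect (exists x, U i x); last first.
  suff -> : C i = set0 by exact: finite_set0.
  apply/seteqP; split=> // s [L [f [x [_ _ _ _ Ufx]]]].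
  by apply: U0; exists (f x).
have [L [g [f [Lg cf fU]]]] := U_chart Ux.
(* A predicate on generators matters only through its values along [g], that is, through one of
   finitely many masks. *)
pose D (m : (size g).-tuple bool) :=
  dual_of R (localize L (\sum_(a <- mask m g) a)).
apply: (@sub_finite_set _ _ (range D)); last exact/finite_image/finite_finset.
move=> _ [L' [f' [x' [_ cf' xL' -> ]]]]; rewrite -fU => -[y _ fy].
have [b [_ LE]] := chart_monoid_at_point Msep cf Lg cf' fy xL'.
have bg : size (map b g) == size g by rewrite size_map.
exists (Tuple bg) => //; rewrite /D /= -filter_mask big_filter.
exact/esym/dual_of_ext.
Qed.

Lemma chart_cones_fan : is_fan chart_cones.
Proof.
split; [exact: chart_cones_finite| |exact: chart_cones_face|exact:
  chart_cones_inter].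
move=> _ [L cL ->]; have [_ [g Lg]] := cL; split.
  exact: dual_of_rational_polyhedral Lg.
by apply: dual_of_strictly_convex => m; exact: chart_monoid_group.
Qed.

Let cone_monoid_ex (s : chart_cones) :
  exists L, chart_monoid e L /\ val s = dual_of R L.
Proof. by have := valP s; rewrite in_setE => -[L cL sL]; exists L. Qed.

(** The choice is harmless: by [dual_of_inj] the cone determines the membership predicate of the
    monoid. *)
Definition cone_monoid (s : chart_cones) : addrClosed M :=
  sval (cid (cone_monoid_ex s)).

Lemma cone_monoid_chart s : chart_monoid e (cone_monoid s).
Proof. by have [] := svalP (cid (cone_monoid_ex s)). Qed.

Lemma cone_monoid_dual s : val s = dual_of R (cone_monoid s).
Proof. by have [] := svalP (cid (cone_monoid_ex s)). Qed.

Lemma cone_monoid_fg (s : chart_cones) : exists g : seq M,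
  [set` cone_monoid s] = submonoid_gen [set` g].
Proof. by case: (cone_monoid_chart s). Qed.

Lemma cone_monoid_nonneg (s : chart_cones) m :
  m \in cone_monoid s -> dual_cone (val s) (toR R m).
Proof. by move=> mL v; rewrite cone_monoid_dual; exact. Qed.

Lemma cone_monoid_group (s : chart_cones) : subgroup_gen [set` cone_monoid s] =
  setT.
Proof.
apply/seteqP; split=> // m _ B [[B0 BB] LB].
have [l [l' [lL l'L lm]]] := chart_monoid_group m (cone_monoid_chart s).
have -> : m = l' - l by rewrite -lm addrAC subrr add0r.
by have := BB l' l; rewrite !inE; apply; exact: LB.
Qed.

Lemma cone_monoid_cone (s : chart_cones) :
  cone [set toR R m | m in [set` cone_monoid s]] = dual_cone (val s).
Proof.
have [g Lg] := cone_monoid_fg s.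
by rewrite cone_monoid_dual (cone_bidual R Lg).
Qed.

Lemma cone_monoid_localize (s t : chart_cones) m : m \in cone_monoid s ->
  val t = val s `&` [set v | pairing (toR R m) v = 0] ->
  cone_monoid t =i localize (cone_monoid s) m.
Proof.
move=> mL tE; apply: dual_of_inj; first exact: cone_monoid_chart.
  exact: chart_monoid_localize (cone_monoid_chart s).
by rewrite dual_of_localize// -!cone_monoid_dual.
Qed.

(** Both sides are the localization at an [m] of the larger cone's monoid that cuts out the face.
    Such an [m] lies in the face lattice, and conversely every generator of the face lattice is
    orthogonal to the face, hence a unit in the monoid of [t] by [dual_of_orthogonalN]. *)
Lemma cone_monoid_face (s t : chart_cones) : face (val t) (val s) ->
  [set` cone_monoid t] =
  [set a + b | a in [set` cone_monoid s] &
               b in face_lattice (val t) [set` cone_monoid s]].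
Proof.
have [g Lg] := cone_monoid_fg s; have [g' Lg'] := cone_monoid_fg t.
rewrite {1}[val s]cone_monoid_dual => /(face_dual_of Lg)[m mL].
rewrite -cone_monoid_dual => tE; have tL := cone_monoid_localize mL tE.
apply/seteqP; split=> [l|_ [a aL [b bL <-]]] /=.
  rewrite tL => /localizeP[N lN].
  exists (l + m *+ N) => //; exists (- (m *+ N)); last by rewrite addrK.
  move=> B [[B0 BB] LB]; have Bm : B m.
    by apply: LB; split=> //= v; rewrite tE => -[].
  have BN x : B x -> B (- x).
    by move=> Bx; have := BB 0 x; rewrite !inE sub0r; apply=> //;
      rewrite inE in B0.
  apply: (BN); elim: N {lN} => [|N IH]; first by rewrite mulr0n;
    rewrite inE in B0.
  rewrite mulrS -[m *+ N]opprK; have := BB m (- (m *+ N)).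
  by rewrite !inE; apply=> //; exact: BN.
apply: rpredD.
  by rewrite tL; exact: sub_localize.
have [] : [set b | b \in cone_monoid t /\ - b \in cone_monoid t] b; last by [].
apply: bL; split.
  split; first by rewrite inE /= oppr0 rpred0.
  move=> x y; rewrite !inE /= => -[xt xNt] [yt yNt].
  by rewrite opprB [y - x]addrC !rpredD.
move=> l [/= lL lt]; have lt' : l \in cone_monoid t by rewrite tL;
  exact: sub_localize.
split=> //; apply: (dual_of_orthogonalN (R := R) Lg' lt') => v.
by rewrite -cone_monoid_dual; exact: lt.
Qed.

Definition chart_triple : toric_triple R :=
  ToricTriple chart_cones_fan cone_monoid_fg cone_monoid_nonneg
    cone_monoid_group
    cone_monoid_cone cone_monoid_face.

End FanOfCharts.

(** * Gluing *)

Section Gluing.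
Context (k : closedFieldType) (R : realType) (D : toric_triple R) (X : fspace
  k).
Context (f : forall s : fan D, chart k s -> X).
Hypothesis f_open : forall s, open_immersion (@f s).
Hypothesis f_cover : forall x, exists s (y : chart k s), f y = x.
Hypothesis f_restrict : forall s t (y : chart k t) (x : chart k s),
  val t `<=` val s -> restricts y x -> f x = f y.
Hypothesis f_glued : forall s u (x : chart k s) (y : chart k u), f x = f y ->
  glued (Tagged (@chart k R D) x) (Tagged (@chart k R D) y).
Arguments chart_map {k R D s} x.

Let glue_eq (p q : charts k D) : clos_refl_sym_trans _ (@glued k R D) p q ->
  f (tagged p) = f (tagged q).
Proof.
elim=> {p q} [p q [t [tE [y [yp yq]]]]|//|p q _ //|p q r _ pq _ qr].
  rewrite (f_restrict _ yp); last by rewrite tE => v [].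
  by rewrite (f_restrict _ yq)// tE => v [].
by rewrite pq.
Qed.

(** [f_glued] makes points with the same image in [X] equivalent in a single step, and [f_restrict]
    makes the images constant on classes, so the generated equivalence is exactly equality in [X].
    Topology and regular functions are then compared on the open images of the charts. *)
Lemma toric_space_glue : exists Psi : X -> toric_space k D,
  isomorphism Psi /\ forall s (x : chart k s), Psi (f x) = chart_map x.
Proof.
have F1 x : exists p : toric_space k D, forall s (y : chart k s), f y = x ->
  p = chart_map y.
  have [s [y yx]] := f_cover x; exists (chart_map y) => t z zx.
  by apply/chart_map_eq/rst_step/f_glued; rewrite yx zx.
have F2 (p : toric_space k D) : exists x : X,
    forall s (y : chart k s), p = chart_map y -> x = f y.
  have [s [y ->]] := chart_mapP p; exists (f y) => t z /chart_map_eq/glue_eq.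
  exact.
have [Psi PsiP] := choice F1; have [Phi PhiP] := choice F2.
have PsiE s (y : chart k s) : Psi (f y) = chart_map y by exact: PsiP.
have PhiE s (y : chart k s) : Phi (chart_map y) = f y by exact: PhiP.
have PsiK : cancel Psi Phi.
  by move=> x; have [s [y <-]] := f_cover x; rewrite PsiE PhiE.
have PhiK : cancel Phi Psi.
  by move=> p; have [s [y ->]] := chart_mapP p; rewrite PhiE PsiE.
have preE (V : set (toric_space k D)) x : V (Psi x) -> exists s,
    (f (s:=s) @` (chart_map (s:=s) @^-1` V)) x.
  by move=> Vx; have [s [y yx]] := f_cover x; exists s, y => //=;
    rewrite -PsiE yx.
have subE (V : set (toric_space k D)) s :
    f (s:=s) @` (chart_map (s:=s) @^-1` V) `<=` Psi @^-1` V.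
  by move=> _ [y Vy <-]; rewrite /= PsiE.
have openV (V : set (toric_space k D)) s : open V ->
    open (f (s:=s) @` (chart_map (s:=s) @^-1` V)).
  by move=> /open_toric oV; have [_ _ + _] := f_open s; apply.
exists Psi; split=> //; exists Phi; split=> //; split.
- apply/continuousP => V oV; rewrite openE => x /preE[s xs].
  by apply: filterS (@subE V s) _; apply: open_nbhs_nbhs; split=> //;
    exact: openV.
- move=> V g oV rg; apply: regular_glue => [|x /preE[s xs]].
    rewrite openE => x /preE[s xs].
    by apply: filterS (@subE V s) _; apply: open_nbhs_nbhs; split=> //;
      exact: openV.
  exists (f (s:=s) @` (chart_map (s:=s) @^-1` V)); split=> //.
    exact: openV.
  have [_ _ _ rf] := f_open s; apply: rf.
    by move: oV => /open_toric; apply.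
  have -> : (g \o Psi) \o f (s:=s) = g \o chart_map (s:=s).
    by apply/funext => y /=; rewrite PsiE.
  exact: rg.
- apply/continuousP => V oV; apply/open_toric => s.
  have -> : chart_map (s:=s) @^-1` (Phi @^-1` V) = f (s:=s) @^-1` V.
    by apply/seteqP; split=> y /=; rewrite PhiE.
  by apply: open_preimage oV; case: (f_open s) => -[].
move=> V g oV rg; apply: (_ : toric_regular _ _) => s.
have -> : chart_map (s:=s) @^-1` (Phi @^-1` V) = f (s:=s) @^-1` V.
  by apply/seteqP; split=> y /=; rewrite PhiE.
have -> : (g \o Phi) \o chart_map (s:=s) = g \o f (s:=s).
  by apply/funext => y /=; rewrite PhiE.
by have [[_ mf] _ _ _] := f_open s; exact: mf.
Qed.

End Gluing.

Section ToricSpaceOfCharts.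
Context (k : closedFieldType) (R : realType) (X : fspace k) (n : nat).
Notation M := 'rV[int]_n.
Context (e : tspec k M -> X).
Hypothesis (sepX : separated X) (oe : open_immersion e).
Context (p : nat) (U : 'I_p -> set X).
Hypothesis U_cover : forall x, exists i, U i x.
Hypothesis U_chart : forall i x, U i x ->
  exists L (g : seq M) (f : tspec k (submonoid L) -> X),
  [/\ [set` L] = submonoid_gen [set` g], toric_chart e f & range f = U i].
Implicit Types L : addrClosed M.

Let Msep := @torus_separates k n.
Let D : toric_triple R := chart_triple R sepX oe U_cover U_chart.

Let monoid (s : fan D) : addrClosed M := semigroup D s.

Let monoid_chart (s : fan D) : chart_monoid e (monoid s).
Proof. exact: (cone_monoid_chart s). Qed.

Let monoid_dual (s : fan D) : val s = dual_of R (monoid s).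
Proof. exact: (cone_monoid_dual s). Qed.

Let fan_of (s : set 'cV[R]_n) : chart_cones e s -> exists t : fan D, val t = s.
Proof. by move=> Fs; exists (SigSub (mem_set Fs)). Qed.

Let monoid_sub (s t : fan D) : val t `<=` val s ->
  {subset monoid s <= monoid t}.
Proof.
move=> ts l lL; have tE : val s `&` val t = val t.
  by apply/seteqP; split=> v; [case|move=> vt; split=> //; exact: ts].
have Fs : chart_cones e (val s) by have := valP s; rewrite in_setE.
have Ft : chart_cones e (val t) by have := valP t; rewrite in_setE.
have [_ st _] := chart_cones_inter sepX Fs Ft.
rewrite tE in st.
suff : [set` monoid t] l by [].
rewrite (@semigroup_face R D s t st); exists l => //; exists 0;
  last by rewrite addr0.
by move=> B [[B0 _] _]; rewrite inE in B0.
Qed.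

Let monoid_of L : chart_monoid e L ->
  exists s : fan D, val s = dual_of R L /\ monoid s =i L.
Proof.
move=> cL; have [|s sE] := @fan_of (dual_of R L); first by exists L.
exists s; split=> //; apply: (dual_of_inj (R := R) sepX) => //.
by rewrite -monoid_dual.
Qed.

Let chart_fun (s : fan D) : exists f : chart k s ->
  X, toric_chart e (L:=monoid s) f.
Proof. by case: (monoid_chart s) => [[f cf] _]; exists f. Qed.

Let f (s : fan D) : chart k s -> X := sval (cid (chart_fun s)).

Let f_chart s : toric_chart e (L:=monoid s) (@f s).
Proof. exact: (svalP (cid (chart_fun s))). Qed.

Let f_cover x : exists s (y : chart k s), f y = x.
Proof.
have [i Ui] := U_cover x; have [L [g [fL [Lg cL fU]]]] := U_chart Ui.
have : range fL x by rewrite fU.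
move=> [y _ yx]; have [|s [_ sL]] := @monoid_of L; first by split;
  [exists fL|exists g].
have s_sub : {subset monoid s <= L} by move=> l; rewrite sL.
exists s, (tres (incl s_sub) y); rewrite -yx; apply/esym.
exact: (chart_restrict Msep sepX s_sub y (f_chart s) cL).
Qed.

Let restricts_tres (s t : fan D) (y : chart k t) (x : chart k s)
  (st : {subset monoid s <= monoid t}) : restricts y x -> x = tres (incl st) y.
Proof.
by move=> yx; apply: tspec_ext => a; rewrite tresE; exact: yx.
Qed.

Let f_restrict (s t : fan D) (y : chart k t) (x : chart k s) :
  val t `<=` val s -> restricts y x -> f x = f y.
Proof.
move=> /monoid_sub st yx; rewrite (restricts_tres st yx); apply/esym.
exact: (chart_restrict Msep sepX st y (f_chart s) (f_chart t)).
Qed.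

(** [glued] asks for a point in the chart of the intersection cone, while the chart [L] around the
    common point may be a further localization of it. The cone of [L] lies in the intersection,
    which gives the inclusion of monoids along which [z] is mapped. *)
Let f_glued (s u : fan D) (x : chart k s) (y : chart k u) : f x = f y ->
  glued (Tagged (@chart k R D) x) (Tagged (@chart k R D) y).
Proof.
move=> xy; have [L [fL [z [cL LM sL uL zx]]]] :=
  chart_common_point Msep (f_chart s) (f_chart u) (monoid_chart s)
    (monoid_chart u) xy.
have Fs : chart_cones e (val s) by have := valP s; rewrite in_setE.
have Fu : chart_cones e (val u) by have := valP u; rewrite in_setE.
have [Fsu _ _] := chart_cones_inter sepX Fs Fu.
have [t tE] := fan_of Fsu.
have [w [wL wE]] := monoid_of LM.
have tL : {subset monoid t <= L}.
  have wt : val w `<=` val t.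
    rewrite wL tE !monoid_dual => v vL; split=> l ls; apply: vL.
      exact: sL.
    exact: uL.
  by move=> l /(monoid_sub wt); rewrite wE.
exists t; split; first by rewrite tE.
pose z' : chart k t := tres (incl tL) z; exists z'.
have restr (s' : fan D) (x' : chart k s') : {subset monoid s' <= L} ->
    fL z = f x' -> restricts z' x'.
  move=> s'L zx' a b ab.
  have -> : x' = tres (incl s'L) z.
    have [[_ f_inj _ _] _] := f_chart s'; apply: f_inj; rewrite -zx'.
    exact: (chart_restrict Msep sepX s'L z (f_chart s') cL).
  by rewrite /z' !tresE; congr (tval _ z); exact: val_inj.
by split; apply: restr => //; rewrite zx.
Qed.

Lemma toric_space_of_charts : exists Psi : X -> toric_space k D,
  isomorphism Psi /\ forall (alpha : X -> X) (s : torus k D), morphism alpha ->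
    (forall t, alpha (e t) = e (tmul s t)) ->
    forall x, Psi (alpha x) = toric_act s (Psi x).
Proof.
have f_open s : open_immersion (@f s) by case: (f_chart s).
have [Psi [isoPsi PsiE]] := toric_space_glue f_open f_cover f_restrict f_glued.
exists Psi; split=> // alpha s malpha alphae x.
have [t [y <-]] := f_cover x.
have := chart_equivariant Msep sepX y (f_chart t) malpha alphae.
move=> ->; rewrite PsiE [in RHS]PsiE toric_act_chart.
by [].
Qed.

End ToricSpaceOfCharts.

(** * Torus actions *)

Section Actions.
Context (k : fieldType).

Lemma cst_morphism (X Y : fspace k) (y : Y) : morphism (fun _ : X => y).
Proof.
have open_pre (V : set Y) : open ((fun _ : X => y) @^-1` V).
  rewrite preimage_cst; case: ifP => _; [exact: openT|exact: open0].
by split=> [|V g oV _]; [exact: cst_continuous|exact: regular_cst].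
Qed.

Lemma action_morphism (G : alg_group k) (X : fspace k) (act : G -> X -> X) g :
  algebraic_action act -> morphism (act g).
Proof.
move=> [_ _ mact].
have idm : morphism (@id X) by split=> [x|V h].
have mg := @cst_morphism X G g.
exact: (morphism_comp (pairing_morphism mg idm) mact).
Qed.

Lemma isomorphism_inv (X Y : fspace k) (f : X -> Y) (g : Y -> X) :
  morphism f -> morphism g -> cancel f g -> cancel g f -> isomorphism g.
Proof. by move=> mf mg fK gK; exists f. Qed.

Lemma irreducible_meets (X : fspace k) (V W : set X) : irreducible X ->
  open V -> open W -> V !=set0 -> W !=set0 -> (V `&` W) !=set0.
Proof.
move=> [_ irr] oV oW [v Vv] [w Ww]; apply: contrapT => VW.
have [||||] := irr (~` V) (~` W);
  [exact: open_closedC|exact: open_closedC| | |].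
- apply/seteqP; split=> // x _; have [Vx|] := pselect (V x); last by left.
  by right=> Wx; apply: VW; exists x.
- by move=> VT; have : (~` V) v by rewrite VT.
by move=> WT; have : (~` W) w by rewrite WT.
Qed.

End Actions.

Theorem theorem7p6 (k : closedFieldType) (R : realType)
    (T : alg_group k) (X : fspace k) (j : T -> X) (act : T -> X -> X)
    (hX : toric_variety j act) :
  exists (D : toric_triple R) (phi : T -> torus k D),
    torus_isomorphism phi /\
    exists Psi : X -> toric_space k D,
      isomorphism Psi /\
      forall (t : T) (x : X), Psi (act t x) = toric_act (phi t) (Psi x).
Proof.
case: hX => [[n [phi [[psi [mphi mpsi phiK psiK]] phiM]]] _ irrX sepX actX
  goodX oj ext].
pose e : tspec k 'rV[int]_n -> X := j \o psi.
have oe : open_immersion e.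
  apply: open_immersion_comp oj; apply: isomorphism_open_immersion.
  exact: isomorphism_inv mphi mpsi phiK psiK.
have actE s t : act s (e t) = e (tmul (phi s) t).
  by rewrite /e /= ext -[t in RHS]psiK -phiM phiK.
have mact s : morphism (act s) := action_morphism s actX.
have [p [U [affU covU invU]]] := goodX.
have [t0 _] := trivial_point k 'rV[int]_n.
have e_dense (V : set X) : open V -> V !=set0 -> exists t, V (e t).
  move=> oV V0; have [|x [Vx [t _ tx]]] :=
    irreducible_meets irrX oV (open_range oe) V0.
    by exists (e t0), t0.
  by exists t; rewrite tx.
have U_cover x : exists i, U i x.
  by have : [set: X] x by []; rewrite -covU => -[i _ Ui]; exists i.
(* [alg_group] states a left unit and left inverses; commutativity, transported from T^M, also gives
   the right unit needed to write one torus point as a translate of another. *)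
have mulC : commutative (@group_mul k T).
  move=> a b; apply: (can_inj phiK); rewrite !phiM; apply: tspec_ext => m.
  by rewrite !tactE mulrC.
have U_chart i x : U i x -> exists L (g : seq 'rV[int]_n) (f : tspec k
  (submonoid L) -> X),
    [/\ [set` L] = submonoid_gen [set` g], toric_chart e f & range f = U i].
  move=> Uix; have [oU [A [f [fgA of_ fU]]]] := affU i; rewrite -fU.
  (* A nonempty invariant open set meets the open orbit by irreducibility, and therefore contains
     it. The point [x] rules out the empty members of the cover, which have no toric chart. *)
  have [t1 Ut1] : exists t, U i (e t) by apply: e_dense => //; exists x.
  apply: (affine_toric_chart (@torus_separates k n) oe (lattice_sgalg_fg k n)
    e_dense fgA of_).
    move=> t; rewrite fU; pose a := psi t; pose b := psi t1.
    have -> : e t = act (group_mul a (group_inv b)) (e t1).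
      rewrite /e /= ext -/a -/b -group_mulA group_mulV mulC group_mul1.
      by [].
    exact: invU.
  move=> s; exists (act (psi s)); split; first exact: mact.
    by move=> t; rewrite actE psiK.
  by move=> y; rewrite fU; apply: invU; rewrite -fU; exists y.
have [Psi [isoPsi PsiE]] := toric_space_of_charts R sepX oe U_cover U_chart.
exists (chart_triple R sepX oe U_cover U_chart), phi; split.
  by split=> //; exists psi.
exists Psi; split=> // t x; apply: PsiE; first exact: mact.
exact: actE.
Qed.
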